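(* Let $1\le p<\infty$, and let $w\in A_{p,loc}(\mathcal{H}^n)$ be such that there exists a real number $\delta<1$ such that for all integers $j,l,r\ge 1$ with $|l-j|\le r$ we have $$ w(\mathcal{C}_l\cap B_H(x,r))\lesssim e^{(n-1)\frac{r+l-j}{2}(p-\delta)}\,e^{(n-1)r\delta}\,w(x)\quad\text{for a.e. } x\in\mathcal{C}_j, $$ with implicit constant independent of $j,l,r,x$. Then $$\|Mf\|_{L^{p,\infty}(w)}\lesssim\|f\|_{L^p(w)}.$$ Furthermore, if $p<q<\infty$, then $$\|Tf\|_{L^q(w)}\lesssim\|f\|_{L^q(w)}$$ for every operator $T$ satisfying, for some $\gamma\ge 0$, the pointwise estimate $$|Tf(x)|\lesssim M^{loc}(|f|)(x)+\sum_{j\ge 1} j^{\gamma}A_j(|f|)(x)$$ (with implicit constant independent of $f$ and $x$). The implicit constants in the conclusions are independent of $f$.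
   Context: $\mathcal{H}^n$ ($n\ge2$) denotes the $n$-dimensional hyperbolic space, i.e. the unique (up to isometries) $n$-dimensional complete simply connected Riemannian manifold of constant sectional curvature $-1$; $\mu_n$ is its volume measure, $d_n$ its distance, and $B_H(x,r)=\{y: d_n(x,y)<r\}$. A base point $0\in\mathcal{H}^n$ is fixed (the origin in the ball model), and for a positive integer $j$, $\mathcal{C}_j=B_H(0,j)\setminus B_H(0,j-1)$. For $r>0$, $$A_r f(x)=\frac{1}{\mu_n(B_H(x,r))}\int_{B_H(x,r)}|f(y)|\,d\mu_n(y),$$ $Mf(x)=\sup_{r>0}A_rf(x)$ is the centered Hardy–Littlewood maximal function, and $M^{loc}f(x)=\sup_{0<r\le 2}A_rf(x)$. A weight is a non-negative measurable function $w$ on $\mathcal{H}^n$; $w(E)=\int_E w\,d\mu_n$ for measurable $E$. $L^p(w)$ is $L^p$ with respect to the measure $w\,d\mu_n$, and $\|g\|_{L^{p,\infty}(w)}=\sup_{\lambda>0}\lambda\, w(\{|g|>\lambda\})^{1/p}$. For $p>1$, a weight $w$ belongs to $A_{p,loc}(\mathcal{H}^n)$ if $$\sup_{0<r(B)\le 1}\left(\frac{1}{\mu_n(B)}\int_B w\,d\mu_n\right)\left(\frac{1}{\mu_n(B)}\int_B w^{-\frac{1}{p-1}}\,d\mu_n\right)^{p-1}<\infty,$$ the supremum being over all hyperbolic balls $B$ of radius $r(B)\le 1$; for $p=1$ the second factor is interpreted as usual as $\|w^{-1}\|_{L^\infty(B)}$, i.e. there is a constant $C$ with $\frac{1}{\mu_n(B)}\int_B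 w\,d\mu_n\le C\,\operatorname{ess\,inf}_B w$ for all balls $B$ of radius $\le 1$. $X\lesssim Y$ means $X\le CY$ for a finite constant $C$. *)

(* Defs.v *)
From HB Require Import structures.
From mathcomp Require Import all_boot all_order all_algebra.
From mathcomp Require Import all_classical all_reals all_analysis.
From mathcomp Require Import measurable_realfun ess_sup_inf.

Set Implicit Arguments.
Unset Strict Implicit.
Unset Printing Implicit Defensive.

Import Order.TTheory GRing.Theory Num.Theory.
Import numFieldNormedType.Exports.

Local Open Scope classical_set_scope.
Local Open Scope ring_scope.

Lemma sigma_finite_product d1 d2 (T1 : measurableType d1)
    (T2 : measurableType d2) (R : realType)
    (m1 : {sigma_finite_measure set T1 -> \bar R})
    (m2 : {sigma_finite_measure set T2 -> \bar R}) :
  sigma_finite setT (m1 \x m2)%E.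
Proof.
have /sigma_finiteP[F [TF ndF Foo]] := sigma_finiteT m1.
have /sigma_finiteP[G [TG ndG Goo]] := sigma_finiteT m2.
exists (fun k => F k `*` G k).
  rewrite -setXTT TF TG predeqE => -[x y]; split.
    move=> [/= [i _ Fix] [j _ Gjy]]; exists (maxn i j) => //; split.
    - by move: x Fix; exact/subsetPset/ndF/leq_maxl.
    - by move: y Gjy; exact/subsetPset/ndG/leq_maxr.
  by move=> [k _ []/= ? ?]; split; exists k.
move=> k; have [? ?] := Foo k; have [? ?] := Goo k.
split; first exact: measurableX.
by rewrite product_measure1E// lte_mul_pinfty// ge0_fin_numE.
Qed.

Section lebesgue_tuple.
Context {R : realType}.
Local Notation RM := (measurableTypeR R).

Definition tuple_of_pair (m : nat) (p : RM * m.-tuple RM) : m.+1.-tuple RM :=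
  [tuple of p.1 :: p.2].

Lemma measurable_tuple_of_pair (m : nat) :
  measurable_fun setT (@tuple_of_pair m).
Proof. exact: measurable_cons. Qed.

Section lebesgue_cons.
Variables (m : nat) (mu : {sigma_finite_measure set (m.-tuple RM) -> \bar R}).

Definition lebesgue_cons : set (m.+1.-tuple RM) -> \bar R :=
  pushforward (lebesgue_measure \x mu)%E (@tuple_of_pair m).

Let lebesgue_cons0 : lebesgue_cons set0 = 0%E.
Proof. by rewrite /lebesgue_cons /pushforward preimage_set0 measure0. Qed.

Let lebesgue_cons_ge0 A : (0 <= lebesgue_cons A)%E.
Proof. by rewrite /lebesgue_cons /pushforward measure_ge0. Qed.

Let lebesgue_cons_sigma_additive : semi_sigma_additive lebesgue_cons.
Proof.
move=> F mF tF mUF; rewrite /lebesgue_cons /pushforward preimage_bigcup.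
have mpre A : measurable A -> measurable (@tuple_of_pair m @^-1` A).
  by move=> mA; rewrite -[X in measurable X]setTI;
     exact: measurable_tuple_of_pair.
apply: measure_semi_sigma_additive.
- by move=> k; exact: mpre.
- apply/trivIsetP => /= i j _ _ ij; rewrite -preimage_setI.
  by move/trivIsetP : tF => /(_ _ _ _ _ ij) ->//; rewrite preimage_set0.
- by rewrite -preimage_bigcup; exact: mpre.
Qed.

HB.instance Definition _ := isMeasure.Build _ _ _ lebesgue_cons
  lebesgue_cons0 lebesgue_cons_ge0 lebesgue_cons_sigma_additive.

Let lebesgue_cons_sigma_finite : sigma_finite setT lebesgue_cons.
Proof.
have [F FT mF] :=
  @sigma_finite_product _ _ RM (m.-tuple RM) _ lebesgue_measure mu.
pose g (t : m.+1.-tuple RM) : RM * m.-tuple RM :=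
  (tnth t ord0, [tuple of behead t]).
have mg : measurable_fun setT g.
  apply: measurable_fun_pair; first exact: measurable_tnth.
  exact: measurable_behead.
have gK p : g (tuple_of_pair p) = p.
  by case: p => x t; congr pair; exact/val_inj.
exists (fun k => g @^-1` F k).
  by rewrite -preimage_bigcup -FT preimage_setT.
move=> k; have [mFk Fkoo] := mF k; split.
  by rewrite -[X in measurable X]setTI; exact: mg.
rewrite /lebesgue_cons /pushforward (_ : _ @^-1` _ = F k)//.
by apply/seteqP; split => p /=; rewrite gK.
Qed.

HB.instance Definition _ := Measure_isSigmaFinite.Build _ _ _ lebesgue_cons
  lebesgue_cons_sigma_finite.

End lebesgue_cons.

(* Lebesgue measure on R^m, built one coordinate at a time. *)
Fixpoint lebesgue_tuple (m : nat) :
    {sigma_finite_measure set (m.-tuple RM) -> \bar R} :=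
  match m return {sigma_finite_measure set (m.-tuple RM) -> \bar R} with
  | 0 => \d_ ([tuple] : 0.-tuple RM)
  | m'.+1 => lebesgue_cons (lebesgue_tuple m')
  end.

End lebesgue_tuple.

Definition arcosh {R : realType} (u : R) : R := ln (u + Num.sqrt (u ^+ 2 - 1)).

(* Hyperbolic space in the upper half-space model: the points (x', t) of
   R^(n-1) x R with t > 0, with Riemannian metric (|dx'|^2 + dt^2) / t^2. *)
Record hyperbolic (R : realType) (n : nat) := Hyperbolic {
  hbase : n.-1.-tuple (measurableTypeR R) ;
  hheight : measurableTypeR R ;
  hheight_gt0 : (0 : R) < hheight }.

Section hyperbolic_space.
Context {R : realType} {n : nat}.
Local Notation RM := (measurableTypeR R).
Local Notation H := (hyperbolic R n).

Definition hcoord (x : H) : n.-1.-tuple RM * RM := (hbase x, hheight x).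

(* The image under the Cayley transform of the origin of the ball model. *)
Definition horigin : H := @Hyperbolic R n [tuple of nseq n.-1 0] 1 ltr01.

HB.instance Definition _ := gen_eqMixin H.
HB.instance Definition _ := gen_choiceMixin H.
HB.instance Definition _ := isPointed.Build H horigin.

(* The Borel sigma-algebra of the half-space. *)
HB.instance Definition _ :=
  Measurable.copy H (g_sigma_algebra_preimageType hcoord).

Definition hdist (x y : H) : R :=
  arcosh (1 + (\sum_(i < n.-1) (tnth (hbase x) i - tnth (hbase y) i : R) ^+ 2
               + (hheight x - hheight y : R) ^+ 2)
              / (2 * (hheight x : R) * hheight y)).

Definition hball (x : H) (r : R) : set H := [set y | hdist x y < r].

(* The Riemannian volume element is t^(-n) dx' dt. *)
Definition hvolume (A : set H) : \bar R :=
  (\int[lebesgue_tuple n.-1 \x lebesgue_measure]_(p in hcoord @` A)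
     ((p.2 : R) ^- n)%:E)%E.

Let hcoord_inj : injective hcoord.
Proof.
move=> [x s s0] [y t t0] [/= xy st]; subst y t.
by congr Hyperbolic; exact: Prop_irrelevance.
Qed.

Let measurable_hcoord_image (A : set H) :
  measurable A -> measurable (hcoord @` A).
Proof.
move=> [B mB <-]; rewrite setTI.
rewrite (_ : _ @` _ = B `&` (snd @^-1` `]0%R, +oo[)).
  apply: measurableI => //; rewrite -[X in measurable X]setTI.
  by apply: (@measurable_snd _ _ _ RM) => //; exact: measurable_itv.
apply/seteqP; split => [_ [z Bz <-]|[x t] [Bxt /=]].
  by split => //=; rewrite in_itv/= andbT hheight_gt0.
rewrite in_itv/= andbT => t0.
by exists (@Hyperbolic R n x t t0).
Qed.

Let hvolume0 : hvolume set0 = 0%E.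
Proof. by rewrite /hvolume image_set0 integral_set0. Qed.

Let hvolume_ge0 A : (0 <= hvolume A)%E.
Proof.
apply: integral_ge0 => _ [z _ <-]; rewrite lee_fin.
by rewrite invr_ge0 exprn_ge0// ltW// hheight_gt0.
Qed.

Let hvolume_sigma_additive : semi_sigma_additive hvolume.
Proof.
move=> F mF tF mUF; rewrite /hvolume image_bigcup ge0_integral_bigcup.
- apply: is_cvg_ereal_nneg_natsum_cond => k _ _; exact: hvolume_ge0.
- by move=> k; exact: measurable_hcoord_image.
- apply/measurable_EFinP.
  apply: (eq_measurable_fun (fun p => expR (- n%:R * ln (p.2 : R)))).
    move=> p; rewrite inE => -[k _ [z _ <-]] /=.
    by rewrite mulNr expRN expRM_natl lnK// posrE hheight_gt0.
  apply: (measurable_funS measurableT) => //.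
  apply: measurableT_comp => //; apply: measurable_funM => //.
  exact: (measurableT_comp (@measurable_ln R) measurable_snd).
- move=> _ [k _ [z _ <-]]; rewrite lee_fin.
  by rewrite invr_ge0 exprn_ge0// ltW// hheight_gt0.
- apply/trivIsetP => i j _ _ ij.
  apply/seteqP; split => // _ [[z Fiz <-] [z' Fjz' /hcoord_inj zz']].
  move/trivIsetP : tF => /(_ _ _ I I ij)/seteqP[+ _].
  by apply; split; [exact: Fiz|rewrite -zz'].
Qed.

HB.instance Definition _ := isMeasure.Build _ _ _ hvolume
  hvolume0 hvolume_ge0 hvolume_sigma_additive.

Lemma measurable_hcoord : measurable_fun setT hcoord.
Proof. by move=> _ B mB; exists B. Qed.

Lemma measurable_hdist (x : H) : measurable_fun setT (hdist x).
Proof.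
have mheight : measurable_fun setT (fun y : H => hheight y : R).
  exact: (measurableT_comp (@measurable_snd _ _ _ RM) measurable_hcoord).
have mbase i : measurable_fun setT (fun y : H => tnth (hbase y) i : R).
  apply: (measurableT_comp (@measurable_tnth _ RM n.-1 i)).
  exact: (measurableT_comp (@measurable_fst _ _ _ RM) measurable_hcoord).
have minvheight : measurable_fun setT (fun y : H => (hheight y : R)^-1).
  apply: (eq_measurable_fun (fun y => expR (- ln (hheight y : R)))).
    by move=> y _; rewrite expRN lnK// posrE hheight_gt0.
  apply: measurableT_comp => //; apply: measurableT_comp => //.
  exact: (measurableT_comp (@measurable_ln R) mheight).
have marcosh : measurable_fun setT (@arcosh R).
  apply: (measurableT_comp (@measurable_ln R)).
  apply: measurable_funD => //.
  apply: (measurableT_comp (f := @Num.sqrt R)).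
    by apply: continuous_measurable_fun; exact: sqrt_continuous.
  by apply: measurable_funB => //; exact: measurable_funX.
apply: (measurableT_comp marcosh).
apply: measurable_funD => //; apply: measurable_funM.
  apply: measurable_funD.
    apply: measurable_sum => i; apply: measurable_funX.
    by apply: measurable_funB.
  by apply: measurable_funX; apply: measurable_funB.
under eq_fun do rewrite invfM.
exact: measurable_funM.
Qed.

Lemma measurable_hball (x : H) (r : R) : measurable (hball x r).
Proof.
rewrite (_ : hball x r = setT `&` hdist x @^-1` `]-oo, r[).
  by apply: measurable_hdist => //; exact: measurable_itv.
by rewrite setTI; apply/seteqP; split => y; rewrite /= in_itv.
Qed.

(* [hshell j] is the annulus C_j, for j >= 1. *)
Definition hshell (j : nat) : set H :=
  hball horigin j%:R `\` hball horigin (j%:R - 1).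

End hyperbolic_space.
Record weight d (T : measurableType d) (R : realType) := Weight {
  weight_fun :> T -> R ;
  weight_ge0 : forall x, 0 <= weight_fun x ;
  measurable_weight : measurable_fun setT weight_fun }.

Section weighted.
Context d (T : measurableType d) (R : realType).
Variables (mu : {measure set T -> \bar R}) (w : weight T R).

(* The measure w dmu. *)
Definition weighted (A : set T) : \bar R := (\int[mu]_(x in A) (w x)%:E)%E.

Let weighted0 : weighted set0 = 0%E.
Proof. by rewrite /weighted integral_set0. Qed.

Let weighted_ge0 A : (0 <= weighted A)%E.
Proof. by apply: integral_ge0 => x _; rewrite lee_fin weight_ge0. Qed.

Let weighted_sigma_additive : semi_sigma_additive weighted.
Proof.
apply: semi_sigma_additive_nng_induced => [|x].
  exact/measurable_EFinP/measurable_weight.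
by rewrite lee_fin weight_ge0.
Qed.

HB.instance Definition _ := isMeasure.Build _ _ _ weighted
  weighted0 weighted_ge0 weighted_sigma_additive.

End weighted.

Section norms.
Context d (T : measurableType d) (R : realType).
Local Open Scope ereal_scope.

Definition average (mu : set T -> \bar R) (A : set T) (f : T -> \bar R) : \bar R :=
  (mu A)^-1 * \int[mu]_(y in A) f y.

Definition weak_Lnorm (mu : set T -> \bar R) (p : R) (g : T -> \bar R) : \bar R :=
  ereal_sup [set l%:E * mu [set x | l%:E < `|g x|] `^ p^-1
            | l in [set l : R | (0 < l)%R]].

End norms.

Section maximal_operators.
Context {R : realType} {n : nat}.
Local Notation H := (hyperbolic R n).
Local Notation mu := (@hvolume R n).
Local Open Scope ereal_scope.

Definition ball_average (r : R) (f : H -> \bar R) (x : H) : \bar R :=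
  average mu (hball x r) (abse \o f).

Definition maximal (f : H -> \bar R) (x : H) : \bar R :=
  ereal_sup [set ball_average r f x | r in [set r : R | (0 < r)%R]].

Definition local_maximal (f : H -> \bar R) (x : H) : \bar R :=
  ereal_sup [set ball_average r f x | r in [set r : R | (0 < r <= 2)%R]].

(* In [\bar R] the inverse of 0 is +oo, so that w^(-1/(p-1)) is +oo where w
   vanishes. *)
Definition Ap_loc (p : R) (w : weight H R) : Prop :=
  if p == 1%R then
    exists2 C : R, (0 < C)%R &
      forall (x : H) (r : R), (0 < r <= 1)%R ->
        average mu (hball x r) (EFin \o w) <=
        C%:E * ess_inf (mrestr mu (measurable_hball x r)) (EFin \o w)
  else
    ereal_sup [set average mu (hball z.1 z.2) (EFin \o w) *
                   average mu (hball z.1 z.2)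
                     (fun y => (w y)%:E^-1 `^ (p - 1)^-1) `^ (p - 1)
              | z in [set z : H * R | (0 < z.2 <= 1)%R]] < +oo.

End maximal_operators.

(* Main.v *)
(* Sort the pairs x, y with d(x, y) < r by the step r - i between their shells,
   0 <= i <= 2r. The slice of B(x, r) lies in the lens B(x, r) `&` B(0, j), whose
   volume is O(e^((n-1) i/2)), while the hypothesis bounds the w-mass of the
   transposed slice at y by
     C e^((n-1) ((2r - i) (p - delta)/2 + r delta)) w(y).
   For q > p, Jensen's inequality on each slice and Tonelli's theorem bound the
   norm of A_r on L^q(w) by a polynomial in r times e^(- kappa r), hence the sum
   of the j^gamma A_j.
   For the weak type at large radii, f is first averaged at unit scale, which is
   bounded on L^p(w) by the hypothesis and makes f roughly constant on unit balls.
   Values above e^((n-1) r) are then felt only within distance r of the set where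
   they occur. Values below are cut, on each slice, at a height depending on r and
   i, in the manner of Naor and Tao: the small values add up to O(1), and
   Chebyshev's inequality for the others sums over r to the p-th power of f.
   At small radii the local A_p condition and a Vitali covering give the weak type.
   The strong type of M on L^q(w) follows by truncating f at dyadic levels. *)

Require Import Defs.
From HB Require Import structures.
From mathcomp Require Import all_boot all_order all_algebra.
From mathcomp Require Import all_classical all_reals all_analysis.
From mathcomp Require Import measurable_realfun ess_sup_inf.
From mathcomp Require Import ring lra.

Set Implicit Arguments.
Unset Strict Implicit.
Unset Printing Implicit Defensive.

Import Order.TTheory GRing.Theory Num.Theory.
Import numFieldNormedType.Exports.

Local Open Scope classical_set_scope.
Local Open Scope ring_scope.

(** * The distance of the half-space *)

(** Write [a] for [n - 1]. On L^q(w), Schur's test pairs the volume [expR (a * i / 2)] of a slice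
    with the weight of its transpose. After division by the volume of the ball, what is left is a
    decay with exponent [a * ((2 * r - i) / 2 * (q - p) + i / 2 * (1 - delta))]. For [q = p] it
    vanishes at [i = 0] for every [r]: the norms are bounded but not summable in [r], and this is
    why the heights of the cut must depend on both [r] and [i]. Maximal functions are never shown to
    be measurable. Bounds are stated with a measurable set containing a superlevel set, or with a
    measurable majorant, and integrals are compared by monotonicity alone. Functions are
    extended-real valued, so Jensen's and Hölder's inequalities are drawn from Young's inequality
    with a free parameter. The geometry is done with the cosh of the distance, which is rational in
    the coordinates and comes from the Lorentz form. *)

Section hyperbolic_functions.
Context {R : realType}.
Implicit Types (r u : R).

Definition cosh r : R := (expR r + expR (- r)) / 2.

Lemma arcosh_ge0 u : 1 <= u -> 0 <= arcosh u.
Proof.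
move=> u1; rewrite /arcosh ln_ge0//.
by rewrite (le_trans u1)// lerDl sqrtr_ge0.
Qed.

Lemma expR_arcosh u : 1 <= u -> expR (arcosh u) = u + Num.sqrt (u ^+ 2 - 1).
Proof.
move=> u1; rewrite /arcosh lnK// posrE.
by rewrite ltr_wpDr ?sqrtr_ge0// (lt_le_trans ltr01).
Qed.

Lemma expRN_arcosh u : 1 <= u -> expR (- arcosh u) = u - Num.sqrt (u ^+ 2 - 1).
Proof.
move=> u1; rewrite expRN expR_arcosh//.
have h : Num.sqrt (u ^+ 2 - 1) ^+ 2 = u ^+ 2 - 1.
  by rewrite sqr_sqrtr// subr_ge0 exprn_ege1.
have d0 : u + Num.sqrt (u ^+ 2 - 1) != 0.
  by rewrite gt_eqF// ltr_wpDr ?sqrtr_ge0// (lt_le_trans ltr01).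
apply: (mulfI d0); rewrite mulfV//.
by rewrite mulrC -subr_sqr h; ring.
Qed.

Lemma cosh_arcosh u : 1 <= u -> cosh (arcosh u) = u.
Proof. by move=> u1; rewrite /cosh expR_arcosh// expRN_arcosh//; field. Qed.

Lemma cosh_lt r1 r2 : 0 <= r1 -> r1 < r2 -> cosh r1 < cosh r2.
Proof.
move=> r10 r12; rewrite /cosh ltr_pM2r ?invr_gt0// !expRN.
have a1 : 1 <= expR r1 by rewrite -expR0 ler_expR.
have ab : expR r1 < expR r2 by rewrite ltr_expR.
set a := expR r1 in a1 ab *; set b := expR r2 in ab *.
have a0 : 0 < a by lra.
have b0 : 0 < b by lra.
rewrite -subr_gt0 (_ : _ - _ = (b - a) * (a * b - 1) / (a * b)); last first.
  by field; rewrite !gt_eqF.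
by rewrite divr_gt0 ?mulr_gt0//; nra.
Qed.

Lemma arcosh_lt u r : 1 <= u -> 0 <= r -> (arcosh u < r) = (u < cosh r).
Proof.
move=> u1 r0; apply/idP/idP => [ur|].
  by rewrite -[ltLHS]cosh_arcosh// cosh_lt// arcosh_ge0.
apply: contraTT; rewrite -!leNgt => ru.
rewrite -[leRHS]cosh_arcosh//.
by move: ru; rewrite le_eqVlt => /predU1P[->//|/cosh_lt]; move/(_ r0)/ltW.
Qed.

Lemma cosh_ge1 r : 1 <= cosh r.
Proof.
rewrite /cosh expRN; have := expR_gt0 r; set a := expR r => a0.
rewrite -subr_ge0 (_ : _ - _ = (a - 1) ^+ 2 / (2 * a)).
  by rewrite divr_ge0 ?sqr_ge0// mulr_ge0 ?ltW.
by field; rewrite gt_eqF.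
Qed.

Lemma cosh_le_expR r : 0 <= r -> cosh r <= expR r.
Proof.
move=> r0; rewrite /cosh; have : expR (- r) <= expR r by rewrite ler_expR; lra.
lra.
Qed.

Lemma expR_le_cosh r : expR r <= 2 * cosh r.
Proof. by rewrite /cosh; have := expR_gt0 (- r); lra. Qed.

Lemma cosh_arcoshD u v : 1 <= u -> 1 <= v ->
  cosh (arcosh u + arcosh v) =
  u * v + Num.sqrt (u ^+ 2 - 1) * Num.sqrt (v ^+ 2 - 1).
Proof.
move=> u1 v1; rewrite /cosh opprD !expRD !expR_arcosh// !expRN_arcosh//.
by field.
Qed.

(** [cosh r - 1] is half the square of [2 sinh (r / 2)], which is estimated through
    [1 + u <= expR u]. This compares small balls with Euclidean ones. *)
Lemma cosh_quadratic r : 0 <= r <= 1 -> r ^+ 2 / 4 <= cosh r - 1 <= 2 * r ^+ 2.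
Proof.
move=> /andP[r0 r1]; pose h := r / 2.
have -> : cosh r - 1 = (expR h - expR (- h)) ^+ 2 / 2.
  rewrite /cosh {1 2}(_ : r = h + h) ?/h ?opprD ?expRD; last by field.
  have : expR h * expR (- h) = 1 by rewrite -expRD subrr expR0.
  by set a := expR h; set b := expR (- h) => ab; lra.
have -> : r = 2 * h by rewrite /h; field.
have h0 : 0 <= h by rewrite /h; lra.
have h1 : h <= 1 / 2 by rewrite /h; lra.
have a1 := expR_ge1Dx h; have b1 := expR_ge1Dx (- h).
have ab : expR h * expR (- h) = 1 by rewrite -expRD subrr expR0.
move: (expR_gt0 h) (expR_gt0 (- h)) a1 b1 ab.
set a := expR h; set b := expR (- h) => a0 b0 a1 b1 ab.
have lo : 5 / 3 * h <= a - b.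
  have : b * (1 + h) <= 1 by rewrite -ab; nra.
  by nra.
have hi : a - b <= 4 * h.
  have : a * (1 - h) <= 1 by rewrite -ab; nra.
  by nra.
by apply/andP; split; nra.
Qed.

End hyperbolic_functions.

Lemma cauchy_schwarz_sum (R : realType) (I : finType) (a b : I -> R) (al be : R) :
  0 <= al -> 0 <= be -> \sum_i a i ^+ 2 = al ^+ 2 -> \sum_i b i ^+ 2 = be ^+ 2 ->
  - (\sum_i a i * b i) <= al * be.
Proof.
move=> al0 be0 ha hb.
have [al00|aln0] := eqVneq al 0.
  rewrite big1 ?oppr0 ?mulr_ge0// => i _.
  have /eqP : \sum_i a i ^+ 2 = 0 by rewrite ha al00 expr0n.
  rewrite psumr_eq0; last by move=> j _; exact: sqr_ge0.
  by move=> /allP/(_ i (mem_index_enum _)); rewrite sqrf_eq0 => /eqP ->; rewrite mul0r.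
have [be00|ben0] := eqVneq be 0.
  rewrite big1 ?oppr0 ?mulr_ge0// => i _.
  have /eqP : \sum_i b i ^+ 2 = 0 by rewrite hb be00 expr0n.
  rewrite psumr_eq0; last by move=> j _; exact: sqr_ge0.
  by move=> /allP/(_ i (mem_index_enum _)); rewrite sqrf_eq0 => /eqP ->; rewrite mulr0.
have ab0 : 0 < al * be by rewrite mulr_gt0// lt_neqAle eq_sym ?aln0 ?ben0.
have : 0 <= \sum_i (be * a i + al * b i) ^+ 2.
  by apply: sumr_ge0 => i _; exact: sqr_ge0.
under eq_bigr do rewrite sqrrD !exprMn.
rewrite 2!big_split/= -!mulr_sumr ha hb.
have -> : \sum_i be * a i * (al * b i) *+ 2 = 2 * (al * be) * \sum_i a i * b i.
  by rewrite mulr_sumr; apply: eq_bigr => i _; ring.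
move=> h.
have : 0 <= (al * be) * (al * be + \sum_i a i * b i) by lra.
by rewrite pmulr_rge0//; lra.
Qed.

Section distance.
Context {R : realType} {n : nat}.
Local Notation RM := (measurableTypeR R).
Local Notation H := (hyperbolic R n).
Implicit Types x y z : H.

Definition horiz (x : H) (i : 'I_n.-1) : R := tnth (hbase x) i.
Definition ht (x : H) : R := hheight x.

Lemma ht_gt0 x : 0 < ht x. Proof. exact: hheight_gt0. Qed.

(** The cosh of the distance, so that distance estimates become polynomial ones. *)
Definition cdist x y : R :=
  1 + (\sum_i (horiz x i - horiz y i) ^+ 2 + (ht x - ht y) ^+ 2) / (2 * ht x * ht y).

Lemma hdistE x y : hdist x y = arcosh (cdist x y). Proof. by []. Qed.

Lemma cdist_ge1 x y : 1 <= cdist x y.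
Proof.
rewrite /cdist lerDl divr_ge0//; last first.
  by rewrite ltW// !mulr_gt0 ?ht_gt0.
by rewrite addr_ge0 ?sqr_ge0// sumr_ge0// => i _; exact: sqr_ge0.
Qed.

Lemma cdistC x y : cdist x y = cdist y x.
Proof.
rewrite /cdist; congr (1 + _ / _); last by ring.
by congr (_ + _); [apply: eq_bigr => i _; ring|ring].
Qed.

Lemma cdistE x y : cdist x y =
  (\sum_i (horiz x i - horiz y i) ^+ 2 + ht x ^+ 2 + ht y ^+ 2) / (2 * ht x * ht y).
Proof.
rewrite /cdist; have := ht_gt0 x; have := ht_gt0 y.
move: (ht x) (ht y) (\sum_i _) => a b c b0 a0.
by field; rewrite !gt_eqF.
Qed.

Lemma hdist_ge0 x y : 0 <= hdist x y.
Proof. by rewrite hdistE arcosh_ge0// cdist_ge1. Qed.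

Lemma hdistC x y : hdist x y = hdist y x.
Proof. by rewrite !hdistE cdistC. Qed.

Lemma hdist_lt x y r : 0 <= r -> (hdist x y < r) = (cdist x y < cosh r).
Proof. by move=> r0; rewrite hdistE arcosh_lt// cdist_ge1. Qed.

Lemma cdist_cosh x y : cdist x y = cosh (hdist x y).
Proof. by rewrite hdistE cosh_arcosh// cdist_ge1. Qed.

(* In the hyperboloid model with apex [y], the cosh of the distance is minus the
   Lorentz product, so the inequality is Cauchy-Schwarz for the space part. *)
Lemma cdist_triangle x y z :
  cdist x z <= cdist x y * cdist y z +
    Num.sqrt (cdist x y ^+ 2 - 1) * Num.sqrt (cdist y z ^+ 2 - 1).
Proof.
pose p i := (horiz x i - horiz y i) / ht x.
pose q i := (horiz z i - horiz y i) / ht z.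
pose A := \sum_i (horiz x i - horiz y i) ^+ 2 + ht x ^+ 2.
pose B := \sum_i (horiz z i - horiz y i) ^+ 2 + ht z ^+ 2.
(* [a] and [b] are the space coordinates of [x] and [z] in the hyperboloid with apex [y]; the index
   [None] is the vertical direction. *)
pose a (i : option 'I_n.-1) :=
  if i is Some j then p j else (A - ht y ^+ 2) / (2 * ht x * ht y).
pose b (i : option 'I_n.-1) :=
  if i is Some j then q j else (B - ht y ^+ 2) / (2 * ht z * ht y).
have hx := ht_gt0 x; have hy := ht_gt0 y; have hz := ht_gt0 z.
have sum_opt (F : option 'I_n.-1 -> R) :
    \sum_i F i = F None + \sum_i F (Some i).
  rewrite (bigD1 None)//=; congr (_ + _).
  by rewrite (reindex_omap Some id)//=; [apply: eq_bigl => i; rewrite eqxx|case].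
have := @cauchy_schwarz_sum R (option 'I_n.-1) a b
  (Num.sqrt (cdist x y ^+ 2 - 1)) (Num.sqrt (cdist y z ^+ 2 - 1)).
rewrite !sqrtr_ge0 !sqr_sqrtr ?subr_ge0 ?exprn_ege1 ?cdist_ge1//.
move=> /(_ isT isT).
have -> : \sum_i a i ^+ 2 = cdist x y ^+ 2 - 1.
  rewrite sum_opt /= cdistE /p.
  under eq_bigr do rewrite exprMn.
  rewrite -mulr_suml /A; move: (\sum_i _) => c.
  by field; rewrite !gt_eqF.
have -> : \sum_i b i ^+ 2 = cdist y z ^+ 2 - 1.
  rewrite sum_opt /= cdistC cdistE /q.
  under eq_bigr do rewrite exprMn.
  rewrite -mulr_suml /B; move: (\sum_i _) => c.
  by field; rewrite !gt_eqF.
move=> /(_ erefl erefl); rewrite -lerBlDl; apply: le_trans.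
rewrite sum_opt/=.
have -> : \sum_i p i * q i =
    (\sum_i (horiz x i - horiz y i) * (horiz z i - horiz y i)) / (ht x * ht z).
  rewrite mulr_suml; apply: eq_bigr => i _; rewrite /p /q.
  by field; rewrite !gt_eqF.
have : \sum_i (horiz x i - horiz z i) ^+ 2 =
    \sum_i (horiz x i - horiz y i) ^+ 2 + \sum_i (horiz z i - horiz y i) ^+ 2
    - 2 * \sum_i (horiz x i - horiz y i) * (horiz z i - horiz y i).
  rewrite mulr_sumr -big_split -sumrB/=; apply: eq_bigr => i _; ring.
rewrite (cdistC y z) !cdistE /A /B => ->.
move: (\sum_i _) (\sum_i _) (\sum_i _) => c d e.
by rewrite le_eqVlt; apply/orP; left; apply/eqP; field; rewrite !gt_eqF.
Qed.

Lemma hdist_triangle x y z : hdist x z <= hdist x y + hdist y z.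
Proof.
rewrite leNgt; apply/negP => /cosh_lt.
rewrite addr_ge0 ?hdist_ge0// => /(_ isT).
rewrite -cdist_cosh !hdistE cosh_arcoshD ?cdist_ge1//.
by rewrite ltNge cdist_triangle.
Qed.

End distance.

(** * Monotone integrals and boxes *)

Section nonneg_integral.
Local Open Scope ereal_scope.
Context d (T : measurableType d) (R : realType).
Variable mu : {measure set T -> \bar R}.

(* Unlike [ge0_le_integral], no measurability is required: the integral of a
   nonnegative function is a supremum over the simple functions below it. *)
Lemma ge0_le_integral_nonmeasurable (D : set T) (f g : T -> \bar R) :
  (forall x, D x -> 0 <= f x) -> (forall x, D x -> f x <= g x) ->
  \int[mu]_(x in D) f x <= \int[mu]_(x in D) g x.
Proof.
move=> f0 fg; rewrite integral_mkcond [leRHS]integral_mkcond.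
have g0 x : D x -> 0 <= g x by move=> Dx; exact: le_trans (f0 x Dx) (fg x Dx).
rewrite !ge0_integralTE//.
- apply: ge_ereal_sup => _ [h hf <-]; apply: ereal_sup_ubound.
  exists h => //= x; apply: le_trans (hf x) _; rewrite !patchE; case: ifPn => //.
  by rewrite inE; exact: fg.
- by move=> x; rewrite patchE; case: ifPn => //; rewrite inE; exact: g0.
- by move=> x; rewrite patchE; case: ifPn => //; rewrite inE; exact: f0.
Qed.

Lemma ge0_subset_integral_nonmeasurable (D E : set T) (f : T -> \bar R) :
  D `<=` E -> (forall x, E x -> 0 <= f x) ->
  \int[mu]_(x in D) f x <= \int[mu]_(x in E) f x.
Proof.
move=> DE f0; rewrite integral_mkcond [leRHS]integral_mkcond.
apply: ge0_le_integral_nonmeasurable => x _; rewrite !patchE; case: ifPn => //.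
  by rewrite inE => /DE; exact: f0.
- by rewrite inE => Dx; rewrite ifT// inE; exact: DE.
- by move=> _; case: ifPn => //; rewrite inE; exact: f0.
Qed.

End nonneg_integral.

Section box_volume.
Context {R : realType}.
Local Notation RM := (measurableTypeR R).

Definition tuple_box m (c : 'I_m -> R) (rho : R) : set (m.-tuple RM) :=
  [set t | forall i, `|(tnth t i : R) - c i| <= rho].

Lemma measurable_tuple_box m (c : 'I_m -> R) rho : measurable (tuple_box c rho).
Proof.
rewrite (_ : tuple_box c rho =
  \bigcap_(i : 'I_m) ((fun t : m.-tuple RM => tnth t i : R) @^-1` `[c i - rho, c i + rho])).
  apply: fin_bigcap_measurable => // i _; rewrite -[X in measurable X]setTI.
  by apply: (@measurable_tnth _ RM m i) => //; exact: measurable_itv.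
apply/seteqP; split => [t tb i _|t tb i] /=.
  by have := tb i; rewrite in_itv/= ler_distl.
by have := tb i I; rewrite /= in_itv/= ler_distl.
Qed.

Lemma lebesgue_measure_segment (a b : R) : a <= b ->
  lebesgue_measure (`[a, b]%classic : set RM) = (b - a)%:E.
Proof.
move=> ab; rewrite [LHS](lebesgue_measure_itv `[a, b]%R) /= lte_fin.
case: ltP => h; first by rewrite EFinD.
by have /eqP -> : b == a; [rewrite eq_le h ab|rewrite subrr].
Qed.

Lemma lebesgue_tuple_box m (c : 'I_m -> R) (rho : R) : 0 <= rho ->
  lebesgue_tuple m (tuple_box c rho) = ((2 * rho) ^+ m)%:E.
Proof.
move=> rho0; elim: m c => [|m IH] c.
  by rewrite /= diracE mem_set ?expr0//; case.
rewrite /= /lebesgue_cons /pushforward.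
rewrite (_ : _ @^-1` _ = `[c ord0 - rho, c ord0 + rho]%classic `*`
     tuple_box (fun i => c (lift ord0 i)) rho).
  rewrite product_measure1E//; last exact: measurable_tuple_box.
  rewrite IH [X in (X * _)%E](@lebesgue_measure_segment (c ord0 - rho) (c ord0 + rho)); last by lra.
  by rewrite -EFinM exprS; congr (_ * _)%:E; ring.
apply/seteqP; split => [[a t] /= tb|[a t] /= [ai tb] i].
  split; first by have := tb ord0; rewrite /= in_itv/= ler_distl.
  by move=> i; have := tb (lift ord0 i); rewrite tnthS.
case: (unliftP ord0 i) => [j ->|->]; rewrite ?tnthS ?tnth0//.
by move: ai; rewrite in_itv/= ler_distl.
Qed.

End box_volume.

Section hyperbolic_box.
Context {R : realType} {n : nat}.
Local Notation RM := (measurableTypeR R).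
Local Notation H := (hyperbolic R n).
Local Notation mu := (@hvolume R n).
Implicit Types (x y : H) (c : 'I_n.-1 -> R).

Definition hbox c (rho a b : R) : set H :=
  [set y | (forall i, `|horiz y i - c i| <= rho) /\ a <= ht y <= b].

Lemma hbox_image c rho a b : 0 < a ->
  hcoord @` hbox c rho a b = tuple_box c rho `*` `[a, b]%classic.
Proof.
move=> a0; apply/seteqP; split => [_ [y [yc yt] <-]|[t u] /= [tc]].
  by split => //=; rewrite in_itv.
rewrite in_itv/= => /andP[au ub].
by exists (@Hyperbolic R n t u (lt_le_trans a0 au)) => //; split => //; apply/andP.
Qed.

Lemma measurable_hbox c rho a b : 0 < a -> measurable (hbox c rho a b).
Proof.
move=> a0; exists (tuple_box c rho `*` `[a, b]%classic).
  by apply: measurableX; [exact: measurable_tuple_box|exact: measurable_itv].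
rewrite setTI; apply/seteqP; split => y; rewrite /= in_itv/=; last by case.
by move=> [].
Qed.

Lemma hbox_product_measure c rho a b : 0 <= rho -> a <= b ->
  ((lebesgue_tuple n.-1 \x lebesgue_measure) (tuple_box c rho `*` `[a, b]%classic)
    = ((2 * rho) ^+ n.-1 * (b - a))%:E)%E.
Proof.
move=> rho0 ab; rewrite product_measure1E//; last first.
  exact: measurable_tuple_box.
rewrite [X in (X * _)%E](@lebesgue_tuple_box R)// EFinM.
by rewrite [X in (_ * X)%E](@lebesgue_measure_segment R a b).
Qed.

Lemma hvolume_hbox_le c rho a b : 0 <= rho -> 0 < a -> a <= b ->
  (mu (hbox c rho a b) <= (a ^- n * ((2 * rho) ^+ n.-1 * (b - a)))%:E)%E.
Proof.
move=> rho0 a0 ab; rewrite /hvolume hbox_image//.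
rewrite EFinM -(hbox_product_measure c rho0 ab) -integral_cst//=; last first.
  by apply: measurableX => //; exact: measurable_tuple_box.
apply: ge0_le_integral_nonmeasurable => -[t u] [_ /=]; rewrite in_itv/= => /andP[au ub].
  by rewrite lee_fin invr_ge0 exprn_ge0// (le_trans _ au)// ltW.
by rewrite lee_fin lef_pV2 ?posrE ?exprn_gt0// ?lerXn2r ?nnegrE//; lra.
Qed.

Lemma hvolume_hbox_ge c rho a b : 0 <= rho -> 0 < a -> a <= b ->
  ((b ^- n * ((2 * rho) ^+ n.-1 * (b - a)))%:E <= mu (hbox c rho a b))%E.
Proof.
move=> rho0 a0 ab; rewrite /hvolume hbox_image//.
rewrite EFinM -(hbox_product_measure c rho0 ab) -integral_cst//=; last first.
  by apply: measurableX => //; exact: measurable_tuple_box.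
apply: ge0_le_integral_nonmeasurable => -[t u] [_ /=]; rewrite in_itv/= => /andP[au ub].
  by rewrite lee_fin invr_ge0 exprn_ge0//; lra.
by rewrite lee_fin lef_pV2 ?posrE ?exprn_gt0// ?lerXn2r ?nnegrE//; lra.
Qed.

(** This makes Tonelli's theorem available on the product. The boxes stay away from height 0, where
    the density blows up. *)
Lemma hvolume_sigma_finite : sigma_finite setT mu.
Proof.
exists (fun k => hbox (fun=> 0) k.+1%:R k.+1%:R^-1 k.+1%:R).
  apply/esym; rewrite -subTset => y _.
  pose M := \sum_i `|horiz y i| + ht y + (ht y)^-1.
  have y0 := ht_gt0 y.
  have S0 : 0 <= \sum_i `|horiz y i| by apply: sumr_ge0.
  have i0 : 0 < (ht y)^-1 by rewrite invr_gt0.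
  have M0 : 0 <= M by rewrite /M; lra.
  have := truncnS_gt M; set k := Num.trunc M => Mk.
  exists k => //; split => [i|].
    rewrite subr0; apply: le_trans (ltW Mk).
    rewrite /M (bigD1 i)//= -!addrA lerDl.
    by rewrite addr_ge0 ?sumr_ge0// addr_ge0// ltW.
  apply/andP; split; last by apply: le_trans (ltW Mk); rewrite /M; lra.
  rewrite -[leRHS]invrK lef_pV2 ?posrE//.
  by apply: le_trans (ltW Mk); rewrite /M; lra.
move=> k; split; first exact: measurable_hbox.
apply: le_lt_trans (hvolume_hbox_le _ _ _ _) _; rewrite ?ltry//.
by rewrite (le_trans (y := 1))// ?invf_le1// ler1n.
Qed.

HB.instance Definition _ := Measure_isSigmaFinite.Build _ _ _ mu hvolume_sigma_finite.

End hyperbolic_box.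

(** * Volume of balls and lenses *)

Section volume_estimates.
Context {R : realType} {n : nat}.
Local Notation H := (hyperbolic R n).
Local Notation mu := (@hvolume R n).
Implicit Types (x y z : H) (c : 'I_n.-1 -> R).

Lemma hvolume_mono (A B : set H) : A `<=` B -> (mu A <= mu B)%E.
Proof.
move=> AB; rewrite /hvolume; apply: ge0_subset_integral_nonmeasurable.
  exact: image_subset.
by move=> _ [z _ <-]; rewrite lee_fin invr_ge0 exprn_ge0// ltW// hheight_gt0.
Qed.

(* The points of the half-space whose Lorentz product with a fixed timelike
   vector is small; both balls and lenses (intersections of two balls) are
   contained in such a set. It is covered by the boxes at heights
   [tau * 4 ^ k, tau * 4 ^ k.+1], where [tau = kappa ^ 2 / (2 K)]. *)
Definition paraboloid c (kappa K : R) : set H :=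
  [set y | \sum_i (horiz y i - c i) ^+ 2 + ht y ^+ 2 + kappa ^+ 2 < 2 * ht y * K].

Lemma ler_norm_of_sqr (u v : R) : 0 <= v -> u ^+ 2 <= v ^+ 2 -> `|u| <= v.
Proof.
move=> v0 uv; have : `|u| ^+ 2 <= v ^+ 2 by rewrite real_normK ?num_real.
by rewrite ler_sqr ?nnegrE.
Qed.

Lemma expr4_gt (a : R) : exists k : nat, a < 4 ^+ k.
Proof.
exists (Num.trunc a).+1; apply: lt_le_trans (truncnS_gt a) _.
by rewrite -natrX ler_nat ltnW// ltn_expl.
Qed.

(** The box of index [k] has width of order [kappa * 2 ^ k] at height of order [tau * 4 ^ k], hence
    volume of order [(2 ^- k * K / kappa) ^+ n.-1]. Since [n.-1 >= 1], this is summable in [k]. *)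
Lemma hvolume_paraboloid c (kappa K : R) : (2 <= n)%N -> 0 < kappa -> 0 < K ->
  (mu (paraboloid c kappa K) <= (6 * (8 * K / kappa) ^+ n.-1)%:E)%E.
Proof.
move=> n2 kappa0 K0; pose tau := kappa ^+ 2 / (2 * K).
have tau0 : 0 < tau by rewrite divr_gt0 ?exprn_gt0 ?mulr_gt0.
pose a k := tau * 4 ^+ k.
have a0 k : 0 < a k by rewrite mulr_gt0 ?exprn_gt0.
have aS k : a k.+1 = 4 * a k by rewrite /a exprS; ring.
pose F k := hbox (n := n) c (kappa * 2 ^+ k.+1) (a k) (a k.+1).
have SF : paraboloid c kappa K `<=` \bigcup_k F k.
  move=> y /= yS; have t0 := ht_gt0 y.
  have S0 : 0 <= \sum_i (horiz y i - c i) ^+ 2.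
    by apply: sumr_ge0 => i _; exact: sqr_ge0.
  have taut : tau < ht y.
    rewrite ltr_pdivrMr ?mulr_gt0//; move: S0 yS (sqr_ge0 (ht y)).
    by rewrite /paraboloid/=; move: (\sum_i _) => p; lra.
  have [k0 hk0] := expr4_gt (ht y / tau).
  have exk : exists k, ht y < a k.
    by exists k0; rewrite /a mulrC -ltr_pdivrMr.
  have [[|k] hk mink] := ex_minnP exk.
    by move: hk; rewrite /a expr0 mulr1 => hk; lra.
  exists k => //; split => [i|]; last first.
    rewrite (ltW hk) andbT leNgt; apply/negP => /mink.
    by rewrite ltnn.
  apply: ler_norm_of_sqr; first by rewrite mulr_ge0 ?exprn_ge0// ltW.
  have : (horiz y i - c i) ^+ 2 <= \sum_i (horiz y i - c i) ^+ 2.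
    by rewrite (bigD1 i)//= lerDl; apply: sumr_ge0 => j _; exact: sqr_ge0.
  move=> /le_trans; apply; rewrite exprMn -exprM mulnC exprM.
  have -> : (2 ^+ 2 : R) = 4 by ring.
  have : 2 * ht y * K <= 2 * a k.+1 * K by rewrite ler_pM2r// ler_pM2l// ltW.
  have -> : 2 * a k.+1 * K = kappa ^+ 2 * 4 ^+ k.+1.
    by rewrite /a /tau; field; rewrite gt_eqF.
  move: yS (sqr_ge0 kappa) (sqr_ge0 (ht y)).
  by rewrite /paraboloid/=; move: (\sum_i _) => p; lra.
apply: le_trans (hvolume_mono SF) _.
have mF k : measurable (F k) by exact: measurable_hbox.
apply: (@le_trans _ _ (\sum_(0 <= k <oo) mu (F k))%E).
  apply: measure_sigma_subadditive => //.
  by apply: bigcup_measurable => k _; exact: mF.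
have C0 : 0 <= 6 * (8 * K / kappa) ^+ n.-1.
  by rewrite mulr_ge0// exprn_ge0// divr_ge0 ?mulr_ge0// ltW.
(* The bound is shared out in parts proportional to [1 / 2 ^ k.+1]; this doubles the constant 3 of a
   single box. *)
apply: le_trans (epsilon_trick0 xpredT C0).
apply: lee_nneseries => k // _; apply: le_trans (hvolume_hbox_le _ _ _ _) _ => //.
- by rewrite mulr_ge0 ?exprn_ge0 ?ltW.
- by rewrite aS; have := a0 k; lra.
rewrite lee_fin aS.
have -> : a k ^- n * ((2 * (kappa * 2 ^+ k.+1)) ^+ n.-1 * (4 * a k - a k)) =
    3 * ((2 * (kappa * 2 ^+ k.+1)) / a k) ^+ n.-1.
  have : (n = n.-1.+1)%N by rewrite prednK// ltnW.
  move: (a k) (a0 k) (2 * _) => u u0 v; move: (n.-1) => m ->.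
  by rewrite exprS exprMn exprVn; field; rewrite !gt_eqF// exprn_gt0.
have -> : 2 * (kappa * 2 ^+ k.+1) / a k = (8 * K / kappa) * 2 ^- k.
  rewrite /a /tau exprS (_ : 4 = 2 ^+ 2); last by ring.
  rewrite -exprM mulnC exprM.
  by field; rewrite !gt_eqF// exprn_gt0.
rewrite exprMn natrX exprS.
have -> : 6 * (8 * K / kappa) ^+ n.-1 / (2 * 2 ^+ k) =
    3 * ((8 * K / kappa) ^+ n.-1 * 2 ^- k).
  by field; rewrite !gt_eqF// exprn_gt0.
rewrite ler_pM2l// ler_wpM2l//; first by rewrite exprn_ge0// divr_ge0 ?mulr_ge0// ltW.
have -> : n.-1 = n.-2.+1 by case: n n2 => [|[]].
have u0 : 0 <= 2 ^- k :> R by rewrite invr_ge0 exprn_ge0.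
have u1 : 2 ^- k <= 1 :> R by rewrite invf_le1 ?exprn_gt0// exprn_ege1// ler1n.
by rewrite exprS ler_piMr// exprn_ile1.
Qed.

(* With [a = expR (- r)] and [b = expR (- rho)], the linear combination
   [a * cdist x y + b * cdist z y] is less than 2 on the lens. *)
Lemma hball_lens_paraboloid x z (r rho : R) : 0 < r -> 0 < rho ->
  exists c kappa K, [/\ 0 < kappa, 0 < K,
    K / kappa <= 2 * expR ((r + rho - hdist x z) / 2) &
    hball x r `&` hball z rho `<=` paraboloid c kappa K].
Proof.
move=> r0 rho0; set s := ht x; set u := ht z.
have s0 : 0 < s by exact: ht_gt0.
have u0 : 0 < u by exact: ht_gt0.
pose a := expR (- r); pose b := expR (- rho).
have a0 : 0 < a by exact: expR_gt0.
have b0 : 0 < b by exact: expR_gt0.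
pose A := a / s + b / u.
have A0 : 0 < A by rewrite addr_gt0// divr_gt0.
(* [D] is the squared Lorentz length of the timelike vector [a x + b z] of the hyperboloid model. It
   exceeds [a * b * expR (hdist x z)], which gives the exponent of the lens. *)
pose D := a ^+ 2 + b ^+ 2 + 2 * a * b * cdist x z.
have d1 := cdist_ge1 x z.
have D0 : 0 < D by rewrite !addr_gt0 ?exprn_gt0 ?mulr_gt0// (lt_le_trans ltr01).
pose c i := (a / s * horiz x i + b / u * horiz z i) / A.
exists c, (Num.sqrt D / A), (2 / A); split.
- by rewrite divr_gt0// sqrtr_gt0.
- by rewrite divr_gt0.
- have -> : 2 / A / (Num.sqrt D / A) = 2 * (Num.sqrt D)^-1.
    by field; rewrite !gt_eqF// sqrtr_gt0.
  rewrite ler_pM2l// -[leRHS]invrK lef_pV2 ?posrE ?sqrtr_gt0 ?invr_gt0 ?expR_gt0//.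
  rewrite -expRN -ler_sqr ?nnegrE ?sqrtr_ge0 ?expR_ge0// sqr_sqrtr ?ltW//.
  rewrite -expRM_natl (_ : 2%:R * _ = - r - rho + hdist x z); last by field.
  rewrite !expRD -/a -/b; have := expR_le_cosh (hdist x z).
  rewrite -cdist_cosh => h; rewrite /D.
  have := ler_wpM2l (ltW (mulr_gt0 a0 b0)) h.
  by have := exprn_gt0 2 a0; have := exprn_gt0 2 b0; lra.
move=> y [/= yx yz].
have {}yx : a * cdist x y < 1.
  rewrite /hball/= hdist_lt ?ltW// in yx; have := cosh_le_expR (ltW r0) => h.
  by rewrite /a expRN -ltr_pdivlMl ?invr_gt0 ?expR_gt0// invrK mulr1; lra.
have {}yz : b * cdist z y < 1.
  rewrite /hball/= hdist_lt ?ltW// in yz; have := cosh_le_expR (ltW rho0) => h.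
  by rewrite /b expRN -ltr_pdivlMl ?invr_gt0 ?expR_gt0// invrK mulr1; lra.
have t0 := ht_gt0 y.
rewrite /paraboloid/= exprMn sqr_sqrtr ?ltW// exprVn.
have : a * cdist x y + b * cdist z y < 2 by lra.
rewrite -(ltr_pM2l (_ : 0 < 2 * ht y / A)); last by rewrite divr_gt0 ?mulr_gt0.
rewrite -mulrA mulrCA; congr (_ < _); last by ring.
rewrite /D !cdistE -/s -/u.
have -> : \sum_i (horiz y i - c i) ^+ 2 = (a / s / A) * \sum_i (horiz x i - horiz y i) ^+ 2
   + (b / u / A) * \sum_i (horiz z i - horiz y i) ^+ 2
   - (a / s * (b / u) / A ^+ 2) * \sum_i (horiz x i - horiz z i) ^+ 2.
  rewrite !mulr_sumr -big_split -sumrB/=; apply: eq_bigr => i _; rewrite /c /A.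
  field; rewrite !gt_eqF//.
  by rewrite addr_gt0// mulr_gt0.
move: (\sum_i _) (\sum_i _) (\sum_i _) => p q v.
rewrite /A; field; rewrite !gt_eqF//.
by rewrite addr_gt0// mulr_gt0.
Qed.

Lemma hvolume_lens_le : (2 <= n)%N -> exists2 C : R, 0 < C &
  forall x z (r rho : R), (mu (hball x r `&` hball z rho) <=
    (C * expR (n.-1%:R * ((r + rho - hdist x z) / 2)))%:E)%E.
Proof.
move=> n2; exists (6 * 16 ^+ n.-1); first by rewrite mulr_gt0 ?exprn_gt0.
move=> x z r rho.
have rhs0 : 0 <= 6 * 16 ^+ n.-1 * expR (n.-1%:R * ((r + rho - hdist x z) / 2)).
  by rewrite !mulr_ge0 ?exprn_ge0// expR_ge0.
have [r0|r0] := leP r 0.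
  rewrite (_ : _ `&` _ = set0) ?measure0 ?lee_fin//.
  apply/seteqP; split => // y [/= /lt_le_trans/(_ r0)].
  by rewrite ltNge hdist_ge0.
have [rho0|rho0] := leP rho 0.
  rewrite (_ : _ `&` _ = set0) ?measure0 ?lee_fin//.
  apply/seteqP; split => // y [_ /= /lt_le_trans/(_ rho0)].
  by rewrite ltNge hdist_ge0.
have [c [kappa [K [k0 K0 Kk sub]]]] := hball_lens_paraboloid x z r0 rho0.
apply: le_trans (hvolume_mono sub) _.
apply: le_trans (hvolume_paraboloid c n2 k0 K0) _.
rewrite lee_fin -[leRHS]mulrA ler_pM2l// expRM_natl -exprMn.
rewrite lerXn2r ?nnegrE ?mulr_ge0 ?expR_ge0 ?invr_ge0 ?(ltW K0) ?(ltW k0)//.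
by rewrite -mulrA; lra.
Qed.

(** A ball is the lens of itself with itself. *)
Lemma hvolume_hball_le : (2 <= n)%N -> exists2 C : R, 0 < C &
  forall x (r : R), (mu (hball x r) <= (C * expR (n.-1%:R * r))%:E)%E.
Proof.
move=> n2; have [C C0 HC] := hvolume_lens_le n2; exists C => // x r.
have := HC x x r r; rewrite setIid hdistE /arcosh.
have -> : cdist x x = 1.
  by rewrite /cdist big1 ?subrr ?expr0n ?addr0 ?mul0r ?addr0// => i _; rewrite subrr expr0n.
rewrite expr1n subrr sqrtr0 addr0 ln1 subr0.
by rewrite (_ : (r + r) / 2 = r)//; field.
Qed.

(** The density favours low heights: a box of width of order [ht x] at heights of order
    [ht x * expR (- r)], near the bottom of the ball, already has volume of order
    [expR (n.-1%:R * r)]. *)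
Lemma hvolume_hball_ge : (2 <= n)%N -> exists2 c : R, 0 < c &
  forall x (r : R), 1 <= r -> ((c * expR (n.-1%:R * r))%:E <= mu (hball x r))%E.
Proof.
move=> n2; have n0 : (0 < n)%N by rewrite ltnW.
have nr0 : 0 < n%:R :> R by rewrite ltr0n.
exists ((4 / 9) ^+ n * n%:R^-1 ^+ n.-1 * 4^-1).
  by rewrite !mulr_gt0 ?exprn_gt0// ?invr_gt0// mulr_gt0.
move=> x r r1; set s := ht x; have s0 : 0 < s by exact: ht_gt0.
pose E := expR (- r); have E0 : 0 < E by exact: expR_gt0.
have E2 : E <= 2^-1.
  rewrite /E expRN lef_pV2 ?posrE ?expR_gt0//.
  by have := expR_ge1Dx r; lra.
have sE0 : 0 < s * E by rewrite mulr_gt0.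
pose rho := s / (2 * n%:R).
have rho0 : 0 < rho by rewrite divr_gt0// mulr_gt0.
have : hbox (horiz x) rho (2 * (s * E)) (9 / 4 * (s * E)) `<=` hball x r.
  move=> y [yx /andP[ya yb]]; rewrite /hball/= hdist_lt; last by lra.
  rewrite cdistE ltr_pdivrMr; last by rewrite !mulr_gt0 ?ht_gt0.
  have : \sum_i (horiz x i - horiz y i) ^+ 2 <= s ^+ 2 / 8.
    apply: le_trans (_ : \sum_(i < n.-1) rho ^+ 2 <= _).
      apply: ler_sum => i _; rewrite -[leLHS]real_normK ?num_real//.
      by rewrite lerXn2r ?nnegrE ?(ltW rho0)// distrC.
    rewrite sumr_const card_ord -[leLHS]mulr_natl /rho.
    rewrite (_ : n.-1%:R * _ = s ^+ 2 / 8 * (n.-1%:R * 2 / n%:R ^+ 2)); last first.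
      by field; rewrite gt_eqF.
    rewrite ler_piMr ?divr_ge0 ?sqr_ge0//.
    rewrite ler_pdivrMr ?exprn_gt0// mul1r expr2 ler_pM// ?ler_nat ?leq_pred//.
  move: (\sum_i _) ya yb => p; set t := ht y; rewrite /cosh -/E -/s => ya yb hp.
  have EE : expR r * E = 1 by rewrite /E -expRD subrr expR0.
  have t0 : 0 < t by exact: ht_gt0.
  have -> : (expR r + E) / 2 * (2 * s * t) = s * t * expR r + s * t * E by field.
  have h1 : 2 * s ^+ 2 <= s * t * expR r.
    rewrite (_ : 2 * _ = 2 * (s * E) * (s * expR r)); last first.
      by rewrite -[LHS]mulr1 -EE; ring.
    by rewrite (_ : s * t * _ = t * (s * expR r)) ?ler_pM2r ?mulr_gt0 ?expR_gt0//; ring.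
  have h2 : t ^+ 2 <= (9 / 4 * (s * E)) * t by rewrite expr2 ler_pM2r.
  have h3 : s * E * t <= s * E * (9 / 4 * (s * E)) by rewrite ler_pM2l.
  have h4 : (s * E) ^+ 2 <= s ^+ 2 / 4.
    rewrite exprMn ler_pM2l ?exprn_gt0//; nra.
  have s2 : 0 < s ^+ 2 by rewrite exprn_gt0.
  by nra.
move=> /hvolume_mono; apply: le_trans.
apply: le_trans (hvolume_hbox_ge _ _ _ _); [|by rewrite ltW|by rewrite mulr_gt0|lra].
rewrite lee_fin mulrC.
have -> : expR (n.-1%:R * r) = E ^- n.-1.
  by rewrite /E expRN exprVn invrK expRM_natl.
rewrite le_eqVlt; apply/orP; left; apply/eqP.
have -> : 9 / 4 * (s * E) - 2 * (s * E) = (s * E) / 4 by field.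
have -> : 2 * rho = s * n%:R^-1 by rewrite /rho; field; rewrite gt_eqF.
have -> : (4 / 9 : R) = (9 / 4)^-1 by field.
have : (n = n.-1.+1)%N by rewrite prednK.
move: nr0; move: n%:R => N N0.
move: (n.-1) => m ->; rewrite !(exprS, exprMn, exprVn).
by field; rewrite !gt_eqF// ?exprn_gt0// exprn_gt0// divr_gt0.
Qed.

(** At radius at most 1 the heights in the ball are comparable to [ht x], so the ball lies between
    two boxes with sides of order [ht x * r]. *)
Lemma hvolume_small_hball : (2 <= n)%N -> exists c C : R, [/\ 0 < c, 0 < C &
  forall x (r : R), 0 < r <= 1 ->
    ((c * r ^+ n)%:E <= mu (hball x r) <= (C * r ^+ n)%:E)%E].
Proof.
move=> n2; have n0 : (0 < n)%N by rewrite ltnW.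
have nr0 : 0 < n%:R :> R by rewrite ltr0n.
have n1 : 1 <= n%:R :> R by rewrite ler1n.
exists ((2 * n%:R)^-1 ^+ n), (60 ^+ n); split.
- by rewrite exprn_gt0// invr_gt0 mulr_gt0.
- by rewrite exprn_gt0.
move=> x r /andP[r0 r1]; set s := ht x; have s0 : 0 < s by exact: ht_gt0.
have /andP[clo chi] : r ^+ 2 / 4 <= cosh r - 1 <= 2 * r ^+ 2.
  by apply: cosh_quadratic; rewrite ltW.
have sr0 : 0 < s * r by rewrite mulr_gt0.
have srs : s * r <= s by rewrite ger_pMr.
have r2 : 0 < r ^+ 2 <= 1 by rewrite exprn_gt0//= exprn_ile1// ltW.
have nE : (n = n.-1.+1)%N by rewrite prednK.
apply/andP; split.
  pose rho := s * r / (2 * n%:R).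
  have rho0 : 0 < rho by rewrite divr_gt0// mulr_gt0.
  have rhos : rho <= s / 2.
    rewrite /rho invfM mulrA ler_pdivrMr// (le_trans (y := s / 2))//.
      by rewrite ler_pM2r.
    by rewrite ler_peMr// divr_ge0// ltW.
  have : hbox (horiz x) rho (s - rho) (s + rho) `<=` hball x r.
    move=> y [yx /andP[ya yb]]; rewrite /hball/= hdist_lt; last by lra.
    rewrite /cdist -ltrBrDl ltr_pdivrMr; last by rewrite !mulr_gt0 ?ht_gt0.
    have : \sum_i (horiz x i - horiz y i) ^+ 2 <= n.-1%:R * rho ^+ 2.
      apply: le_trans (_ : \sum_(i < n.-1) rho ^+ 2 <= _).
        apply: ler_sum => i _; rewrite -[leLHS]real_normK ?num_real//.
        by rewrite lerXn2r ?nnegrE ?(ltW rho0)// distrC.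
      by rewrite sumr_const card_ord -[leLHS]mulr_natl.
    move: (\sum_i _) ya yb => p; set t := ht y; rewrite -/s => ya yb hp.
    have h1 : (s - t) ^+ 2 <= rho ^+ 2.
      rewrite -[leLHS]real_normK ?num_real// lerXn2r ?nnegrE ?(ltW rho0)//.
      by rewrite ler_distlC; apply/andP; split; lra.
    have h2 : n%:R * rho ^+ 2 < (cosh r - 1) * (2 * s * t).
      apply: (lt_le_trans (y := s ^+ 2 * r ^+ 2 / 4)); last first.
        have : s ^+ 2 <= 2 * s * t by rewrite expr2; nra.
        move=> /(ler_pM _ _ clo); rewrite sqr_ge0 divr_ge0 ?sqr_ge0// => /(_ isT isT).
        by apply: le_trans; rewrite le_eqVlt; apply/orP; left; apply/eqP; field.
      rewrite /rho (_ : n%:R * _ = s ^+ 2 * r ^+ 2 / 4 * n%:R^-1); last first.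
        by field; rewrite gt_eqF.
      rewrite gtr_pMr ?invf_lt1 ?ltr1n// divr_gt0// mulr_gt0 ?exprn_gt0//.
    have : n%:R * rho ^+ 2 = n.-1%:R * rho ^+ 2 + rho ^+ 2.
      by rewrite [in n%:R]nE -natr1 mulrDl mul1r.
    lra.
  move=> /hvolume_mono; apply: le_trans.
  apply: le_trans (hvolume_hbox_ge _ _ _ _); [|by rewrite ltW|lra|lra].
  rewrite lee_fin.
  have -> : s + rho - (s - rho) = 2 * rho by ring.
  have srho0 : 0 < s + rho by lra.
  rewrite -exprSr -nE -exprVn -!exprMn; apply: lerXn2r.
  - by rewrite nnegrE mulr_ge0 ?invr_ge0 ?mulr_ge0// ltW.
  - by rewrite nnegrE mulr_ge0 ?invr_ge0 ?mulr_ge0// ltW.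
  rewrite [leRHS]mulrC ler_pdivlMr; last by lra.
  rewrite (_ : 2 * rho = s * r / n%:R); last by rewrite /rho; field; rewrite gt_eqF.
  rewrite (_ : _ * (s + rho) = r / n%:R * ((s + rho) / 2)); last by field; rewrite gt_eqF.
  rewrite (_ : s * r / _ = r / n%:R * s); last by field; rewrite gt_eqF.
  by rewrite ler_pM2l ?divr_gt0//; lra.
(* The bottom of the box is kept at least at [s / 6], as [s - 5 * (s * r)] may be negative. *)
have : hball x r `<=`
    hbox (horiz x) (5 * (s * r)) (Num.max (s / 6) (s - 5 * (s * r))) (s + 5 * (s * r)).
  move=> y; rewrite /hball/= hdist_lt; last by lra.
  move=> yx; have := yx; rewrite /cdist -ltrBrDl ltr_pdivrMr; last by rewrite !mulr_gt0 ?ht_gt0.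
  have t0 := ht_gt0 y.
  have sum_ge i : (horiz x i - horiz y i) ^+ 2 <= \sum_i (horiz x i - horiz y i) ^+ 2.
    by rewrite (bigD1 i)//= lerDl; apply: sumr_ge0 => j _; exact: sqr_ge0.
  have S0 : 0 <= \sum_i (horiz x i - horiz y i) ^+ 2.
    by apply: sumr_ge0 => j _; exact: sqr_ge0.
  move: yx; rewrite cdistE ltr_pdivrMr; last by rewrite !mulr_gt0 ?ht_gt0.
  move: S0 sum_ge t0; rewrite /hbox/= -/s; set p := \sum_i _; set t := ht y => S0 sum_ge t0 h1 h2.
  have st0 : 0 < s * t by rewrite mulr_gt0.
  have c3 : cosh r <= 3 by lra.
  have {h1} h1 : p + s ^+ 2 + t ^+ 2 < 6 * (s * t).
    have : cosh r * (2 * s * t) <= 3 * (2 * s * t) by rewrite ler_pM2r// -mulrA mulr_gt0.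
    lra.
  (* These crude bounds on heights turn the bound on [cdist] into a Euclidean one:
     [2 * r ^+ 2 * (2 * s * (6 * s))] is 24 times [(s * r) ^+ 2], whence the 5. *)
  have ts : t < 6 * s.
    have := sqr_ge0 s => s2; rewrite -(ltr_pM2l t0).
    by rewrite (_ : t * (6 * s) = 6 * (s * t)); [nra|ring].
  have st : s < 6 * t.
    have := sqr_ge0 t => t2; rewrite -(ltr_pM2l s0).
    by rewrite (_ : s * (6 * t) = 6 * (s * t)); [nra|ring].
  have {h2} h2 : p + (s - t) ^+ 2 < (5 * (s * r)) ^+ 2.
    apply: lt_le_trans h2 _.
    apply: le_trans (_ : 2 * r ^+ 2 * (2 * s * (6 * s)) <= _).
      apply: ler_pM => //; first by rewrite (le_trans _ clo)// divr_ge0 ?sqr_ge0.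
        by rewrite -mulrA mulr_ge0// ltW.
      by rewrite ler_pM2l ?mulr_gt0// ltW.
    by have := sqr_ge0 (s * r); rewrite !exprMn; nra.
  split.
    move=> i; apply: ler_norm_of_sqr; first by rewrite mulr_ge0// ltW.
    rewrite (_ : (horiz y i - horiz x i) ^+ 2 = (horiz x i - horiz y i) ^+ 2); last by ring.
    by rewrite (le_trans (sum_ge i))//; have := sqr_ge0 (s - t); lra.
  have : `|t - s| <= 5 * (s * r).
    apply: ler_norm_of_sqr; first by rewrite mulr_ge0// ltW.
    by rewrite (_ : (t - s) ^+ 2 = (s - t) ^+ 2); [lra|ring].
  rewrite ler_distl => /andP[ta tb]; rewrite tb andbT ge_max ta andbT.
  by rewrite ler_pdivrMr//; lra.
move=> /hvolume_mono; move/le_trans; apply.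
have a0 : 0 < Num.max (s / 6) (s - 5 * (s * r)) by rewrite lt_max divr_gt0.
apply: le_trans (hvolume_hbox_le _ _ _ _) _ => //.
- by rewrite mulr_ge0// ltW.
- by rewrite ge_max; apply/andP; split; [rewrite ler_pdivrMr//|]; lra.
rewrite lee_fin -exprMn [in leRHS]nE exprS.
apply: le_trans (_ : (s / 6) ^- n * ((2 * (5 * (s * r))) ^+ n.-1 * (10 * (s * r))) <= _).
  have h : s - 5 * (s * r) <= Num.max (s / 6) (s - 5 * (s * r)) by rewrite le_max lexx orbT.
  have h' : s / 6 <= Num.max (s / 6) (s - 5 * (s * r)) by rewrite le_max lexx.
  apply: ler_pM.
  - by rewrite invr_ge0 exprn_ge0// ltW.
  - rewrite mulr_ge0 ?exprn_ge0 ?mulr_ge0 ?subr_ge0 ?ltW//.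
    by rewrite gt_max; apply/andP; split; [rewrite ltr_pdivrMr//|]; lra.
  - by rewrite lef_pV2 ?posrE ?exprn_gt0 ?divr_gt0// lerXn2r ?nnegrE ?(ltW a0)// ltW// divr_gt0.
  - by rewrite ler_pM2l ?exprn_gt0 ?mulr_gt0//; lra.
rewrite le_eqVlt; apply/orP; left; apply/eqP.
rewrite [X in (s / 6) ^- X]nE; move: (n.-1) => m.
rewrite (exprS (s / 6)) !exprMn exprVn.
have -> : 2 ^+ m * (5 ^+ m * (s ^+ m * r ^+ m)) = 10 ^+ m * (s ^+ m * r ^+ m).
  by rewrite mulrA -exprMn (_ : 2 * 5 = 10)//; ring.
have -> : 60 ^+ m = 6 ^+ m * 10 ^+ m :> R.
  by rewrite -exprMn (_ : 6 * 10 = 60)//; ring.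
by field; rewrite !gt_eqF// exprn_gt0.
Qed.

End volume_estimates.

(** * Integrals and kernels *)

Section poweR_facts.
Local Open Scope ereal_scope.
Context {R : realType}.
Implicit Types (x y : \bar R) (q : R).

Lemma lee_poweR x y q : (0 <= q)%R -> 0 <= x -> x <= y -> x `^ q <= y `^ q.
Proof.
move=> q0 x0 xy; apply: gt0_ler_poweR => //; rewrite in_itv/= leey andbT//.
exact: le_trans xy.
Qed.

Lemma poweRK x q : (0 < q)%R -> 0 <= x -> (x `^ q) `^ q^-1 = x.
Proof. by move=> q0 x0; rewrite -poweRrM mulfV ?gt_eqF// poweRe1. Qed.

Lemma poweRVK x q : (0 < q)%R -> 0 <= x -> (x `^ q^-1) `^ q = x.
Proof. by move=> q0 x0; rewrite -poweRrM mulVf ?gt_eqF// poweRe1. Qed.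

Lemma le_of_poweR x y q : (0 < q)%R -> 0 <= x -> 0 <= y ->
  x `^ q <= y `^ q -> x <= y.
Proof.
move=> q0 x0 y0 xy; rewrite -(poweRK q0 x0) -(poweRK q0 y0).
by apply: lee_poweR => //; [rewrite invr_ge0 ltW|exact: poweR_ge0].
Qed.

Lemma poweR_addn q (m : nat) (u : nat -> \bar R) : (0 < q)%R ->
  (forall i, 0 <= u i) ->
  (\sum_(i < m) u i) `^ q <= (m%:R `^ q)%:E * \sum_(i < m) u i `^ q.
Proof.
move=> q0 u0; set B := \sum_(i < m) u i `^ q.
have B0 : 0 <= B by apply: sume_ge0 => i _; exact: poweR_ge0.
have uB (i : 'I_m) : u i <= B `^ q^-1.
  apply: (le_of_poweR q0) => //; first exact: poweR_ge0.
  rewrite poweRVK// /B (bigD1 i)//= leeDl// sume_ge0// => j _.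
  exact: poweR_ge0.
apply: (@le_trans _ _ ((m%:R%:E * B `^ q^-1) `^ q)).
  apply: lee_poweR; [exact: ltW|by apply: sume_ge0|].
  apply: le_trans (_ : \sum_(i < m) B `^ q^-1 <= _); first exact: lee_sum.
  by rewrite sumr_const card_ord mule_natl.
by rewrite poweRM ?poweR_ge0 ?lee_fin// poweRVK.
Qed.

Lemma poweR_add2 q x y : (0 < q)%R -> 0 <= x -> 0 <= y ->
  (x + y) `^ q <= (2 `^ q)%:E * (x `^ q + y `^ q).
Proof.
move=> q0 x0 y0; pose u i := if i is 0%N then x else y.
have := @poweR_addn q 2 u q0; rewrite !big_ord_recl !big_ord0 !adde0/=.
by apply; case.
Qed.

(** A weighted and crude Hölder inequality: each [u i] is at most [c i] times the power [q^-1] of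
    the weighted series, and the [c i] are summable. *)
Lemma poweR_series q (b c : nat -> R) (C : R) (u : nat -> \bar R) : (0 < q)%R ->
  (forall i, 0 <= b i)%R -> (forall i, 0 <= c i)%R ->
  (forall i, 1 <= b i * c i `^ q)%R -> (forall m, \sum_(i < m) c i <= C)%R ->
  (forall i, 0 <= u i) ->
  (\sum_(0 <= i <oo) u i) `^ q <= (C `^ q)%:E * \sum_(0 <= i <oo) (b i)%:E * u i `^ q.
Proof.
move=> q0 b0 c0 bc cC u0; set B := \sum_(0 <= i <oo) _ * _.
have t0 i : 0 <= (b i)%:E * u i `^ q by rewrite mule_ge0 ?poweR_ge0// lee_fin.
have B0 : 0 <= B by apply: nneseries_ge0.
have C0 : (0 <= C)%R by have := cC 0%N; rewrite big_ord0.
have uB i : u i <= (c i)%:E * B `^ q^-1.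
  apply: (le_of_poweR q0) => //; first by rewrite mule_ge0 ?poweR_ge0 ?lee_fin.
  rewrite poweRM ?poweR_ge0 ?lee_fin// poweRVK//.
  apply: le_trans (_ : (c i `^ q)%:E * ((b i)%:E * u i `^ q) <= _).
    rewrite muleA -EFinM mulrC -[leLHS]mul1e lee_wpmul2r ?poweR_ge0//.
    by rewrite lee_fin.
  rewrite poweR_EFin lee_wpmul2l ?lee_fin ?powR_ge0//.
  rewrite /B; apply: le_trans (nneseries_lim_ge i.+1 _) => //.
  by rewrite big_nat_recr//= leeDr// sume_ge0.
apply: (@le_trans _ _ ((C%:E * B `^ q^-1) `^ q)); last first.
  by rewrite poweRM ?poweR_ge0 ?lee_fin// poweRVK.
apply: lee_poweR; [exact: ltW|exact: nneseries_ge0|].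
apply: lime_le; first exact: is_cvg_nneseries.
near=> m; rewrite big_mkord.
apply: le_trans (_ : \sum_(i < m) (c i)%:E * B `^ q^-1 <= _); first exact: lee_sum.
rewrite -ge0_sume_distrl; last by move=> i _; rewrite lee_fin.
by rewrite lee_wpmul2r ?poweR_ge0// sumEFin lee_fin.
Unshelve. all: by end_near. Qed.

(* Young's inequality for the pair [f ^ p], [1]; integrating it and optimizing
   in [t] gives Jensen's inequality, infinite values included. *)
Lemma le_add_poweR (p t : R) x : (1 <= p)%R -> (0 < t)%R -> 0 <= x ->
  x <= t%:E + (t `^ (1 - p))%:E * x `^ p.
Proof.
move=> p1 t0; have p0 : (0 < p)%R by exact: lt_le_trans p1.
case: x => [a| |]//; last first.
  by move=> _; rewrite poweRyr ?gt_eqF// gt0_muley ?lte_fin ?powR_gt0// addey.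
rewrite lee_fin => a0; rewrite poweR_EFin -EFinM -EFinD lee_fin.
have [at_|ta] := leP a t.
  by rewrite (le_trans at_)// lerDl mulr_ge0 ?powR_ge0.
apply: ler_wpDl; first exact: ltW.
have a1 : (0 < a)%R by exact: lt_trans ta.
apply: (@le_trans _ _ (a `^ (1 - p) * a `^ p)%R).
  by rewrite -powRD ?subrK ?powRr1// oner_eq0 implyFb.
rewrite ler_wpM2r ?powR_ge0// -[leLHS]invrK -[leRHS]invrK lef_pV2 ?posrE ?invr_gt0 ?powR_gt0//.
by rewrite -!powRN opprB ge0_ler_powR ?nnegrE ?subr_ge0// ltW.
Qed.

End poweR_facts.

Section cutoff_geometric_series.
Local Open Scope ereal_scope.
Context {R : realType}.

(** A growing geometric sum is dominated by its last term, here at most [a]. Sums over levels are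
    turned back into powers of a function in this way. *)
Let sum_cutoff (rho a : R) (m : nat) : (1 < rho)%R -> (0 <= a)%R ->
  (\sum_(i < m) (if rho ^+ i <= a then rho ^+ i else 0) <= rho / (rho - 1) * a)%R.
Proof.
move=> rho1 a0; have r1 : (0 < rho - 1)%R by rewrite subr_gt0.
have c0 : (0 <= rho / (rho - 1))%R by rewrite divr_ge0//; lra.
elim: m => [|m IH]; first by rewrite big_ord0 mulr_ge0.
rewrite big_ord_recr/=; case: ifPn => h; last by rewrite addr0.
apply: (@le_trans _ _ (\sum_(i < m.+1) rho ^+ i)%R).
  rewrite big_ord_recr/= lerD2r; apply: ler_sum => i _; case: ifPn => // _.
  by rewrite exprn_ge0//; lra.
have : ((rho - 1) * \sum_(i < m.+1) rho ^+ i = rho * rho ^+ m - 1)%R.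
  by rewrite -exprS subrX1.
move: (\sum_(i < m.+1) _)%R => S HS.
rewrite -(ler_pM2l r1) HS mulrA mulrCA mulfV ?gt_eqF// mulr1.
by have := ler_wpM2l (ltW (lt_trans ltr01 rho1)) h; lra.
Qed.

Lemma nneseries_cutoff (rho : R) (a : \bar R) : (1 < rho)%R -> 0 <= a ->
  \sum_(0 <= i <oo) (if (rho ^+ i)%:E <= a then (rho ^+ i)%:E else 0)
    <= (rho / (rho - 1))%:E * a.
Proof.
move=> rho1; have r1 : (0 < rho - 1)%R by rewrite subr_gt0.
have r0 : (0 < rho)%R by exact: lt_trans rho1.
case: a => [a| |]//; last first.
  by move=> _; rewrite gt0_muley ?leey// lte_fin divr_gt0.
rewrite lee_fin => a0; apply: lime_le.
  apply: is_cvg_nneseries => i _ _; case: ifPn => // _.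
  by rewrite lee_fin exprn_ge0 ?ltW.
near=> m; rewrite big_mkord.
rewrite (eq_bigr (fun i : 'I_m => (if (rho ^+ i <= a)%R then (rho ^+ i)%R else 0%R)%:E)).
  by rewrite sumEFin -EFinM lee_fin; exact: sum_cutoff.
by move=> i _; rewrite lee_fin; case: ifPn.
Unshelve. all: by end_near. Qed.

Lemma nneseries_cutoffV (rho : R) (a : \bar R) : (1 < rho)%R -> 0 <= a ->
  \sum_(0 <= i <oo) (if (rho ^- i)%:E <= a then (rho ^- i)%:E else 0)
    <= (rho / (rho - 1))%:E * a.
Proof.
move=> rho1; have r1 : (0 < rho - 1)%R by rewrite subr_gt0.
have r0 : (0 < rho)%R by exact: lt_trans rho1.
case: a => [a| |]//; last first.
  by move=> _; rewrite gt0_muley ?leey// lte_fin divr_gt0.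
rewrite lee_fin => a0; apply: lime_le.
  apply: is_cvg_nneseries => i _ _; case: ifPn => // _.
  by rewrite lee_fin invr_ge0 exprn_ge0 ?ltW.
near=> m; rewrite big_mkord.
rewrite (eq_bigr (fun i : 'I_m => (if (rho ^- i <= a)%R then (rho ^- i)%R else 0%R)%:E)); last first.
  by move=> i _; rewrite lee_fin; case: ifPn.
rewrite sumEFin -EFinM lee_fin.
have rm : (0 < rho ^+ m)%R by rewrite exprn_gt0.
have ram : (0 <= a * rho ^+ m)%R by exact: mulr_ge0 a0 (ltW rm).
(* Multiplying by [rho ^+ m] and reversing the order of summation turns negative powers into
   positive ones. *)
have := @sum_cutoff rho (a * rho ^+ m)%R m.+1 rho1 ram.
move=> H; rewrite -(ler_pM2r rm) -mulrA; apply: le_trans H.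
rewrite big_ord_recl/= -[leLHS]add0r lerD//.
  by case: ifPn => // _; rewrite expr0.
rewrite mulr_suml (reindex_inj rev_ord_inj)/=; apply: ler_sum => i _.
have e : (rho ^- (m - i.+1) * rho ^+ m = rho ^+ i.+1)%R.
  have -> : (rho ^+ m = rho ^+ (m - i.+1) * rho ^+ i.+1)%R by rewrite -exprD subnK.
  by rewrite mulrA mulVf ?mul1r// expf_neq0// gt_eqF.
rewrite /bump/= add1n -e ler_pM2r//.
by case: ifPn => //; rewrite mul0r.
Unshelve. all: by end_near. Qed.

End cutoff_geometric_series.

Section weighted_integral.
Local Open Scope ereal_scope.
Context d (T : measurableType d) (R : realType).
Variables (mu : {measure set T -> \bar R}) (w : weight T R).
Local Notation nu := (weighted mu w).

Let mw : measurable_fun setT (EFin \o w).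
Proof. exact/measurable_EFinP/measurable_weight. Qed.

Let w0 x : 0 <= (w x)%:E. Proof. by rewrite lee_fin weight_ge0. Qed.

Import HBNNSimple.

Let integral_weighted_nnsfun (h : {nnsfun T >-> R}) :
  \int[nu]_x (h x)%:E = \int[mu]_x ((h x)%:E * (w x)%:E).
Proof.
under [LHS]eq_integral do rewrite fimfunE -fsumEFin//.
under [RHS]eq_integral do rewrite fimfunE -fsumEFin//.
rewrite ge0_integral_fsum//; last 2 first.
  - by move=> r; exact/measurable_EFinP/measurableT_comp.
  - by move=> r x _; rewrite nnfun_muleindic_ge0.
under [RHS]eq_integral.
  move=> x _; rewrite ge0_mule_fsuml; last by move=> r; exact: nnfun_muleindic_ge0.
  over.
rewrite ge0_integral_fsum//; last 2 first.
  - move=> r; apply: emeasurable_funM => //.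
    by apply/measurable_EFinP; exact: measurableT_comp.
  - by move=> r x _; rewrite mule_ge0// nnfun_muleindic_ge0.
apply: eq_fsbigr => r _.
have [r0|r0] := leP 0%R r; last first.
  rewrite !integral0_eq// => x _; rewrite preimage_nnfun0// indicE in_set0 mulr0//.
  by rewrite mul0e.
under [LHS]eq_integral do rewrite EFinM.
rewrite ge0_integralZl//; last exact/measurable_EFinP.
rewrite integral_indic// setIT.
under [RHS]eq_integral do rewrite EFinM -muleA.
rewrite ge0_integralZl//; last 2 first.
  - by apply: emeasurable_funM; [exact/measurable_EFinP|exact: mw].
  - by move=> x _; rewrite mule_ge0// lee_fin.
congr (_ * _).
transitivity (\int[mu]_(x in h @^-1` [set r]) (w x)%:E) => //.
rewrite integral_mkcond; apply: eq_integral => x _.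
by rewrite patchE indicE; case: (x \in _); rewrite ?mul1e ?mul0e.
Qed.

Lemma integral_weighted (f : T -> \bar R) : measurable_fun setT f ->
  (forall x, 0 <= f x) -> \int[nu]_x f x = \int[mu]_x (f x * (w x)%:E).
Proof.
move=> mf f0; pose f_ := nnsfun_approx measurableT mf.
have f_f x : (f_ k x)%:E @[k --> \oo] --> f x by exact: cvg_nnsfun_approx.
transitivity (lim (\int[nu]_x (f_ k x)%:E @[k --> \oo])).
  rewrite -monotone_convergence//=.
  - by apply: eq_integral => x _; apply/esym/cvg_lim.
  - by move=> k; exact/measurable_EFinP.
  - by move=> k x _; rewrite lee_fin.
  - by move=> x _ a b ab; rewrite lee_fin; exact/lefP/nd_nnsfun_approx.
transitivity (lim (\int[mu]_x ((f_ k x)%:E * (w x)%:E) @[k --> \oo])).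
  by apply: congr_lim; apply/funext => k; exact: integral_weighted_nnsfun.
rewrite -monotone_convergence//=.
- apply: eq_integral => x _; apply/cvg_lim => //.
  by apply: cvgeZr.
- by move=> k; apply: emeasurable_funM; [exact/measurable_EFinP|exact: mw].
- by move=> k x _; rewrite mule_ge0// lee_fin.
- move=> x _ a b ab; rewrite lee_wpmul2r// lee_fin.
  exact/lefP/nd_nnsfun_approx.
Qed.

End weighted_integral.

Section jensen.
Local Open Scope ereal_scope.
Context d (T : measurableType d) (R : realType).
Variable mu : {measure set T -> \bar R}.

(** Young's inequality is integrated before the optimization in [t]. With [sigma = 1] this gives
    Jensen's inequality; with [sigma] the dual weight it gives the Hölder inequality behind the
    local A_p condition. *)
Lemma poweR_integral_le_young (D : set T) (F sigma h : T -> \bar R) (p M : R) :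
  measurable D -> (1 <= p)%R -> (0 < M)%R ->
  (forall x, D x -> 0 <= F x) ->
  measurable_fun D sigma -> (forall x, D x -> 0 <= sigma x) ->
  measurable_fun D h -> (forall x, D x -> 0 <= h x) ->
  (forall (t : R) x, (0 < t)%R -> D x ->
    F x <= t%:E * sigma x + (t `^ (1 - p))%:E * h x) ->
  \int[mu]_(x in D) sigma x <= M%:E ->
  (\int[mu]_(x in D) F x) `^ p <= (2 `^ p * M `^ (p - 1))%:E * \int[mu]_(x in D) h x.
Proof.
move=> mD p1 M0 F0 ms s0 mh h0 young sM.
have p0 : (0 < p)%R by exact: lt_le_trans p1.
have c0 : (0 < 2 `^ p * M `^ (p - 1))%R by rewrite mulr_gt0 ?powR_gt0.
have bound t : (0 < t)%R -> \int[mu]_(x in D) F x <=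
    t%:E * M%:E + (t `^ (1 - p))%:E * \int[mu]_(x in D) h x.
  move=> t0; apply: le_trans (_ : \int[mu]_(x in D)
      (t%:E * sigma x + (t `^ (1 - p))%:E * h x) <= _).
    by apply: ge0_le_integral_nonmeasurable => // x Dx; exact: young.
  have tp0 : (0 <= t `^ (1 - p))%R by exact: powR_ge0.
  rewrite ge0_integralD//; last 4 first.
  - by move=> x Dx; rewrite mule_ge0 ?s0// lee_fin ltW.
  - exact: measurable_funeM.
  - by move=> x Dx; rewrite mule_ge0 ?h0// lee_fin.
  - exact: measurable_funeM.
  rewrite !ge0_integralZl//; last by rewrite lee_fin ltW.
  by rewrite leeD2r// lee_wpmul2l// lee_fin ltW.
have I0 : 0 <= \int[mu]_(x in D) h x by exact: integral_ge0.
have J0 : 0 <= \int[mu]_(x in D) F x by exact: integral_ge0.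
move: I0 J0 bound; case: (\int[mu]_(x in D) h x) => [X| |]//; last first.
  by move=> _ _ _; rewrite gt0_muley ?lte_fin// leey.
case: (\int[mu]_(x in D) F x) => [Y| |]//; last first.
  by move=> _ _ /(_ 1%R ltr01).
rewrite !lee_fin => X0 Y0 bound.
have {bound} bound t : (0 < t)%R -> (Y <= t * M + t `^ (1 - p) * X)%R.
  by move=> /bound; rewrite -!EFinM -EFinD lee_fin.
(* If the integral of [h] vanishes, no [t] is optimal and [t] is let tend to 0. *)
move: X0; rewrite le_eqVlt => /predU1P[X0|X0].
  move: bound; rewrite -X0 => bound; rewrite mulr0.
  suff -> : Y = 0%R by rewrite powR0// gt_eqF.
  apply/eqP; rewrite eq_le Y0 andbT; apply/ler_addgt0Pl => e e0.
  have := bound (e / M)%R; rewrite divr_gt0// => /(_ isT).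
  by rewrite mulr0 !addr0 divfK// gt_eqF.
(* The value of [t] for which the two terms of the bound are equal. *)
pose t := ((X / M) `^ p^-1)%R.
have XM0 : (0 < X / M)%R by rewrite divr_gt0.
have t0 : (0 < t)%R by rewrite powR_gt0.
have tp : (t `^ p = X / M)%R by rewrite /t -powRrM mulVf ?gt_eqF// powRr1// ltW.
have tX : (t `^ (1 - p) * X = t * M)%R.
  rewrite powRB; last by rewrite (gt_eqF t0) implybT.
  by rewrite powRr1 ?(ltW t0)// tp; field; rewrite !gt_eqF.
have := bound t t0; rewrite tX => Ht.
apply: (@le_trans _ _ ((2 * (t * M)) `^ p)%R).
  apply: ge0_ler_powR; rewrite ?nnegrE ?(ltW p0)//; last by lra.
  by rewrite !mulr_ge0 ?(ltW t0) ?(ltW M0).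
rewrite powRM ?mulr_ge0 ?(ltW t0) ?(ltW M0)// powRM ?(ltW t0) ?(ltW M0)// tp.
rewrite powRB ?powRr1 ?(ltW M0)//; last by rewrite (gt_eqF M0) implybT.
rewrite le_eqVlt; apply/orP; left; apply/eqP.
by field; rewrite !gt_eqF.
Qed.

Lemma poweR_integral_le (D : set T) (f : T -> \bar R) (p M : R) :
  measurable D -> (1 <= p)%R -> (0 < M)%R ->
  measurable_fun D f -> (forall x, D x -> 0 <= f x) -> mu D <= M%:E ->
  (\int[mu]_(x in D) f x) `^ p
    <= (2 `^ p * M `^ (p - 1))%:E * \int[mu]_(x in D) f x `^ p.
Proof.
move=> mD p1 M0 mf f0 DM; apply: (@poweR_integral_le_young D f (cst 1)) => //.
- exact: (measurableT_comp (measurable_poweR _)).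
- by move=> x _; exact: poweR_ge0.
- by move=> t x t0 Dx; rewrite mule1; exact: le_add_poweR (f0 _ Dx).
- by rewrite integral_cst// mul1e.
Qed.

End jensen.

Section kernel.
Local Open Scope ereal_scope.
Context d (T : measurableType d) (R : realType).
Variables (mu : {sigma_finite_measure set T -> \bar R}) (w : weight T R).
Local Notation nu := (weighted mu w).
Variables (A : set (T * T)) (f : T -> \bar R).
Hypotheses (mA : measurable A) (mf : measurable_fun setT f).
Hypothesis f0 : forall x, 0 <= f x.

Let mw : measurable_fun setT (EFin \o w).
Proof. exact/measurable_EFinP/measurable_weight. Qed.

Let w0 x : 0 <= (w x)%:E. Proof. by rewrite lee_fin weight_ge0. Qed.

Let i0 z : 0 <= (\1_A z)%:E :> \bar R. Proof. by rewrite lee_fin. Qed.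

Let mi : measurable_fun setT (fun z : T * T => (\1_A z)%:E : \bar R).
Proof. exact/measurable_EFinP. Qed.

Let mfi : measurable_fun setT (fun z : T * T => f z.2 * (\1_A z)%:E).
Proof. by apply: emeasurable_funM => //; exact: measurableT_comp. Qed.

Let integral_xsection x :
  \int[mu]_(y in xsection A x) f y = \int[mu]_y (f y * (\1_A (x, y))%:E).
Proof.
rewrite integral_mkcond; apply: eq_integral => y _.
rewrite patchE indicE (_ : (y \in xsection A x) = ((x, y) \in A)); last first.
  by apply/idP/idP; rewrite !inE /xsection/= inE.
by case: ifPn => _; rewrite ?mule1 ?mule0.
Qed.

Let weighted_ysection y :
  nu (ysection A y) = \int[mu]_x ((\1_A (x, y))%:E * (w x)%:E).
Proof.
transitivity (\int[mu]_(x in ysection A y) (w x)%:E) => //.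
rewrite integral_mkcond; apply: eq_integral => x _.
rewrite patchE indicE (_ : (x \in ysection A y) = ((x, y) \in A)); last first.
  by apply/idP/idP; rewrite !inE /ysection/= inE.
by case: ifPn => _; rewrite ?mul1e ?mul0e.
Qed.

Lemma measurable_integral_xsection :
  measurable_fun setT (fun x => \int[mu]_(y in xsection A x) f y).
Proof.
under eq_fun do rewrite integral_xsection.
apply: (@measurable_fun_fubini_tonelli_F _ _ _ _ _ mu
  (fun z : T * T => f z.2 * (\1_A z)%:E)) => // z.
by rewrite mule_ge0.
Qed.

Lemma measurable_weighted_ysection : measurable_fun setT (fun y => nu (ysection A y)).
Proof.
under eq_fun do rewrite weighted_ysection.
apply: (@measurable_fun_fubini_tonelli_G _ _ _ _ _ mu
  (fun z : T * T => (\1_A z)%:E * (w z.1)%:E)).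
  apply: emeasurable_funM => //.
  exact: (measurableT_comp mw measurable_fst).
by move=> z; rewrite mule_ge0.
Qed.

Lemma tonelli_kernel :
  \int[nu]_x \int[mu]_(y in xsection A x) f y =
  \int[mu]_y (f y * nu (ysection A y)).
Proof.
rewrite integral_weighted//; last 2 first.
- exact: measurable_integral_xsection.
- by move=> x; exact: integral_ge0.
pose F (z : T * T) := f z.2 * (\1_A z)%:E * (w z.1)%:E.
have mF : measurable_fun setT F.
  by apply: emeasurable_funM => //; exact: (measurableT_comp mw measurable_fst).
have F0 z : 0 <= F z by rewrite /F !mule_ge0.
transitivity (\int[mu]_x \int[mu]_y F (x, y)).
  apply: eq_integral => x _; rewrite integral_xsection /F/= ge0_integralZr//.
  - exact: (measurableT_comp mfi (measurable_pair1 x)).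
  - by move=> y _; rewrite mule_ge0.
rewrite (fubini_tonelli F)//; apply: eq_integral => y _.
rewrite weighted_ysection -ge0_integralZl//.
- by apply: eq_integral => x _; rewrite /F/= muleA.
- apply: emeasurable_funM => //.
  exact: (measurableT_comp mi (measurable_pair2 y)).
- by move=> x _; rewrite mule_ge0.
Qed.

(** The L^1 case of Schur's test: after Tonelli's theorem [f y] is multiplied by the weight of the
    transposed section. *)
Lemma integral_kernel_le (c : R) : (0 <= c)%R ->
  {ae mu, forall y, nu (ysection A y) <= (c * w y)%:E} ->
  \int[nu]_x \int[mu]_(y in xsection A x) f y <= c%:E * \int[nu]_y f y.
Proof.
move=> c0 Hc; rewrite tonelli_kernel integral_weighted//.
rewrite -ge0_integralZl//; last 2 first.
- exact: emeasurable_funM.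
- by move=> x _; rewrite mule_ge0.
apply: ae_ge0_le_integral => //.
- by move=> y _; rewrite mule_ge0// measure_ge0.
- by apply: emeasurable_funM => //; exact: measurable_weighted_ysection.
- by move=> y _; rewrite !mule_ge0// lee_fin.
- by apply: measurable_funeM; exact: emeasurable_funM.
- apply: filterS Hc => y Hy _.
  by rewrite muleCA lee_wpmul2l// -EFinM.
Qed.

End kernel.

Section kernel_power.
Local Open Scope ereal_scope.
Context d (T : measurableType d) (R : realType).
Variables (mu : {sigma_finite_measure set T -> \bar R}) (w : weight T R).
Local Notation nu := (weighted mu w).

Lemma poweR_kernel_le (A : set (T * T)) (f : T -> \bar R) (q M c : R) :
  measurable A -> measurable_fun setT f -> (forall x, 0 <= f x) ->
  (1 <= q)%R -> (0 < M)%R -> (0 <= c)%R ->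
  (forall x, mu (xsection A x) <= M%:E) ->
  {ae mu, forall y, nu (ysection A y) <= (c * w y)%:E} ->
  \int[nu]_x (\int[mu]_(y in xsection A x) f y) `^ q
    <= (2 `^ q * M `^ (q - 1) * c)%:E * \int[nu]_y f y `^ q.
Proof.
move=> mA mf f0 q1 M0 c0 AM Ac.
have mfq : measurable_fun setT (fun x => f x `^ q).
  exact: (measurableT_comp (measurable_poweR _)).
have C0 : 0 <= (2 `^ q * M `^ (q - 1))%:E by rewrite lee_fin mulr_ge0 ?powR_ge0.
apply: le_trans (_ : \int[nu]_x ((2 `^ q * M `^ (q - 1))%:E *
    \int[mu]_(y in xsection A x) f y `^ q) <= _).
  apply: ge0_le_integral_nonmeasurable => x _; first exact: poweR_ge0.
  apply: poweR_integral_le => //; [|exact: measurable_funTS|exact: AM].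
  exact: measurable_xsection.
pose g x := \int[mu]_(y in xsection A x) f y `^ q.
have mg : measurable_fun setT g.
  by apply: measurable_integral_xsection => // ?; exact: poweR_ge0.
have g0 x : 0 <= g x by apply: integral_ge0 => ? _; exact: poweR_ge0.
rewrite (ge0_integralZl nu measurableT mg)//.
rewrite (EFinM _ c) -muleA lee_wpmul2l//.
have fq0 y : 0 <= f y `^ q by exact: poweR_ge0.
exact: (integral_kernel_le mA mfq fq0 c0 Ac).
Qed.

End kernel_power.

(** * Decomposition into shells *)

Section shells.
Context {R : realType} {n : nat}.
Local Notation H := (hyperbolic R n).
Local Notation mu := (@hvolume R n).
Local Notation o := (@horigin R n).
Implicit Types x y z : H.

(** The successor is there because shells are numbered from 1. *)
Definition shell_index x : nat := (Num.trunc (hdist o x)).+1.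

Lemma shell_indexP x :
  (shell_index x)%:R - 1 <= hdist o x < (shell_index x)%:R.
Proof.
rewrite /shell_index truncnS_gt andbT -natr1 addrK.
by rewrite truncn_le hdist_ge0.
Qed.

Lemma hshell_index x : hshell (shell_index x) x.
Proof.
have /andP[h1 h2] := shell_indexP x; split => //=.
by rewrite /hball/=; apply/negP; rewrite -leNgt.
Qed.

Lemma hshell_indexE j x : hshell j.+1 x -> shell_index x = j.+1.
Proof.
case; rewrite /hball/= => xj /negP; rewrite -leNgt -natr1 addrK => jx.
have /andP[h1 h2] := shell_indexP x; apply/eqP; rewrite eqn_leq.
have -> : (shell_index x <= j.+1)%N.
  by rewrite -ltnS -(ltr_nat R) -[j.+2%:R]natr1; lra.
by rewrite -(ltr_nat R) (le_lt_trans jx).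
Qed.

Lemma shell_index_dist x y (r : nat) : hdist x y < r%:R ->
  `|(shell_index x)%:R - (shell_index y)%:R| <= r%:R :> R.
Proof.
move=> xy; have /andP[x1 x2] := shell_indexP x.
have /andP[y1 y2] := shell_indexP y.
have h1 := hdist_triangle o x y; have h2 := hdist_triangle o y x.
rewrite hdistC in h2; rewrite (hdistC y x) in h2.
have {}h2 : hdist o x <= hdist o y + hdist x y by rewrite (hdistC o x).
have h3 : (shell_index x)%:R < (shell_index y + r).+1%:R :> R.
  by rewrite -natr1 natrD; lra.
have h4 : (shell_index y)%:R < (shell_index x + r).+1%:R :> R.
  by rewrite -natr1 natrD; lra.
rewrite ltr_nat ltnS -(ler_nat R) natrD in h3.
rewrite ltr_nat ltnS -(ler_nat R) natrD in h4.
by rewrite ler_distl; apply/andP; split; lra.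
Qed.

Lemma measurable_hdist2 : measurable_fun setT (fun z : H * H => hdist z.1 z.2).
Proof.
have mheight : measurable_fun setT (ht : H -> R).
  exact: (measurableT_comp (@measurable_snd _ _ _ (measurableTypeR R)) measurable_hcoord).
have mhoriz i : measurable_fun setT (fun y : H => horiz y i : R).
  apply: (measurableT_comp (@measurable_tnth _ (measurableTypeR R) n.-1 i)).
  exact: (measurableT_comp (@measurable_fst _ _ _ (measurableTypeR R)) measurable_hcoord).
have minvheight : measurable_fun setT (fun y : H => (ht y)^-1).
  apply: (eq_measurable_fun (fun y => expR (- ln (ht y)))).
    by move=> y _; rewrite expRN lnK// posrE ht_gt0.
  apply: measurableT_comp => //; apply: measurableT_comp => //.
  exact: (measurableT_comp (@measurable_ln R) mheight).
have m1 (g : H -> R) : measurable_fun setT g -> measurable_fun setT (fun z : H * H => g z.1).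
  by move=> mg; exact: (measurableT_comp mg measurable_fst).
have m2 (g : H -> R) : measurable_fun setT g -> measurable_fun setT (fun z : H * H => g z.2).
  by move=> mg; exact: (measurableT_comp mg measurable_snd).
have marcosh : measurable_fun setT (@arcosh R).
  apply: (measurableT_comp (@measurable_ln R)).
  apply: measurable_funD => //.
  apply: (measurableT_comp (f := @Num.sqrt R)).
    by apply: continuous_measurable_fun; exact: sqrt_continuous.
  by apply: measurable_funB => //; exact: measurable_funX.
under eq_fun do rewrite hdistE.
apply: (measurableT_comp marcosh).
apply: measurable_funD => //; apply: measurable_funM.
  apply: measurable_funD.
    apply: measurable_sum => i; apply: measurable_funX.
    by apply: measurable_funB; [exact: (m1 _ (mhoriz i))|exact: (m2 _ (mhoriz i))].
  by apply: measurable_funX; apply: measurable_funB; [exact: (m1 _ mheight)|exact: (m2 _ mheight)].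
under eq_fun do rewrite !invfM.
by apply: measurable_funM; [apply: measurable_funM => //; exact: (m1 _ minvheight)|exact: (m2 _ minvheight)].
Qed.

Definition ball_kernel (r : R) : set (H * H) := [set z | hdist z.1 z.2 < r].

Lemma measurable_ball_kernel r : measurable (ball_kernel r).
Proof.
rewrite (_ : ball_kernel r = setT `&` (fun z : H * H => hdist z.1 z.2) @^-1` `]-oo, r[).
  by apply: measurable_hdist2 => //; exact: measurable_itv.
by rewrite setTI; apply/seteqP; split => z; rewrite /= in_itv.
Qed.

Lemma xsection_ball_kernel r x : xsection (ball_kernel r) x = hball x r.
Proof. by apply/seteqP; split => y; rewrite /xsection/= inE. Qed.

Lemma ysection_ball_kernel r y : ysection (ball_kernel r) y = hball y r.
Proof. by apply/seteqP; split => x; rewrite /ysection/= inE /hball/= hdistC. Qed.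

Lemma measurable_hshell j : measurable (@hshell R n j).
Proof. by apply: measurableD; exact: measurable_hball. Qed.

(* The step between the shells of two points at distance less than [r] lies in
   [- r, r]; it is encoded as [r - i], with [i <= 2 * r]. *)
Definition hkernel (r i : nat) : set (H * H) :=
  [set z | ball_kernel r%:R z /\ (shell_index z.1 + i = shell_index z.2 + r)%N].

Lemma measurable_hkernel r i : measurable (hkernel r i).
Proof.
rewrite (_ : hkernel r i = ball_kernel r%:R `&`
  \bigcup_l \bigcup_j (if (l.+1 + i == j.+1 + r)%N then hshell l.+1 `*` hshell j.+1 else set0)).
  apply: measurableI; first exact: measurable_ball_kernel.
  apply: bigcup_measurable => l _; apply: bigcup_measurable => j _.
  by case: ifPn => // _; apply: measurableX; exact: measurable_hshell.
apply/seteqP; split => -[x y] /= [xy h]; split => //.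
  exists (shell_index x).-1 => //; exists (shell_index y).-1 => //.
  by rewrite /= h eqxx; split => /=; exact: hshell_index.
move: h => [l _ [j _]]; case: ifPn => // /eqP ljr [/= xl yj].
by rewrite (hshell_indexE xl) (hshell_indexE yj).
Qed.

Lemma hball_hkernel r x : hball x r%:R `<=`
  \big[setU/set0]_(i < (2 * r).+1) xsection (hkernel r i) x.
Proof.
move=> y xy; have := shell_index_dist xy.
rewrite ler_distl => /andP[h1 h2].
have {}h1 : (shell_index y <= shell_index x + r)%N by rewrite -(ler_nat R) natrD; lra.
have {}h2 : (shell_index x <= shell_index y + r)%N by rewrite -(ler_nat R) natrD; lra.
have ir : (shell_index y + r - shell_index x < (2 * r).+1)%N.
  by rewrite ltnS mul2n -addnn leq_subLR addnA leq_add2r.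
rewrite -(bigcup_mkord _ (fun i => xsection (hkernel r i) x)).
exists (shell_index y + r - shell_index x)%N => //.
by rewrite /xsection/= inE; split => //=; rewrite subnKC.
Qed.

Lemma hvolume_hkernel_le : (2 <= n)%N -> exists2 C : R, 0 < C & forall r i x,
  (mu (xsection (hkernel r i) x) <= (C * expR (n.-1%:R * (i%:R / 2)))%:E)%E.
Proof.
move=> n2; have [C C0 HC] := @hvolume_lens_le R n n2.
exists (C * expR (n.-1%:R / 2)); first by rewrite mulr_gt0 ?expR_gt0.
move=> r i x; have [[y0 y0x]|] := pselect (xsection (hkernel r i) x !=set0); last first.
  move=> /set0P/negP; rewrite negbK => /eqP ->; rewrite measure0 lee_fin.
  by rewrite !mulr_ge0 ?expR_ge0// ltW.
have {y0x} [_ e0] : hkernel r i (x, y0) by move: y0x; rewrite /xsection/= inE.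
have sub : xsection (hkernel r i) x `<=`
    hball x r%:R `&` hball o (shell_index y0)%:R.
  move=> y; rewrite /xsection/= inE => -[/= xy e]; split => //.
  have -> : shell_index y0 = shell_index y by apply: (@addIn r); rewrite -e0 -e.
  by have /andP[] := shell_indexP y.
apply: le_trans (hvolume_mono sub) _; apply: le_trans (HC _ _ _ _) _.
rewrite lee_fin -mulrA -expRD ler_pM2l// ler_expR -mulrDr ler_wpM2l//.
(* The distance from [o] to [x] may fall short of the shell index by 1; the factor
   [expR (n.-1%:R / 2)] in the constant pays for this. *)
have /andP[x1 _] := shell_indexP x.
have : (shell_index x)%:R + i%:R = (shell_index y0)%:R + r%:R :> R by rewrite -!natrD e0.
by rewrite hdistC => e; lra.
Qed.

End shells.

Section hypothesis_kernel.
Context {R : realType} {n : nat}.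
Local Notation H := (hyperbolic R n).
Local Notation mu := (@hvolume R n).
Variables (w : weight H R) (p delta C : R).
Hypothesis C0 : 0 < C.
Hypothesis shell_growth :
  forall j l r : nat, (1 <= j)%N -> (1 <= l)%N -> (1 <= r)%N ->
    `|l%:R - j%:R| <= r%:R :> R ->
    {ae mu, forall x, hshell j x ->
      (weighted mu w (hshell l `&` hball x r%:R) <=
        (C * expR ((n%:R - 1) * ((r%:R + l%:R - j%:R) / 2) * (p - delta))
           * expR ((n%:R - 1) * r%:R * delta) * w x)%:E)%E}.

(** The fixed point [y] is in shell [j] and the points [x] of the section are in shell [l] with
    [l + i = j + r], so [r + l - j] in the hypothesis is [2 * r - i]. *)
Lemma weighted_hkernel_le (r i : nat) : (1 <= r)%N ->
  {ae mu, forall y, (weighted mu w (ysection (hkernel r i) y) <=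
    (C * expR ((n%:R - 1) * ((2 * r%:R - i%:R) / 2 * (p - delta) + r%:R * delta)) * w y)%:E)%E}.
Proof.
move=> r1.
(* The null sets of all pairs of shells, countably many, are merged before [y] is fixed. *)
have : \forall y \ae mu, forall j l : nat, `|l.+1%:R - j.+1%:R| <= r%:R :> R ->
    hshell j.+1 y -> (weighted mu w (hshell l.+1 `&` hball y r%:R) <=
        (C * expR ((n%:R - 1) * ((r%:R + l.+1%:R - j.+1%:R) / 2) * (p - delta))
           * expR ((n%:R - 1) * r%:R * delta) * w y)%:E)%E.
  apply: ae_foralln => j; apply: ae_foralln => l.
  have [h|h] := pselect (`|l.+1%:R - j.+1%:R| <= r%:R :> R); last first.
    by apply: aeW => y /h.
  by apply: filterS (@shell_growth j.+1 l.+1 r isT isT r1 h) => y Hy _.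
apply: filterS => y Hy.
have [[x0 x0y]|] := pselect (ysection (hkernel r i) y !=set0); last first.
  move=> /set0P/negP; rewrite negbK => /eqP ->; rewrite measure0 lee_fin.
  by rewrite !mulr_ge0 ?expR_ge0 ?weight_ge0// ltW.
have {x0y} [d0 e0] : hkernel r i (x0, y) by move: x0y; rewrite /ysection/= inE.
have sub : ysection (hkernel r i) y `<=` hshell (shell_index x0) `&` hball y r%:R.
  move=> x; rewrite /ysection/= inE => -[/= xy e]; split; last first.
    by rewrite /hball/= hdistC.
  have -> : shell_index x0 = shell_index x by apply: (@addIn i); rewrite e0 e.
  exact: hshell_index.
apply: le_trans (_ : (weighted mu w (hshell (shell_index x0) `&` hball y r%:R) <= _)%E).
  by apply: ge0_subset_integral_nonmeasurable => // x _; rewrite lee_fin weight_ge0.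
apply: le_trans (Hy (shell_index y).-1 (shell_index x0).-1 _ _) _ => /=.
- exact: shell_index_dist.
- exact: hshell_index.
rewrite lee_fin ler_wpM2r ?weight_ge0// -mulrA -expRD ler_pM2l// ler_expR.
have e : (shell_index x0)%:R + i%:R = (shell_index y)%:R + r%:R :> R by rewrite -!natrD e0.
rewrite (_ : r%:R + _ - _ = 2 * r%:R - i%:R :> R); last by move: e; rewrite /shell_index/=; lra.
by rewrite le_eqVlt; apply/orP; left; apply/eqP; ring.
Qed.

End hypothesis_kernel.

Lemma sume_const_ord (R : realType) (m : nat) (x : \bar R) :
  (\sum_(i < m) x = m%:R%:E * x)%E.
Proof. by rewrite sumr_const card_ord mule_natl. Qed.

Lemma sum_expRN_le (R : realType) (c : R) : 0 < c ->
  exists2 G : R, 0 < G & forall m : nat, \sum_(i < m) expR (- (c * i%:R)) <= G.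
Proof.
move=> c0; pose x := expR (- c).
have x0 : 0 < x by exact: expR_gt0.
have x1 : x < 1 by rewrite /x -expR0 ltr_expR; lra.
exists (1 / (1 - x)); first by rewrite divr_gt0// subr_gt0.
move=> m; apply: le_trans (geometric_le_lim m ler01 x0 _); last first.
  by rewrite ger0_norm ?ltW.
rewrite /series/= big_mkord; apply: ler_sum => i _.
by rewrite mul1r /x -expRM_natl; rewrite ler_expR; lra.
Qed.

Lemma markov_le (d : measure_display) (T : measurableType d) (R : realType)
    (mu : {measure set T -> \bar R}) (F : T -> \bar R) (c : R) : (0 < c) ->
  measurable_fun setT F -> (forall x, 0 <= F x)%E ->
  (mu [set x | c%:E <= F x] <= (c^-1)%:E * \int[mu]_x F x)%E.
Proof.
move=> c0 mF F0; set U := [set x | _].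
have mU : measurable U.
  by rewrite /U -[X in measurable X]setTI; exact: emeasurable_fun_c_infty.
rewrite -(@lee_pmul2l _ c%:E) ?lte_fin// muleA -EFinM mulfV ?gt_eqF// mul1e.
rewrite -integral_cst//; apply: le_trans (_ : \int[mu]_(x in U) F x <= _)%E.
  by apply: ge0_le_integral_nonmeasurable => // x _; rewrite lee_fin ltW.
by apply: ge0_subset_integral_nonmeasurable.
Qed.

Lemma integral_cover_le (d : measure_display) (T : measurableType d) (R : realType)
    (mu : {measure set T -> \bar R}) (D : set T) (m : nat) (F : nat -> set T)
    (f : T -> \bar R) :
  D `<=` \big[setU/set0]_(i < m) F i -> (forall i, measurable (F i)) ->
  measurable_fun setT f -> (forall x, 0 <= f x)%E ->
  (\int[mu]_(x in D) f x <= \sum_(i < m) \int[mu]_(x in F i) f x)%E.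
Proof.
move=> DF mF mf f0; apply: le_trans (_ : \int[mu]_(x in \big[setU/set0]_(i < m) F i) f x <= _)%E.
  exact: ge0_subset_integral_nonmeasurable.
rewrite [leRHS](eq_bigr (fun i : 'I_m => \int[mu]_x (f \_ (F i)) x)%E); last first.
  by move=> i _; rewrite integral_mkcond.
rewrite -ge0_integral_sum//; last 2 first.
- by move=> i; apply/(measurable_restrictT f (mF i)); exact: measurable_funTS.
- by move=> i x _; rewrite patchE; case: ifPn.
rewrite integral_mkcond; apply: ge0_le_integral_nonmeasurable => x _.
  by rewrite patchE; case: ifPn.
rewrite patchE; case: ifPn => [|_]; last first.
  by apply: sume_ge0 => i _; rewrite patchE; case: ifPn.
rewrite inE -bigcup_mkord => -[i im Fix]; rewrite (bigD1 (Ordinal im))//=.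
rewrite patchE mem_set// leeDl// sume_ge0// => j _; rewrite patchE.
by case: ifPn.
Qed.

(** * Large radii *)

Section large_radii.
Context {R : realType} {n : nat}.
Local Notation H := (hyperbolic R n).
Local Notation mu := (@hvolume R n).
Variables (w : weight H R) (p delta Cw : R).
Local Notation nu := (weighted mu w).
Local Notation a := (n.-1%:R : R).
Hypotheses (n2 : (2 <= n)%N) (p1 : 1 <= p) (delta1 : delta < 1) (Cw0 : 0 < Cw).
Hypothesis kernel_growth : forall r i : nat, (1 <= r)%N ->
  {ae mu, forall y, (nu (ysection (hkernel r i) y) <=
    (Cw * expR (a * ((2 * r%:R - i%:R) / 2 * (p - delta) + r%:R * delta)) * w y)%:E)%E}.

Let a0 : 0 < a. Proof. by rewrite ltr0n -ltnS prednK// ltnW. Qed.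

Lemma ball_integral_le_kernels (f : H -> \bar R) (r : nat) x :
  measurable_fun setT f -> (forall y, 0 <= f y)%E ->
  (\int[mu]_(y in hball x r%:R) f y <=
   \sum_(i < (2 * r).+1) \int[mu]_(y in xsection (hkernel r i) x) f y)%E.
Proof.
move=> mf f0; apply: (@integral_cover_le _ _ _ mu _ _
  (fun i => xsection (hkernel r i) x)) => //.
  exact: hball_hkernel.
by move=> i; apply: measurable_xsection; exact: measurable_hkernel.
Qed.

Lemma strong_type_ball_integral (q : R) : p < q ->
  exists C kappa : R, [/\ 0 < C, 0 < kappa & forall (f : H -> \bar R) (r : nat),
   measurable_fun setT f -> (forall y, 0 <= f y)%E -> (1 <= r)%N ->
   (\int[nu]_x (\int[mu]_(y in hball x r%:R) f y) `^ q <=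
     (C * (2 * r).+1%:R `^ (q + 1) * expR ((a * q - kappa) * r%:R))%:E *
        \int[nu]_y f y `^ q)%E].
Proof.
move=> pq; have [CV CV0 HV] := @hvolume_hkernel_le R n n2.
have q1 : 1 < q by exact: le_lt_trans pq.
have q0 : 0 < q by exact: lt_trans q1.
(* The slack in the exponent is affine in [i], proportional to [q - p] at [i = 0] and to [1 - delta]
   at [i = 2 * r]; the smaller of the two is the rate of decay. *)
pose m := Num.min (q - p) (1 - delta).
have m0 : 0 < m by rewrite lt_min !subr_gt0 pq.
have mq : m <= q - p by rewrite ge_min lexx.
have md : m <= 1 - delta by rewrite ge_min lexx orbT.
exists (2 `^ q * CV `^ (q - 1) * Cw), (a * m); split.
- by rewrite !mulr_gt0// powR_gt0.
- by rewrite mulr_gt0.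
move=> f r mf f0 r1; set I := (\int[nu]_y f y `^ q)%E.
have I0 : (0 <= I)%E by apply: integral_ge0 => y _; exact: poweR_ge0.
have mg i : measurable_fun setT (fun x => \int[mu]_(y in xsection (hkernel r i) x) f y)%E.
  by apply: measurable_integral_xsection => //; exact: measurable_hkernel.
have g0 i x : (0 <= \int[mu]_(y in xsection (hkernel r i) x) f y)%E by exact: integral_ge0.
have mgq i : measurable_fun setT
    (fun x => (\int[mu]_(y in xsection (hkernel r i) x) f y) `^ q)%E.
  exact: (measurableT_comp (measurable_poweR _) (mg i)).
apply: le_trans (_ : \int[nu]_x (((2 * r).+1%:R `^ q)%:E * \sum_(i < (2 * r).+1)
    (\int[mu]_(y in xsection (hkernel r i) x) f y) `^ q) <= _)%E.
  apply: ge0_le_integral_nonmeasurable => x _; first exact: poweR_ge0.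
  apply: le_trans (poweR_addn _ q0 (fun i => g0 i x)).
  apply: lee_poweR; [exact: ltW|exact: integral_ge0|].
  exact: ball_integral_le_kernels.
rewrite ge0_integralZl//; last 2 first.
- exact: emeasurable_sum.
- by move=> x _; apply: sume_ge0 => i _; exact: poweR_ge0.
rewrite ge0_integral_sum//; last by move=> i x _; exact: poweR_ge0.
apply: le_trans (_ : ((2 * r).+1%:R `^ q)%:E * \sum_(i < (2 * r).+1)
  ((2 `^ q * CV `^ (q - 1) * Cw * expR ((a * q - a * m) * r%:R))%:E * I) <= _)%E; last first.
  rewrite sume_const_ord muleA muleA -!EFinM.
  rewrite lee_wpmul2r// lee_fin le_eqVlt; apply/orP; left; apply/eqP.
  rewrite [X in _ = _ * X * _]powRD; last by rewrite pnatr_eq0 implybT.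
  by rewrite powRr1//; ring.
rewrite lee_wpmul2l ?lee_fin ?powR_ge0//; apply: lee_sum => i _.
have M0 : 0 < CV * expR (a * (i%:R / 2)) by rewrite mulr_gt0 ?expR_gt0.
have c0 : 0 <= Cw * expR (a * ((2 * r%:R - i%:R) / 2 * (p - delta) + r%:R * delta)).
  by rewrite mulr_ge0 ?expR_ge0// ltW.
apply: le_trans (poweR_kernel_le (measurable_hkernel r i) mf f0 (ltW q1) M0 c0
  (HV r i) (kernel_growth i r1)) _.
rewrite -/I lee_wpmul2r// lee_fin powRM ?expR_ge0 ?(ltW CV0)//.
rewrite -expRM.
rewrite (_ : _ * (Cw * _) = 2 `^ q * CV `^ (q - 1) * Cw *
  (expR (a * (i%:R / 2) * (q - 1)) *
   expR (a * ((2 * r%:R - i%:R) / 2 * (p - delta) + r%:R * delta)))); last by ring.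
rewrite -expRD ler_wpM2l//.
  by rewrite mulr_ge0 ?(ltW Cw0)// mulr_ge0 ?powR_ge0.
rewrite ler_expR -subr_ge0.
have ir : i%:R <= 2 * r%:R :> R by rewrite -natrM ler_nat -ltnS.
rewrite (_ : _ - _ = a * ((2 * r%:R - i%:R) / 2 * (q - p - m) + i%:R / 2 * (1 - delta - m))).
  by rewrite mulr_ge0 ?(ltW a0)// addr_ge0// mulr_ge0//; lra.
by field.
Qed.

(** As [delta < p], the bounds on the slices decay geometrically in [i] from [expR (a * p * r%:R)],
    so the slice [i = 0] decides. *)
Lemma weighted_hball_le : exists2 C : R, 0 < C & forall r : nat, (1 <= r)%N ->
  {ae mu, forall y, (nu (ysection (ball_kernel r%:R) y) <=
    (C * expR (a * p * r%:R) * w y)%:E)%E}.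
Proof.
have s0 : 0 < a * (p - delta) / 2 by rewrite divr_gt0// mulr_gt0// subr_gt0 (lt_le_trans delta1).
have [G G0 HG] := sum_expRN_le s0.
exists (Cw * G); first by rewrite mulr_gt0.
move=> r r1.
have := ae_foralln (fun i => kernel_growth i r1).
apply: filterS => y Hy.
have sub : ysection (ball_kernel r%:R) y `<=`
    \big[setU/set0]_(i < (2 * r).+1) ysection (hkernel r i) y.
  move=> x; rewrite ysection_ball_kernel /hball/= hdistC => xy.
  have := @hball_hkernel R n r x y xy.
  rewrite -(bigcup_mkord _ (fun i => xsection (hkernel r i) x)).
  rewrite -(bigcup_mkord _ (fun i => ysection (hkernel r i) y)).
  move=> -[i im]; rewrite /xsection/= inE => h.
  by exists i => //; rewrite /ysection/= inE.
apply: le_trans (@integral_cover_le _ _ _ mu _ (2 * r).+1 (fun i => ysection (hkernel r i) y)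
  (EFin \o w) sub _ _ _) _.
- by move=> i; apply: measurable_ysection; exact: measurable_hkernel.
- exact/measurable_EFinP/measurable_weight.
- by move=> x; rewrite lee_fin weight_ge0.
apply: le_trans (_ : \sum_(i < (2 * r).+1) (Cw * expR (a * p * r%:R) *
    expR (- (a * (p - delta) / 2 * i%:R)) * w y)%:E <= _)%E.
  apply: lee_sum => i _; apply: le_trans (Hy i) _.
  rewrite lee_fin ler_wpM2r ?weight_ge0// -[leRHS]mulrA -expRD ler_pM2l//.
  rewrite ler_expR le_eqVlt; apply/orP; left; apply/eqP; by field.
rewrite sumEFin lee_fin -mulr_suml ler_wpM2r ?weight_ge0// -mulr_sumr.
by rewrite mulrAC ler_wpM2r ?expR_ge0// ler_pM2l.
Qed.

Lemma ball_integral_bounded (q : R) (r : nat) : 1 <= q -> (1 <= r)%N ->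
  exists2 C : R, 0 < C & forall f : H -> \bar R,
   measurable_fun setT f -> (forall y, 0 <= f y)%E ->
   (\int[nu]_x (\int[mu]_(y in hball x r%:R) f y) `^ q <=
     C%:E * \int[nu]_y f y `^ q)%E.
Proof.
move=> q1 r1; have [CB CB0 HB] := weighted_hball_le.
have [CV CV0 HV] := @hvolume_hball_le R n n2.
have M0 : 0 < CV * expR (a * r%:R) by rewrite mulr_gt0 ?expR_gt0.
have c0 : 0 < CB * expR (a * p * r%:R) by rewrite mulr_gt0 ?expR_gt0.
exists (2 `^ q * (CV * expR (a * r%:R)) `^ (q - 1) * (CB * expR (a * p * r%:R))).
  by rewrite mulr_gt0// mulr_gt0 ?powR_gt0.
move=> f mf f0.
under eq_integral do rewrite -xsection_ball_kernel.
have HM x : (mu (xsection (ball_kernel r%:R) x) <= (CV * expR (a * r%:R))%:E)%E.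
  by rewrite xsection_ball_kernel.
exact: (poweR_kernel_le (measurable_ball_kernel r%:R) mf f0 q1 M0 (ltW c0) HM (HB r r1)).
Qed.

(* Exchanging the integrals, [f z] is counted with weight the volume of a unit
   ball, which is bounded below. *)
Lemma ball_integral_mean : exists2 C : R, 0 < C & forall (f : H -> \bar R) (r : R) x,
   measurable_fun setT f -> (forall y, 0 <= f y)%E ->
   (\int[mu]_(y in hball x r) f y <=
    C%:E * \int[mu]_(y in hball x (r + 1)) \int[mu]_(z in hball y 1) f z)%E.
Proof.
have [c c0 Hc] := @hvolume_hball_ge R n n2.
have ce0 : 0 < c * expR (a * 1) by rewrite mulr_gt0 ?expR_gt0.
exists (c * expR (a * 1))^-1; first by rewrite invr_gt0.
move=> f r x mf f0; set B := hball x (r + 1).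
have mB : measurable B by exact: measurable_hball.
have B0 y : 0 <= \1_B y :> R by [].
have mv : measurable_fun setT (\1_B : H -> R) by exact: measurable_indic.
(* With the indicator of the larger ball as weight, the outer integral is one against a weighted
   measure, to which [tonelli_kernel] applies. *)
pose v := @Weight _ H R \1_B B0 mv.
have mg : measurable_fun setT (fun y => \int[mu]_(z in hball y 1) f z)%E.
  under eq_fun do rewrite -xsection_ball_kernel.
  by apply: measurable_integral_xsection => //; exact: measurable_ball_kernel.
have g0 y : (0 <= \int[mu]_(z in hball y 1) f z)%E by exact: integral_ge0.
have -> : (\int[mu]_(y in B) \int[mu]_(z in hball y 1) f z =
    \int[weighted mu v]_y \int[mu]_(z in hball y 1) f z)%E.
  rewrite integral_weighted// [LHS]integral_mkcond; apply: eq_integral => y _.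
  by rewrite patchE /= indicE; case: ifPn => _; rewrite ?mule1 ?mule0.
under [X in (_ <= _ * X)%E]eq_integral do rewrite -xsection_ball_kernel.
rewrite tonelli_kernel//; last exact: measurable_ball_kernel.
rewrite -(@lee_pmul2l _ (c * expR (a * 1))%:E) ?lte_fin//.
rewrite [leRHS]muleA -EFinM mulfV ?gt_eqF// mul1e.
rewrite [X in (_ * X <= _)%E]integral_mkcond.
rewrite -ge0_integralZl//; last 3 first.
- apply/(measurable_restrictT f (measurable_hball x r)); exact: measurable_funTS.
- by move=> y _; rewrite patchE; case: ifPn.
- by rewrite lee_fin ltW.
apply: ge0_le_integral_nonmeasurable => y _.
  by rewrite mule_ge0 ?lee_fin ?(ltW ce0)// patchE; case: ifPn.
rewrite patchE; case: ifPn; last by rewrite mule0 mule_ge0.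
rewrite inE /hball/= => xy; rewrite muleC lee_wpmul2l// ysection_ball_kernel.
apply: le_trans (Hc y 1 (lexx 1)) _.
rewrite -[leLHS]mul1e -integral_cst; last exact: measurable_hball.
apply: ge0_le_integral_nonmeasurable => z yz; rewrite lee_fin//=.
rewrite indicE mem_set// /B /hball/=.
by apply: le_lt_trans (hdist_triangle x y z) _; rewrite ltrD.
Qed.

End large_radii.

(** * Weak type at large radii *)

Section weak_type_large_radii.
Context {R : realType} {n : nat}.
Local Notation H := (hyperbolic R n).
Local Notation mu := (@hvolume R n).
Variables (w : weight H R) (p delta Cw : R).
Local Notation nu := (weighted mu w).
Local Notation a := (n.-1%:R : R).
Hypotheses (n2 : (2 <= n)%N) (p1 : 1 <= p) (delta1 : delta < 1) (Cw0 : 0 < Cw).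
Hypothesis kernel_growth : forall r i : nat, (1 <= r)%N ->
  {ae mu, forall y, (nu (ysection (hkernel r i) y) <=
    (Cw * expR (a * ((2 * r%:R - i%:R) / 2 * (p - delta) + r%:R * delta)) * w y)%:E)%E}.

Let a0 : 0 < a. Proof. by rewrite ltr0n -ltnS prednK// ltnW. Qed.
Let p0 : 0 < p. Proof. exact: lt_le_trans p1. Qed.

Lemma measurable_ball_integral (r : R) (f : H -> \bar R) :
  measurable_fun setT f -> (forall y, 0 <= f y)%E ->
  measurable_fun setT (fun x => \int[mu]_(y in hball x r) f y)%E.
Proof.
move=> mf f0; under eq_fun do rewrite -xsection_ball_kernel.
by apply: measurable_integral_xsection => //; exact: measurable_ball_kernel.
Qed.

Section near_large_values.
Variable h : H -> \bar R.
Hypothesis mh : measurable_fun setT h.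

Let G (r : nat) : set H := [set y | ((expR (a * r%:R))%:E < h y)%E].

Let mG r : measurable (G r).
Proof. by rewrite /G -[X in measurable X]setTI; exact: emeasurable_fun_o_infty. Qed.

Let iG r y : \bar R := (\1_(G r) y)%:E.

Let miG r : measurable_fun setT (iG r).
Proof. exact/measurable_EFinP. Qed.

(** Asking for large values on a set of volume at least [c], rather than at one point, makes the set
    measurable and open to Markov's inequality. *)
Definition near_large_values (c : R) (r : nat) : set H :=
  [set x | (c%:E <= \int[mu]_(y in hball x r.+1%:R) iG r y)%E].

Lemma measurable_near_large_values c r : measurable (near_large_values c r).
Proof.
rewrite /near_large_values -[X in measurable X]setTI.
apply: emeasurable_fun_c_infty => //; apply: measurable_ball_integral => // y.
by rewrite lee_fin.
Qed.

Lemma near_large_values_ball (c : R) r x y :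
  (c%:E <= mu (hball y 1))%E -> hball x r%:R y ->
  (forall z, hball y 1 z -> ((expR (a * r%:R))%:E < h z)%E) ->
  near_large_values c r x.
Proof.
move=> Hc xy yh; rewrite /near_large_values/=; apply: le_trans Hc _.
rewrite -[leLHS]mul1e -integral_cst; last exact: measurable_hball.
rewrite integral_mkcond [leRHS]integral_mkcond.
apply: ge0_le_integral_nonmeasurable => z _; rewrite !patchE.
  by case: ifPn => // _; rewrite lee_fin.
case: ifPn => [|_]; last by case: ifPn => // _; rewrite lee_fin.
rewrite inE => yz; rewrite mem_set/=; last first.
  rewrite /hball/= -natr1; apply: le_lt_trans (hdist_triangle x y z) _.
  by apply: ltrD.
by rewrite lee_fin /iG indicE mem_set//; exact: yh.
Qed.

Lemma weighted_near_large_values (c CB : R) : 0 < c -> 0 < CB ->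
  (forall r : nat, (1 <= r)%N ->
    {ae mu, forall y, (nu (ysection (ball_kernel r%:R) y) <=
      (CB * expR (a * p * r%:R) * w y)%:E)%E}) ->
  (\sum_(0 <= r <oo) nu (near_large_values c r) <=
    (c^-1 * CB * expR (a * p) * (expR (a * p) / (expR (a * p) - 1)))%:E
      * \int[nu]_y h y `^ p)%E.
Proof.
move=> c0 CB0 HB; pose rho := expR (a * p); have rho1 : 1 < rho by rewrite expR_gt1 mulr_gt0.
pose K := c^-1 * CB * rho.
have rho0 : 0 < rho by exact: expR_gt0.
have K0 : 0 < K by rewrite !mulr_gt0// invr_gt0.
rewrite -/rho -/K.
have step r : (nu (near_large_values c r) <=
    \int[nu]_y (K%:E * ((rho ^+ r)%:E * iG r y)))%E.
  apply: le_trans (markov_le nu c0 (measurable_ball_integral r.+1%:R (miG r) _) _) _.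
  - by move=> y; rewrite lee_fin.
  - by move=> x; apply: integral_ge0 => y _; rewrite lee_fin.
  under [X in (_ * X <= _)%E]eq_integral do rewrite -xsection_ball_kernel.
  have cb0 : 0 <= CB * expR (a * p * r.+1%:R) by rewrite mulr_ge0 ?expR_ge0// ltW.
  have iG0 y : (0 <= iG r y)%E by rewrite lee_fin.
  apply: (@le_trans _ _ ((c^-1)%:E * ((CB * expR (a * p * r.+1%:R))%:E * \int[nu]_y iG r y))%E).
    rewrite lee_wpmul2l ?lee_fin ?invr_ge0 ?(ltW c0)//.
    exact: (integral_kernel_le (measurable_ball_kernel _) (miG r) iG0 cb0 (HB r.+1 isT)).
  rewrite muleA -EFinM.
  under [leRHS]eq_integral do rewrite muleA -(EFinM K).
  rewrite ge0_integralZl//; last by rewrite lee_fin mulr_ge0 ?exprn_ge0 ?(ltW K0) ?(ltW rho0).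
  rewrite lee_wpmul2r ?integral_ge0// lee_fin /K /rho -expRM_natl -natr1.
  rewrite (_ : a * p * (r%:R + 1) = a * p + r%:R * (a * p)) ?expRD; last by ring.
  by rewrite le_eqVlt; apply/orP; left; apply/eqP; ring.
apply: le_trans (_ : \sum_(0 <= r <oo) \int[nu]_y (K%:E * ((rho ^+ r)%:E * iG r y)) <= _)%E.
  by apply: lee_nneseries => // r _; exact: step.
have K0' : (0 <= K%:E)%E by rewrite lee_fin ltW.
have t0 r y : (0 <= (rho ^+ r)%:E * iG r y)%E.
  by rewrite mule_ge0// lee_fin// exprn_ge0// ltW.
have mt r : measurable_fun setT (fun y => K%:E * ((rho ^+ r)%:E * iG r y))%E.
  by apply: measurable_funeM; exact: measurable_funeM.
rewrite -integral_nneseries//; last by move=> r y _; exact: mule_ge0.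
have mhp : measurable_fun setT (fun y => h y `^ p)%E.
  exact: (measurableT_comp (measurable_poweR _)).
have C0' : (0 <= (K * (rho / (rho - 1)))%:E)%E.
  by rewrite lee_fin mulr_ge0 ?(ltW K0)// divr_ge0 ?(ltW rho0)// subr_ge0 ltW.
rewrite -ge0_integralZl//; last by move=> y _; exact: poweR_ge0.
apply: ge0_le_integral_nonmeasurable => y _.
  by apply: nneseries_ge0 => r _ _; exact: mule_ge0.
rewrite nneseriesZl//.
rewrite (EFinM K) -muleA lee_wpmul2l//.
apply: le_trans (nneseries_cutoff rho1 (poweR_ge0 (h y) p)).
apply: lee_nneseries => // r _; rewrite /iG indicE.
have [|_] := boolP (y \in G r); last first.
  by rewrite mule0; case: ifPn => // _; rewrite lee_fin exprn_ge0// ltW.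
rewrite inE /G/= => hy; rewrite mule1 ifT//.
apply: le_trans (_ : (expR (a * r%:R))%:E `^ p <= _)%E.
  rewrite poweR_EFin lee_fin -expRM /rho -expRM_natl ler_expR.
  by rewrite le_eqVlt; apply/orP; left; apply/eqP; ring.
by apply: lee_poweR; [exact: ltW|rewrite lee_fin expR_ge0|exact: ltW].
Qed.

End near_large_values.

(** [kappa] is the gain in the exponent per unit of [i]. Half of it is kept as decay in [i]. A
    quarter absorbs the lowering of the heights by [eps], and the last quarter buys the power [eta]
    that makes the sum over [r] converge. *)
Let kappa := a * (1 - delta) / 2.
Let eps := kappa / (4 * p).
Let eta := kappa / (4 * (eps + a / 2)).

Let kappa0 : 0 < kappa. Proof. by rewrite divr_gt0// mulr_gt0// subr_gt0. Qed.
Let eps0 : 0 < eps. Proof. by rewrite divr_gt0// mulr_gt0. Qed.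
Let eta0 : 0 < eta. Proof. by rewrite divr_gt0// mulr_gt0// addr_gt0// divr_gt0. Qed.

(* [threshold r i] is the height at which a function is cut on the part
   [hkernel r i] of the ball of radius [r]: small values contribute at most
   [expR (- eps * i)] times the volume of the ball. *)
Let threshold (r i : nat) : R := expR (a * (2 * r%:R - i%:R) / 2 - eps * i%:R).

(** [tau] is the logarithm of a value above the threshold. On the left is its exponent after
    Markov's inequality at level [expR (a * r%:R)]. The excess of [tau] over the threshold, taken
    with coefficient [p - 1 + eta], turns it into a power of the value. *)
Let exponent_le (r i : nat) (tau : R) :
  a * (2 * r%:R - i%:R) / 2 - eps * i%:R < tau ->
  a * ((2 * r%:R - i%:R) / 2 * (p - delta) + r%:R * delta) - a * r%:R + tau <=
  - (kappa / 2 * i%:R) + (p + eta) * tau - a * eta * r%:R.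
Proof.
move=> htau.
have h1 : (p - 1) * eps <= kappa / 4.
  rewrite /eps (_ : _ * _ = kappa / 4 * ((p - 1) / p)); last by field; rewrite gt_eqF.
  apply: ler_piMr; first by rewrite divr_ge0// ltW.
  by rewrite ler_pdivrMr//; lra.
have ea0 : 0 < eps + a / 2 by rewrite addr_gt0// divr_gt0.
have h2 : eta * (eps + a / 2) = kappa / 4.
  by rewrite /eta; field; rewrite !gt_eqF//; lra.
rewrite -subr_ge0.
pose X := tau - (a * (2 * r%:R - i%:R) / 2 - eps * i%:R).
have X0 : 0 < X by rewrite subr_gt0.
rewrite [leRHS](_ : _ = (p - 1 + eta) * X +
    i%:R * (kappa / 2 - (p - 1) * eps - eta * (eps + a / 2))); last first.
  by rewrite /X /kappa; field.
apply: addr_ge0; apply: mulr_ge0 => //; [|exact: ltW|]; last by lra.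
by rewrite addr_ge0 ?subr_ge0// ltW.
Qed.

Section intermediate_values.
Variable g : H -> \bar R.
Hypotheses (mg : measurable_fun setT g) (g0 : forall y, (0 <= g y)%E).

Let E (r i : nat) : set H :=
  [set y | ((threshold r i)%:E < g y)%E /\ (g y <= (expR (a * r%:R))%:E)%E].

Let mE r i : measurable (E r i).
Proof.
rewrite (_ : E r i = (setT `&` [set y | ((threshold r i)%:E < g y)%E]) `&`
   (setT `&` [set y | (g y <= (expR (a * r%:R))%:E)%E])).
  by apply: measurableI; [exact: emeasurable_fun_o_infty|exact: emeasurable_fun_infty_c].
by rewrite !setTI.
Qed.

Let gE r i y : \bar R := (g y * (\1_(E r i) y)%:E)%E.

Let mgE r i : measurable_fun setT (gE r i).
Proof. by apply: emeasurable_funM => //; exact/measurable_EFinP. Qed.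

Let gE0 r i y : (0 <= gE r i y)%E.
Proof. by rewrite mule_ge0// lee_fin. Qed.

(** The condition [0 < r] empties the set at radius 0, where no growth bound is at hand. *)
Definition many_intermediate_values (r : nat) : set H :=
  [set x | (0 < r)%N /\ ((expR (a * r%:R))%:E <=
     \sum_(i < (2 * r).+1) \int[mu]_(y in xsection (hkernel r i) x) gE r i y)%E].

Let mS (r : nat) : measurable_fun setT (fun x =>
  \sum_(i < (2 * r).+1) \int[mu]_(y in xsection (hkernel r i) x) gE r i y)%E.
Proof.
apply: emeasurable_sum => i.
by apply: measurable_integral_xsection => //; exact: measurable_hkernel.
Qed.

Lemma measurable_many_intermediate_values r : measurable (many_intermediate_values r).
Proof.
have [->|r0] := posnP r.
  by rewrite (_ : many_intermediate_values 0 = set0)//; apply/seteqP; split => x [].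
rewrite (_ : many_intermediate_values r = setT `&` [set x | ((expR (a * r%:R))%:E <=
     \sum_(i < (2 * r).+1) \int[mu]_(y in xsection (hkernel r i) x) gE r i y)%E]).
  exact: emeasurable_fun_c_infty.
by apply/seteqP; split => x /= [].
Qed.

Let coef (r i : nat) : R := expR (- (a * r%:R)) *
  (Cw * expR (a * ((2 * r%:R - i%:R) / 2 * (p - delta) + r%:R * delta))).

Let coef0 r i : 0 <= coef r i.
Proof. by rewrite mulr_ge0 ?expR_ge0// mulr_ge0 ?expR_ge0// ltW. Qed.

Let F (r : nat) (y : H) : \bar R := (\sum_(i < (2 * r).+1) (coef r i)%:E * gE r i y)%E.

Let F0 r y : (0 <= F r y)%E.
Proof. by apply: sume_ge0 => i _; rewrite mule_ge0// lee_fin. Qed.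

Let mF r : measurable_fun setT (F r).
Proof. by apply: emeasurable_sum => i; exact: measurable_funeM. Qed.

Let weighted_many_le r : (nu (many_intermediate_values r) <= \int[nu]_y F r y)%E.
Proof.
have [->|r0] := posnP r.
  rewrite (_ : many_intermediate_values 0 = set0) ?measure0 ?integral_ge0//.
  by apply/seteqP; split => x [].
have S0 x : (0 <= \sum_(i < (2 * r).+1)
    \int[mu]_(y in xsection (hkernel r i) x) gE r i y)%E.
  by apply: sume_ge0 => i _; exact: integral_ge0.
apply: le_trans (_ : (nu [set x | ((expR (a * r%:R))%:E <=
     \sum_(i < (2 * r).+1) \int[mu]_(y in xsection (hkernel r i) x) gE r i y)%E] <= _)%E).
  apply: ge0_subset_integral_nonmeasurable => [x []//|x _].
  by rewrite lee_fin weight_ge0.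
apply: le_trans (markov_le nu (expR_gt0 _) (mS r) S0) _.
rewrite ge0_integral_sum//; last 2 first.
- by move=> i; apply: measurable_integral_xsection => //; exact: measurable_hkernel.
- by move=> i x _; exact: integral_ge0.
rewrite /F ge0_integral_sum//; last 2 first.
- by move=> i; exact: measurable_funeM.
- by move=> i x _; rewrite mule_ge0// lee_fin.
rewrite ge0_sume_distrr; last by move=> i _; apply: integral_ge0 => x _; exact: integral_ge0.
apply: lee_sum => i _; rewrite ge0_integralZl//; last by rewrite lee_fin.
rewrite /coef EFinM -muleA expRN lee_wpmul2l// ?lee_fin ?invr_ge0 ?expR_ge0//.
have c0 : 0 <= Cw * expR (a * ((2 * r%:R - i%:R) / 2 * (p - delta) + r%:R * delta)).
  by rewrite mulr_ge0 ?expR_ge0// ltW.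
exact: (integral_kernel_le (measurable_hkernel r i) (mgE r i) (gE0 r i) c0
  (kernel_growth i r0)).
Qed.

(** At a value [expR tau], summing over [i] leaves [expR ((p + eta) * tau - a * eta * r%:R)]. The
    upper cut keeps only the [r] with [tau <= a * r%:R], so the geometric series in [r] starts there
    and returns [expR (p * tau)]. *)
Lemma weighted_many_intermediate_values (G : R) : 0 < G ->
  (forall m : nat, \sum_(i < m) expR (- (kappa / 2 * i%:R)) <= G) ->
  (\sum_(0 <= r <oo) nu (many_intermediate_values r) <=
    (Cw * G * (expR (a * eta) / (expR (a * eta) - 1)))%:E * \int[nu]_y g y `^ p)%E.
Proof.
move=> G0 HG; pose rho := expR (a * eta).
have rho1 : 1 < rho by rewrite expR_gt1 mulr_gt0.
have rho0 : 0 < rho by exact: expR_gt0.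
have C0 : 0 < Cw * G * (rho / (rho - 1)).
  by rewrite !mulr_gt0// ?invr_gt0 ?subr_gt0.
rewrite -/rho.
apply: le_trans (_ : \sum_(0 <= r <oo) \int[nu]_y F r y <= _)%E.
  by apply: lee_nneseries => // r _; exact: weighted_many_le.
rewrite -integral_nneseries//.
have mgp : measurable_fun setT (fun y => g y `^ p)%E.
  exact: (measurableT_comp (measurable_poweR _)).
rewrite -ge0_integralZl//; last 2 first.
- by move=> y _; exact: poweR_ge0.
- by rewrite lee_fin ltW.
apply: ge0_le_integral_nonmeasurable => y _; first exact: nneseries_ge0.
(* The values 0 and +oo lie in no [E r i]: thresholds are positive and upper cuts finite. *)
have [[t [t0 gyt]]|gy] := pselect (exists t : R, 0 < t /\ g y = t%:E); last first.
  rewrite eseries0 ?mule_ge0 ?poweR_ge0 ?lee_fin ?(ltW C0)// => r _ _.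
  rewrite /F big1// => i _; rewrite /gE indicE; case: (boolP (y \in E r i)); last first.
    by rewrite !mule0.
  rewrite inE => -[gl gu]; exfalso; apply: gy.
  move: gl gu; case: (g y) => [t| |]// gl _; exists t; split => //.
  by rewrite lte_fin in gl; exact: lt_trans (expR_gt0 _) gl.
pose tau := ln t; have et : t = expR tau by rewrite lnK.
have term r : (F r y <= (Cw * G * expR ((p + eta) * tau))%:E *
    (if (rho ^- r)%:E <= (expR (- (eta * tau)))%:E then (rho ^- r)%:E else 0))%E.
  have [tr|tr] := leP tau (a * r%:R); last first.
    rewrite /F big1; first by rewrite mule_ge0// ?lee_fin ?mulr_ge0 ?expR_ge0 ?(ltW Cw0) ?(ltW G0)//;
      case: ifPn => // _; rewrite lee_fin invr_ge0 exprn_ge0// ltW.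
    move=> i _; rewrite /gE indicE; case: (boolP (y \in E r i)); last by rewrite !mule0.
    by rewrite inE => -[_]; rewrite gyt lee_fin et ler_expR leNgt tr.
  have -> : rho ^- r = expR (- (a * eta * r%:R)).
    by rewrite /rho expRN -expRM_natl; congr ((expR _)^-1); ring.
  rewrite lee_fin ler_expR lerN2 ifT; last first.
    by rewrite -mulrA mulrCA ler_pM2l.
  apply: le_trans (_ : \sum_(i < (2 * r).+1) (Cw * expR ((p + eta) * tau) *
     expR (- (a * eta * r%:R)) * expR (- (kappa / 2 * i%:R)))%:E <= _)%E; last first.
    rewrite sumEFin -EFinM lee_fin -mulr_sumr.
    rewrite (_ : Cw * G * _ * _ = Cw * expR ((p + eta) * tau) * expR (- (a * eta * r%:R)) * G).
      by rewrite ler_wpM2l// !mulr_ge0 ?expR_ge0// ltW.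
    by ring.
  apply: lee_sum => i _; rewrite /gE indicE; case: (boolP (y \in E r i)) => [|_]; last first.
    by rewrite !mule0 lee_fin !mulr_ge0 ?expR_ge0// ltW.
  rewrite inE => -[]; rewrite gyt !lte_fin et ltr_expR => h1 _.
  rewrite mule1 -EFinM lee_fin /coef.
  rewrite (_ : _ * (Cw * _) * _ = Cw * (expR (- (a * r%:R)) *
    (expR (a * ((2 * r%:R - i%:R) / 2 * (p - delta) + r%:R * delta)) * expR tau))); last by ring.
  rewrite -!(mulrA Cw) ler_pM2l// -!expRD ler_expR.
  by have := exponent_le h1; lra.
apply: le_trans (lee_nneseries _ (fun r _ => term r)) _ => //.
have e0 : (0 <= (Cw * G * expR ((p + eta) * tau))%:E)%E.
  by rewrite lee_fin !mulr_ge0 ?expR_ge0// ltW.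
rewrite nneseriesZl//; last first.
  by move=> r _; case: ifPn => // _; rewrite lee_fin invr_ge0 exprn_ge0// ltW.
apply: le_trans (lee_wpmul2l e0 (nneseries_cutoffV rho1 _)) _.
  by rewrite lee_fin expR_ge0.
rewrite gyt poweR_EFin et -expRM -!EFinM lee_fin.
rewrite [leLHS](_ : _ = Cw * G * (rho / (rho - 1)) *
  (expR ((p + eta) * tau) * expR (- (eta * tau)))); last by ring.
rewrite -expRD ler_pM2l// ler_expR.
by rewrite le_eqVlt; apply/orP; left; apply/eqP; ring.
Qed.

(** The threshold times the volume of the slice is of order [expR (a * r%:R - eps * i%:R)], which is
    summable in [i]. *)
Lemma low_part_le (CV G : R) : 0 < CV ->
  (forall r i x, (mu (xsection (hkernel r i) x) <=
    (CV * expR (n.-1%:R * (i%:R / 2)))%:E)%E) ->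
  (forall m : nat, \sum_(i < m) expR (- (eps * i%:R)) <= G) ->
  forall (r : nat) x,
  (forall y, hball x r%:R y -> (g y <= (expR (a * r%:R))%:E)%E) ->
  (\int[mu]_(y in hball x r%:R) g y <= (CV * G * expR (a * r%:R))%:E +
    \sum_(i < (2 * r).+1) \int[mu]_(y in xsection (hkernel r i) x) gE r i y)%E.
Proof.
move=> CV0 HV HG r x gr; apply: le_trans (ball_integral_le_kernels r x mg g0) _.
have mK i : measurable (xsection (hkernel (R := R) (n := n) r i) x).
  by apply: measurable_xsection; exact: measurable_hkernel.
apply: le_trans (_ : \sum_(i < (2 * r).+1) ((CV * expR (a * r%:R) * expR (- (eps * i%:R)))%:E +
    \int[mu]_(y in xsection (hkernel r i) x) gE r i y) <= _)%E; last first.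
  rewrite big_split/= leeD2r// sumEFin lee_fin -mulr_sumr mulrAC.
  by rewrite ler_pM2r ?expR_gt0// ler_pM2l//; exact: HG.
apply: lee_sum => i _.
apply: le_trans (_ : \int[mu]_(y in xsection (hkernel r i) x)
   ((threshold r i)%:E + gE r i y) <= _)%E.
  apply: ge0_le_integral_nonmeasurable => y //.
  rewrite /xsection/= inE => -[/= xy _].
  rewrite /gE indicE; case: (boolP (y \in E r i)) => [_|].
    by rewrite mule1 leeDr// lee_fin expR_ge0.
  rewrite notin_setE mule0 adde0 => /not_andP[/negP|]; first by rewrite -leNgt.
  by move=> /(_ (gr y xy)).
rewrite ge0_integralD//; last 2 first.
- by move=> y _; rewrite lee_fin expR_ge0.
- exact: measurable_funTS.
rewrite integral_cst// leeD2r//.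
apply: le_trans (lee_wpmul2l _ (HV r i x)) _; first by rewrite lee_fin expR_ge0.
rewrite -EFinM lee_fin mulrCA -mulrA ler_pM2l// -!expRD ler_expR.
by rewrite le_eqVlt; apply/orP; left; apply/eqP; field.
Qed.

End intermediate_values.

Lemma weak_type_large_radii : exists C L : R, [/\ 0 < C, 0 < L &
  forall f : H -> \bar R, measurable_fun setT f -> (forall y, 0 <= f y)%E ->
  exists U : set H, [/\ measurable U,
    forall x (r : nat), (1 <= r)%N ->
      ((L * expR (a * r%:R))%:E < \int[mu]_(y in hball x r%:R) f y)%E -> U x &
    (nu U <= C%:E * \int[nu]_y f y `^ p)%E]].
Proof.
have [c cpos Hc] := @hvolume_hball_ge R n n2.
have [CV CV0 HV] := @hvolume_hkernel_le R n n2.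
have [CB CB0 HB] := weighted_hball_le n2 p1 delta1 Cw0 kernel_growth.
have [C1 C10 H1] := @ball_integral_mean R n n2.
have kappa20 : 0 < kappa / 2 by rewrite divr_gt0.
have [G G0 HG] := sum_expRN_le kappa20.
have [G' G'0 HG'] := sum_expRN_le eps0.
have [I1 I10 HI1] := ball_integral_bounded n2 p1 delta1 Cw0 kernel_growth p1 (leqnn 1).
have [I2 I20 HI2] := ball_integral_bounded n2 p1 delta1 Cw0 kernel_growth p1 (ltn0Sn 1).
pose c1 := c * expR (a * 1); have c10 : 0 < c1 by rewrite mulr_gt0 ?expR_gt0.
have er0 (b : R) : 0 < b -> 0 < expR b / (expR b - 1).
  by move=> b0; rewrite divr_gt0 ?expR_gt0// subr_gt0 expR_gt1.
pose K1 := c1^-1 * CB * expR (a * p) * (expR (a * p) / (expR (a * p) - 1)).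
pose K2 := Cw * G * (expR (a * eta) / (expR (a * eta) - 1)).
have K10 : 0 < K1.
  apply: mulr_gt0; last by apply: er0; exact: mulr_gt0.
  by rewrite mulr_gt0 ?expR_gt0// mulr_gt0// invr_gt0.
have K20 : 0 < K2.
  by apply: mulr_gt0; [exact: mulr_gt0|apply: er0; exact: mulr_gt0].
(* [CV * G'] covers the values below the thresholds and 1 is left for the intermediate ones. The
   factor [expR a] below pays for the passage from [r] to [r.+1]. *)
pose L' := CV * G' + 1.
have L'0 : 0 < L' by rewrite addr_gt0 ?mulr_gt0.
exists (K1 * I2 + K2 * I1), (C1 * L' * expR a); split.
- by apply: addr_gt0; exact: mulr_gt0.
- by apply: mulr_gt0; [exact: mulr_gt0|exact: expR_gt0].
move=> f mf f0.
pose g y := (\int[mu]_(z in hball y 1) f z)%E.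
(* With radius 2, [h] is at least [g y] on the whole unit ball about [y]: one large value of [g]
   becomes a unit ball of large values of [h]. *)
pose h y := (\int[mu]_(z in hball y 2) f z)%E.
have mg : measurable_fun setT g by exact: measurable_ball_integral.
have mh : measurable_fun setT h by exact: measurable_ball_integral.
have g0 y : (0 <= g y)%E by exact: integral_ge0.
pose U1 := near_large_values h c1.
pose U2 := many_intermediate_values g.
have mU1 r : measurable (U1 r) by exact: measurable_near_large_values.
have mU2 r : measurable (U2 r) by exact: measurable_many_intermediate_values.
exists ((\bigcup_r U1 r) `|` (\bigcup_r U2 r)); split.
- by apply: measurableU; exact: bigcup_measurable.
- move=> x r r1 Lr.
  have {Lr} : ((L' * expR (a * r.+1%:R))%:E < \int[mu]_(y in hball x r.+1%:R) g y)%E.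
    rewrite -(@lte_pmul2l _ C1%:E) ?lte_fin//; apply: (lt_le_trans (y := (\int[mu]_(y in hball x r%:R) f y)%E)).
      rewrite -EFinM -[r.+1%:R]natr1 mulrDr mulr1 expRD.
      by rewrite (_ : C1 * _ = C1 * L' * expR a * expR (a * r%:R)) //; ring.
    by rewrite -natr1; exact: H1.
  have [[y [xy gy]]|small] := pselect (exists y, hball x r.+1%:R y /\ ((expR (a * r.+1%:R))%:E < g y)%E).
    move=> _; left; exists r.+1 => //; apply: (near_large_values_ball _ xy).
      exact: Hc.
    move=> z yz; apply: lt_le_trans gy _.
    apply: ge0_subset_integral_nonmeasurable => // v; rewrite /hball/= => yv.
    apply: le_lt_trans (hdist_triangle z y v) _.
    by rewrite (_ : 2 = 1 + 1)// ltrD// hdistC.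
  have {}small y : hball x r.+1%:R y -> (g y <= (expR (a * r.+1%:R))%:E)%E.
    by move=> xy; rewrite leNgt; apply/negP => gy; apply: small; exists y.
  move=> /lt_le_trans/(_ (@low_part_le g mg g0 CV G' CV0 HV HG' r.+1 x small)) HS.
  right; exists r.+1 => //; split => //.
  rewrite leNgt; apply/negP => HS'.
  move: HS; rewrite ltNge => /negP; apply.
  apply: le_trans (leeD2l _ (ltW HS')) _.
  by rewrite -EFinD lee_fin /L' mulrDl mul1r.
apply: (@le_trans _ _ (nu (\bigcup_r U1 r) + nu (\bigcup_r U2 r))%E).
  apply: measureU2; exact: bigcup_measurable.
rewrite EFinD ge0_muleDl; last 2 first.
- by rewrite lee_fin; exact: mulr_ge0 (ltW K10) (ltW I20).
- by rewrite lee_fin; exact: mulr_ge0 (ltW K20) (ltW I10).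
apply: leeD.
  apply: (@le_trans _ _ (\sum_(0 <= r <oo) nu (U1 r))%E).
    by apply: measure_sigma_subadditive => //; exact: bigcup_measurable.
  have HU1 := weighted_near_large_values mh c10 CB0 HB.
  apply: (le_trans HU1).
  rewrite (EFinM K1) -muleA lee_wpmul2l//; first by rewrite lee_fin ltW.
  exact: HI2.
apply: (@le_trans _ _ (\sum_(0 <= r <oo) nu (U2 r))%E).
  by apply: measure_sigma_subadditive => //; exact: bigcup_measurable.
have HU2 := weighted_many_intermediate_values mg g0 G0 HG.
apply: (le_trans HU2).
rewrite (EFinM K2) -muleA lee_wpmul2l//; first by rewrite lee_fin ltW.
exact: HI1.
Qed.

End weak_type_large_radii.

(** * Small radii *)

Section muckenhoupt.
Local Open Scope ereal_scope.
Context {R : realType} {n : nat}.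
Local Notation H := (hyperbolic R n).
Local Notation mu := (@hvolume R n).
Variables (p : R) (w : weight H R).
Local Notation nu := (weighted mu w).
Hypotheses (n2 : (2 <= n)%N) (p1 : (1 <= p)%R) (Apw : Ap_loc p w).

Let p0 : (0 < p)%R. Proof. exact: lt_le_trans p1. Qed.

Let mw : measurable_fun setT (EFin \o w).
Proof. exact/measurable_EFinP/measurable_weight. Qed.

Let w0 x : 0 <= (w x)%:E. Proof. by rewrite lee_fin weight_ge0. Qed.

Lemma hvolume_small_fin x (r : R) : (0 < r <= 1)%R ->
  exists2 V : R, (0 < V)%R & mu (hball x r) = V%:E.
Proof.
move=> r01; have [c [C [c0 C0 HV]]] := @hvolume_small_hball R n n2.
have /andP[r0 _] := r01; have := HV x r r01.
case: (mu (hball x r)) => [V| |] /andP[]//.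
rewrite !lee_fin => cV _; exists V => //.
by apply: lt_le_trans cV; rewrite mulr_gt0// exprn_gt0.
Qed.

Let Holder_ball1 : p = 1%R -> exists2 K : R, (0 < K)%R & forall x (r : R) (f : H -> \bar R),
  (0 < r <= 1)%R -> measurable_fun setT f -> (forall y, 0 <= f y) ->
  nu (hball x r) * (\int[mu]_(y in hball x r) f y) `^ p
    <= K%:E * mu (hball x r) `^ p * \int[mu]_(y in hball x r) (f y `^ p * (w y)%:E).
Proof.
move=> pE; move: Apw; rewrite /Ap_loc pE eqxx => -[K K0 HK]; exists K => //.
move=> x r f r01 mf f0; have [V V0 HV] := hvolume_small_fin x r01.
rewrite poweRe1; last exact: integral_ge0.
rewrite HV poweRe1 ?lee_fin ?(ltW V0)//.
under [X in _ <= _ * X]eq_integral do rewrite poweRe1//.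
have := HK x r r01; rewrite /average HV inver gt_eqF//.
set m := ess_inf _ _ => Hm.
have m0 : 0 <= m by apply/ess_infP; apply: aeW => y /=; exact: w0.
have {}Hm : nu (hball x r) <= (K * V)%:E * m.
  rewrite (_ : nu (hball x r) = V%:E * ((V^-1)%:E * \int[mu]_(y in hball x r) (w y)%:E)).
    by rewrite mulrC EFinM -muleA lee_pmul2l// lte_fin.
  by rewrite muleA -EFinM mulfV ?gt_eqF// mul1e.
apply: le_trans (lee_wpmul2r (integral_ge0 _ _) Hm) _ => //.
rewrite -EFinM -muleA lee_pmul2l ?lte_fin ?mulr_gt0//.
have mB := measurable_hball x r.
rewrite -ge0_integralZl//; last exact: measurable_funTS.
have mfB : measurable_fun (hball x r) f by exact: measurable_funTS.
have mwB : measurable_fun (hball x r) (EFin \o w) by exact: measurable_funTS.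
apply: ae_ge0_le_integral => //.
- by move=> y _; exact: mule_ge0.
- exact: measurable_funeM.
- by move=> y _; exact: mule_ge0.
- exact: emeasurable_funM.
(* The exceptional set is null for the restriction of [mu] to the ball, so its trace on the ball is
   null for [mu]. *)
have [N [mN N0 HN]] := ess_inf_le (mrestr mu mB) (EFin \o w).
exists (N `&` hball x r); split => //; first exact: measurableI.
move=> y /= /not_implyP[xy Hy]; split => //; apply: HN => /= my.
by apply: Hy; rewrite [leRHS]muleC lee_wpmul2r.
Qed.

Let Holder_ballp : p <> 1%R -> exists2 K : R, (0 < K)%R & forall x (r : R) (f : H -> \bar R),
  (0 < r <= 1)%R -> measurable_fun setT f -> (forall y, 0 <= f y) ->
  nu (hball x r) * (\int[mu]_(y in hball x r) f y) `^ p
    <= K%:E * mu (hball x r) `^ p * \int[mu]_(y in hball x r) (f y `^ p * (w y)%:E).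
Proof.
move=> /eqP pE; move: Apw; rewrite /Ap_loc (negbTE pE); set S := ereal_sup _ => Soo.
have p11 : (0 < p - 1)%R by rewrite subr_gt0 lt_neqAle eq_sym pE.
pose sigma (y : H) : \bar R := (w y)%:E^-1 `^ (p - 1)^-1.
have HS x r : (0 < r <= 1)%R -> average mu (hball x r) (EFin \o w) *
    average mu (hball x r) sigma `^ (p - 1) <= S.
  by move=> r01; apply: ereal_sup_ubound; exists (x, r).
have [K [K0 HK]] : exists K : R, (0 < K)%R /\ S <= K%:E.
  move: Soo; case: (S) => [k| |]// _.
  - exists (Num.max k 1)%R; split; first by rewrite lt_max ltr01 orbT.
    by rewrite lee_fin le_max lexx.
  - by exists 1%R; split => //; exact: leNye.
exists (2 `^ p * K)%R; first by rewrite mulr_gt0// powR_gt0.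
move=> x r f r01 mf f0; have [V V0 HV] := hvolume_small_fin x r01.
have mB := measurable_hball x r.
have sigmaE y : sigma y = if w y == 0%R then +oo else (expR (- (p - 1)^-1 * ln (w y)))%:E.
  rewrite /sigma inver; case: eqVneq => wy.
    by rewrite poweRyr// gt_eqF// invr_gt0.
  have wy0 : (0 < w y)%R by rewrite lt_neqAle eq_sym wy weight_ge0.
  rewrite poweR_EFin /powR invr_eq0 (negbTE wy) lnV ?posrE//.
  by rewrite mulrN mulNr.
have sigma0 y : 0 < sigma y by rewrite sigmaE; case: ifPn; rewrite ?lte_fin ?expR_gt0.
have msigma : measurable_fun setT sigma.
  apply: (eq_measurable_fun (fun y => if w y == 0%R then +oo else
    (expR (- (p - 1)^-1 * ln (w y)))%:E)); first by move=> y _; rewrite sigmaE.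
  apply: measurable_fun_ifT => //.
    by apply: measurable_fun_eqr => //; exact: measurable_weight.
  apply/measurable_EFinP; apply: measurableT_comp => //.
  apply: measurable_funM => //.
  exact: (measurableT_comp (@measurable_ln R) (measurable_weight _)).
(* If the ball has weight 0, the A_p product may be 0 times +oo and says nothing about [sigma]; the
   claim is then trivial. *)
have [nuB0|nuB0] := eqVneq (nu (hball x r)) 0.
  rewrite nuB0 mul0e mule_ge0//.
    by rewrite mule_ge0 ?poweR_ge0// lee_fin mulr_ge0 ?powR_ge0// ltW.
  by apply: integral_ge0 => y _; rewrite mule_ge0// poweR_ge0.
have nuB : 0 < nu (hball x r) by rewrite lt_neqAle eq_sym nuB0 measure_ge0.
have := le_trans (HS x r r01) HK.
rewrite /average HV inver gt_eqF//.
change (\int[mu]_(y in hball x r) (EFin \o w) y) with (nu (hball x r)).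
have : 0 < \int[mu]_(y in hball x r) sigma y.
  rewrite lt_neqAle integral_ge0 ?andbT; last by move=> y _; exact: ltW.
  apply/eqP => /esym s0.
  have : \int[mu]_(y in hball x r) `|sigma y| = 0.
    by rewrite -[RHS]s0; apply: eq_integral => y _; rewrite gee0_abs// ltW.
  move=> /(ae_eq_integral_abs mu mB (measurable_funTS msigma)) [N [mN N0 HN]].
  have : mu (hball x r) <= mu N.
    apply: hvolume_mono => y xy; apply: HN => /= /(_ xy) /= sy0.
    by have := sigma0 y; rewrite sy0 ltxx.
  by rewrite N0 HV lee_fin leNgt V0.
(* As the weight of the ball is positive, a finite A_p product excludes an infinite integral of
   [sigma]. *)
case Es : (\int[mu]_(y in hball x r) sigma y) => [M| |]//; last first.
  move=> _; rewrite gt0_muley ?lte_fin ?invr_gt0// poweRyr ?gt_eqF//.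
  by rewrite gt0_muley// mule_gt0// lte_fin invr_gt0.
rewrite lte_fin => M0.
rewrite -EFinM (poweR_EFin (V^-1 * M)%R) powRM ?invr_ge0 ?(ltW V0) ?(ltW M0)// => HKB.
have Vp : (V `^ p = V * V `^ (p - 1))%R.
  by rewrite mulr_powRB1// ltW.
have {}HKB : nu (hball x r) * (M `^ (p - 1))%:E <= (K * V `^ p)%:E.
  have VV0 : (0 < V `^ p)%R by rewrite powR_gt0.
  have VV1 : (V^-1 `^ (p - 1) = (V `^ (p - 1))^-1)%R.
    by rewrite -[(V^-1)%R](powR_inv1 (ltW V0)) -powRrM mulrC powRrM powR_inv1 ?powR_ge0.
  have -> : nu (hball x r) * (M `^ (p - 1))%:E = (V `^ p)%:E * ((V^-1)%:E * nu (hball x r) *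
    (V^-1 `^ (p - 1) * M `^ (p - 1))%:E).
    rewrite (muleC (V^-1)%:E) -(muleA (nu _)) (muleCA (V `^ p)%:E) -!EFinM; congr (_ * _%:E).
    rewrite VV1 Vp; field.
    by rewrite !gt_eqF// powR_gt0.
  by rewrite (mulrC K) (EFinM (V `^ p)%R) lee_pmul2l// lte_fin.
rewrite [leLHS]muleC.
have young : (\int[mu]_(y in hball x r) f y) `^ p <= (2 `^ p * M `^ (p - 1))%:E *
    \int[mu]_(y in hball x r) (f y `^ p * (w y)%:E).
  apply: (@poweR_integral_le_young _ _ _ mu _ f sigma) => //.
  - exact: measurable_funTS.
  - by move=> y _; exact: ltW.
  - apply: emeasurable_funM; last exact: measurable_funTS.
    apply: measurable_funTS; exact: (measurableT_comp (measurable_poweR _)).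
  - by move=> y _; rewrite mule_ge0// poweR_ge0.
  (* Where [w] vanishes, [sigma] is +oo and the inequality is trivial; elsewhere it is
     [le_add_poweR] at [t * sigma y]. *)
  - move=> t y t0 _; rewrite sigmaE; case: eqVneq => wy.
      by rewrite gt0_muley ?lte_fin// wy mule0 mule0 adde0 leey.
    have wy0 : (0 < w y)%R by rewrite lt_neqAle eq_sym wy weight_ge0.
    have e0 := expR_gt0 (- (p - 1)^-1 * ln (w y)).
    have := @le_add_poweR _ p (t * expR (- (p - 1)^-1 * ln (w y))) (f y) p1 (mulr_gt0 t0 e0) (f0 y).
    rewrite (powRM _ (ltW t0) (ltW e0)) -expRM.
    rewrite (_ : expR (_ * _ * _) = w y); last first.
      by rewrite (_ : _ * _ = ln (w y))%R ?lnK ?posrE//; field; rewrite gt_eqF.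
    by rewrite (muleC (f y `^ p)) muleA -!EFinM.
  - by rewrite Es.
apply: le_trans (lee_wpmul2r (ltW nuB) young) _.
have mulACE (A M' X N : \bar R) : A * M' * X * N = N * M' * (A * X).
  by rewrite muleC !muleA (muleAC N A).
rewrite (EFinM (2 `^ p)%R (M `^ _)%R) mulACE.
apply: le_trans (lee_wpmul2r _ HKB) _.
  rewrite mule_ge0 ?lee_fin ?powR_ge0//.
  by apply: integral_ge0 => y _; rewrite mule_ge0// poweR_ge0.
rewrite poweR_EFin muleA -!EFinM (_ : (K * V `^ p * 2 `^ p)%R = (2 `^ p * K * V `^ p)%R)//.
by ring.
Qed.

(** The local A_p condition tested on functions: a form common to [p = 1] and [p > 1], and the only
    one used below. *)
Lemma Holder_ball : exists2 K : R, (0 < K)%R & forall x (r : R) (f : H -> \bar R),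
  (0 < r <= 1)%R -> measurable_fun setT f -> (forall y, 0 <= f y) ->
  nu (hball x r) * (\int[mu]_(y in hball x r) f y) `^ p
    <= K%:E * mu (hball x r) `^ p * \int[mu]_(y in hball x r) (f y `^ p * (w y)%:E).
Proof. by have [/Holder_ball1//|/Holder_ballp] := pselect (p = 1%R). Qed.

End muckenhoupt.

(** * Vitali covering by rational balls *)

Section covering.
Context {R : realType} {n : nat}.
Local Notation H := (hyperbolic R n).
Local Notation mu := (@hvolume R n).
Implicit Types (x y z : H) (b c : H * R) (s t : seq (H * R)).

Definition bball b : set H := hball b.1 b.2.
Definition bball3 b : set H := hball b.1 (3 * b.2).

Lemma hball_sub x z (r r' : R) : hdist x z + r <= r' -> hball z r `<=` hball x r'.
Proof.
move=> h y; rewrite /hball/= => zy.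
by apply: le_lt_trans (hdist_triangle x z y) _; lra.
Qed.

Lemma bball3_meet b c : c.2 <= b.2 -> bball b `&` bball c !=set0 -> bball c `<=` bball3 b.
Proof.
move=> cb [y [/= by_ cy]]; apply: hball_sub; rewrite /bball/hball/= in by_ cy.
by have := hdist_triangle b.1 y c.1; rewrite (hdistC y c.1); lra.
Qed.

Lemma seq_max_radius b s : exists2 c, c \in b :: s & forall c', c' \in b :: s -> c'.2 <= c.2.
Proof.
elim: s b => [b|b' s IH b].
  by exists b; rewrite ?mem_head// => c'; rewrite inE => /eqP ->.
have [c cs Hc] := IH b'; have [bc|cb] := leP b.2 c.2.
  exists c; first by rewrite inE cs orbT.
  by move=> c'; rewrite inE => /predU1P[->//|/Hc].
exists b; first by rewrite mem_head.
by move=> c'; rewrite inE => /predU1P[->//|/Hc h]; exact: le_trans h (ltW cb).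
Qed.

(** Greedy selection: keep a ball of largest radius, discard all those that meet it, since its
    triple contains them, and recurse on the rest. *)
Lemma vitali_finite s : exists t, [/\ uniq t, {subset t <= s},
  forall b c, b \in t -> c \in t -> bball b `&` bball c !=set0 -> b = c &
  forall b, b \in s -> exists2 c, c \in t & bball b `<=` bball3 c].
Proof.
have [m] := ubnP (size s); elim: m s => // m IH [|b0 s0] ssm.
  by exists [::]; split.
set s := b0 :: s0 in ssm *; have [b bs bmax] := seq_max_radius b0 s0.
pose s' := [seq c <- s | `[< bball b `&` bball c = set0 >]].
have meet_self c : c \in s' -> b = c -> bball b = set0.
  by rewrite mem_filter => /andP[/asboolP h _] bc; move: h; rewrite -bc setIid.
(* An empty ball does not meet itself, so the recursion would not shrink the list. But if the
   largest ball is empty, all are. *)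
have [bb0|bb0] := eqVneq (bball b) set0.
  have all0 c : c \in s -> bball c = set0.
    move=> cs; apply/seteqP; split => // y; rewrite /bball/hball/= => cy.
    have b2 : 0 < b.2.
      by apply: lt_le_trans (bmax _ cs); apply: le_lt_trans cy; exact: hdist_ge0.
    suff : bball b b.1 by rewrite bb0.
    rewrite /bball/hball/= hdistE /arcosh.
    have -> : cdist b.1 b.1 = 1.
      by rewrite /cdist big1 ?subrr ?expr0n ?addr0 ?mul0r ?addr0// => i _; rewrite subrr expr0n.
    by rewrite expr1n subrr sqrtr0 addr0 ln1.
  exists [:: b]; split => //.
  - by move=> c; rewrite inE => /eqP ->.
  - by move=> c c'; rewrite !inE => /eqP -> /eqP ->.
  - by move=> c /all0 ->; exists b; rewrite ?mem_head.
have bs' : b \notin s'.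
  by apply/negP => /meet_self -/(_ erefl)/eqP; rewrite (negbTE bb0).
have ss' : (size s' < m)%N.
  rewrite -ltnS; apply: leq_trans ssm.
  rewrite ltnS size_filter -(count_predC (fun c => `[< bball b `&` bball c = set0 >]) s).
  rewrite -addn1 leq_add2l -has_count; apply/hasP; exists b => //=.
  by apply/negP => /asboolP; rewrite setIid => /eqP; rewrite (negbTE bb0).
have [t [ut ts' dt ct]] := IH s' ss'.
have disj c : c \in t -> ~ (bball b `&` bball c !=set0).
  by move=> /ts'; rewrite mem_filter => /andP[/asboolP -> _] [].
exists (b :: t); split.
- by rewrite /= ut andbT; apply/negP => /ts'; rewrite (negbTE bs').
- by move=> c; rewrite inE => /predU1P[->//|/ts']; rewrite mem_filter => /andP[].
- move=> c c'; rewrite !inE => /predU1P[->|ct1] /predU1P[->|ct2]//.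
  + by move=> /(disj _ ct2).
  + by rewrite setIC => /(disj _ ct1).
  + exact: dt.
- move=> c cs; have [h|h] := pselect (bball b `&` bball c = set0).
    have /ct[c' c't sub] : c \in s' by rewrite mem_filter cs andbT; apply/asboolP.
    by exists c' => //; rewrite inE c't orbT.
  exists b; first by rewrite mem_head.
  by apply: bball3_meet; [exact: bmax|apply/set0P/eqP].
Qed.

(** A countable family makes the exceptional set a countable union, hence measurable, and an
    increasing limit of finite unions. Codes without meaning yield an empty ball. *)
Definition rational_ball (k : nat) : H * R :=
  if @unpickle (n.-1.-tuple rat * rat * rat)%type k is Some (t, q, r) then
    if pselect (0 < ratr q :> R) is left q0 then
      (@Hyperbolic R n (map_tuple (fun v : rat => ratr v : R) t) (ratr q) q0, ratr r)
    else (horigin, 0)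
  else (horigin, 0).

(** The bounds on centre and radius make the rational ball contain [hball x r], with radius at most
    tripled. *)
Lemma rational_ball_dense x (r : R) : 0 < r ->
  exists k, hdist x (rational_ball k).1 < r /\ 2 * r < (rational_ball k).2 < 3 * r.
Proof.
move=> r0; set s := ht x; have s0 : 0 < s by exact: ht_gt0.
pose c := cosh r - 1.
have c0 : 0 < c.
  rewrite subr_gt0; apply: le_lt_trans (cosh_ge1 0) _; exact: cosh_lt.
(* The second term keeps the sum of the squared errors, each at most [(s * theta) ^+ 2], below
   [c * s ^+ 2]; the first keeps the rational height above [s / 2]. *)
pose theta := Num.min 2^-1 (c / n.+1%:R).
have th0 : 0 < theta by rewrite lt_min invr_gt0 ltr0n divr_gt0.
have th1 : theta <= 2^-1 by rewrite ge_min lexx.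
have th2 : theta * n.+1%:R <= c by rewrite -ler_pdivlMr// ge_min lexx orbT.
pose eta := s * theta; have eta0 : 0 < eta by rewrite mulr_gt0.
have eta2 : eta <= s / 2 by rewrite ler_pM2l.
have near_rat (v : R) : exists q : rat, `|v - ratr q| < eta.
  have : v - eta < v + eta by lra.
  move=> /rat_in_itvoo[q]; rewrite in_itv/= => qv; exists q.
  by rewrite ltr_distlC.
have [f Hf] := choice (fun i : 'I_n.-1 => near_rat (horiz x i)).
have [q Hq] := near_rat s.
have [rho] : exists rho : rat, ratr rho \in `]2 * r, 3 * r[.
  by apply: rat_in_itvoo; lra.
rewrite in_itv/= => rhor.
exists (pickle ([tuple f i | i < n.-1], q, rho)).
have q0 : 0 < ratr q :> R.
  by move: Hq; rewrite ltr_distlC => /andP[]; lra.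
rewrite /rational_ball pickleK; case: pselect => // q0'; split => //.
pose z := @Hyperbolic R n (map_tuple (fun v : rat => ratr v : R) [tuple f i | i < n.-1]) (ratr q) q0'.
have hz : ht z = ratr q by [].
rewrite [(_, _).1](_ : _ = z)// hdist_lt ?(ltW r0)// /cdist hz -ltrBrDl -/c -/s.
have h1 : (s - ratr q) ^+ 2 <= eta ^+ 2.
  by rewrite -[leLHS]real_normK ?num_real// lerXn2r ?nnegrE ?(ltW eta0)// ltW.
have h2 : \sum_i (horiz x i - horiz z i) ^+ 2 <= n.-1%:R * eta ^+ 2.
  apply: le_trans (_ : \sum_(i < n.-1) eta ^+ 2 <= _).
    apply: ler_sum => i _; rewrite -[leLHS]real_normK ?num_real//.
    rewrite lerXn2r ?nnegrE ?(ltW eta0)// ltW//.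
    by have := Hf i; rewrite /horiz/= tnth_map tnth_mktuple.
  by rewrite sumr_const card_ord -[leLHS]mulr_natl.
have qs : s / 2 <= ratr q :> R.
  by move: Hq; rewrite ltr_distlC => /andP[]; lra.
have sq0 : 0 < 2 * s * ratr q by rewrite mulr_gt0// mulr_gt0.
rewrite ltr_pdivrMr//.
have h3 : s ^+ 2 <= 2 * s * ratr q by rewrite expr2; nra.
apply: lt_le_trans (_ : c * s ^+ 2 <= _); last by rewrite ler_pM2l.
have h4 : (n.-1%:R + 1) * eta ^+ 2 <= n.+1%:R * eta ^+ 2.
  by rewrite ler_wpM2r ?sqr_ge0// natr1 ler_nat ltnS leq_pred.
have h5 : n.+1%:R * eta ^+ 2 < c * s ^+ 2.
  rewrite /eta exprMn mulrCA [ltRHS]mulrC ltr_pM2l ?exprn_gt0//.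
  apply: lt_le_trans th2; rewrite (mulrC theta) ltr_pM2l ?ltr0n// expr2.
  by rewrite gtr_pMr//; lra.
apply: le_lt_trans (lerD h2 h1) _.
by rewrite -[X in _ + X]mul1r -mulrDl; exact: le_lt_trans h4 h5.
Qed.

End covering.

Lemma measure_bigsetU_le d (T : measurableType d) (R : realType) (m : {measure set T -> \bar R})
    (I : eqType) (s : seq I) (F : I -> set T) :
  (forall i, measurable (F i)) ->
  (m (\big[setU/set0]_(i <- s) F i) <= \sum_(i <- s) m (F i))%E.
Proof.
move=> mF; elim: s => [|i s IH]; first by rewrite !big_nil measure0.
rewrite !big_cons; apply: le_trans (measureU2 m (mF i) _) _.
  exact: bigsetU_measurable.
exact: leeD2l.
Qed.

Section weak_type_small_radii.
Local Open Scope ereal_scope.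
Context {R : realType} {n : nat}.
Local Notation H := (hyperbolic R n).
Local Notation mu := (@hvolume R n).
Variables (p : R) (w : weight H R).
Local Notation nu := (weighted mu w).
Hypotheses (n2 : (2 <= n)%N) (p1 : (1 <= p)%R) (Apw : Ap_loc p w).

Let p0 : (0 < p)%R. Proof. exact: lt_le_trans p1. Qed.

Lemma doubling_small : exists2 c : R, (0 < c)%R & forall x z (r rho : R),
  (0 < r)%R -> (0 < rho)%R -> (rho <= 3 * r)%R -> (3 * r <= 1)%R ->
  c%:E * mu (hball z rho) <= mu (hball x r).
Proof.
have [c [C [c0 C0 HV]]] := @hvolume_small_hball R n n2.
exists (c / (C * 3 ^+ n))%R; first by rewrite divr_gt0// mulr_gt0// exprn_gt0.
move=> x z r rho r0 rho0 rho3 r3.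
have /andP[cx _] : (c * r ^+ n)%:E <= mu (hball x r) <= (C * r ^+ n)%:E by apply: HV; lra.
have /andP[_ Cz] : (c * rho ^+ n)%:E <= mu (hball z rho) <= (C * rho ^+ n)%:E by apply: HV; lra.
apply: le_trans cx; apply: le_trans (lee_wpmul2l _ Cz) _.
  by rewrite lee_fin divr_ge0 ?(ltW c0)// mulr_ge0 ?exprn_ge0 ?(ltW C0).
rewrite -EFinM lee_fin.
apply: (@le_trans _ _ (c / (C * 3 ^+ n) * (C * (3 * r) ^+ n))%R).
  rewrite ler_pM2l ?ler_pM2l//; last by rewrite divr_gt0// mulr_gt0// exprn_gt0.
  by rewrite lerXn2r ?nnegrE ?(ltW rho0)// mulr_ge0// ltW.
rewrite le_eqVlt; apply/orP; left; apply/eqP; rewrite exprMn; field.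
by rewrite !gt_eqF// exprn_gt0.
Qed.

(** The inequality of [Holder_ball] on the tripled ball is tested on [f] cut off to the ball itself;
    doubling compares the two volumes. *)
Lemma weighted_bball3_le : exists2 K : R, (0 < K)%R & forall (c0 : R) (b : H * R) (f : H -> \bar R),
  (0 < c0)%R -> (0 < b.2)%R -> (9 * b.2 <= 1)%R -> measurable_fun setT f ->
  (forall y, 0 <= f y) -> c0%:E * mu (bball b) <= \int[mu]_(y in bball b) f y ->
  nu (bball3 b) <= (K * c0 `^ (- p))%:E * \int[nu]_(y in bball b) f y `^ p.
Proof.
have [K K0 HK] := Holder_ball n2 p1 Apw.
have [c cpos Hc] := doubling_small.
exists (K * c `^ (- p))%R; first by rewrite mulr_gt0// powR_gt0.
move=> c0 [x r] f c00 /= r0 r9 mf f0; rewrite /bball/bball3/= => Hf.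
have mB := measurable_hball x r.
pose g y := f y * (\1_(hball x r) y)%:E.
have mi : measurable_fun setT (fun y : H => (\1_(hball x r) y)%:E : \bar R).
  by apply/measurable_EFinP; exact: measurable_indic.
have mg : measurable_fun setT g by exact: emeasurable_funM.
have g0 y : 0 <= g y by rewrite mule_ge0// lee_fin.
have r31 : (0 < 3 * r <= 1)%R by apply/andP; split; lra.
have [V V0 HV] := hvolume_small_fin n2 x r31.
have sub : hball x r `<=` hball x (3 * r).
  by move=> y; rewrite /hball/= => h; apply: lt_trans h _; lra.
have := HK x (3 * r)%R g r31 mg g0.
have -> : \int[mu]_(y in hball x (3 * r)) g y = \int[mu]_(y in hball x r) f y.
  rewrite [LHS]integral_mkcond [RHS]integral_mkcond; apply: eq_integral => y _.
  rewrite !patchE /g indicE; case: (boolP (y \in hball x r)) => h.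
    by rewrite mule1 ifT// inE; apply: sub; rewrite inE in h.
  by rewrite mule0; case: ifPn.
have -> : \int[mu]_(y in hball x (3 * r)) (g y `^ p * (w y)%:E) =
    \int[nu]_(y in hball x r) f y `^ p.
  rewrite [RHS]integral_mkcond integral_weighted; last 2 first.
  - apply/(measurable_restrictT _ mB); apply: measurable_funTS.
    exact: (measurableT_comp (measurable_poweR _)).
  - by move=> y; rewrite patchE; case: ifPn => // _; exact: poweR_ge0.
  rewrite [LHS]integral_mkcond; apply: eq_integral => y _.
  rewrite !patchE /g indicE; case: (boolP (y \in hball x r)) => h.
    by rewrite mule1 ifT// inE; apply: sub; rewrite inE in h.
  by rewrite mule0 poweR0r ?gt_eqF// mul0e; case: ifPn.
set X := (\int[nu]_(y in hball x r) _); set N0 := nu _; rewrite HV => HKf.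
have cc0 : (0 < c0 * c * V)%R by rewrite !mulr_gt0.
have If : (c0 * c * V)%:E <= \int[mu]_(y in hball x r) f y.
  apply: le_trans Hf; rewrite -mulrA EFinM lee_pmul2l ?lte_fin//.
  by rewrite EFinM -HV; apply: Hc; lra.
have cc0e : 0 <= (c0 * c * V)%:E by rewrite lee_fin ltW.
have {}If := lee_poweR (ltW p0) cc0e If.
have HN : N0 * (c0 * c * V)%:E `^ p <= K%:E * V%:E `^ p * X.
  by apply: le_trans HKf; rewrite lee_wpmul2l// measure_ge0.
rewrite !poweR_EFin in HN.
have P0 : (0 < (c0 * c * V) `^ p)%R by rewrite powR_gt0.
rewrite -(@lee_pmul2l _ ((c0 * c * V) `^ p)%:E) ?lte_fin// muleC.
apply: le_trans HN _; rewrite muleA -!EFinM.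
rewrite lee_wpmul2r//; first by apply: integral_ge0 => y _; exact: poweR_ge0.
rewrite lee_fin !powRM ?mulr_ge0 ?(ltW c00) ?(ltW cpos) ?(ltW V0)//.
rewrite !powRN le_eqVlt; apply/orP; left; apply/eqP; field.
by rewrite !gt_eqF// powR_gt0.
Qed.

Lemma weak_type_small_radii : exists2 C : R, (0 < C)%R &
  forall f : H -> \bar R, measurable_fun setT f -> (forall y, 0 <= f y) ->
  exists U : set H, [/\ measurable U,
    forall x (r : R), (0 < r)%R -> (27 * r <= 1)%R ->
      mu (hball x r) < \int[mu]_(y in hball x r) f y -> U x &
    nu U <= C%:E * \int[nu]_y f y `^ p].
Proof.
have [K K0 HK] := weighted_bball3_le.
have [c cpos Hc] := doubling_small.
have C0 : (0 < K * c `^ (- p))%R by rewrite mulr_gt0// powR_gt0.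
exists (K * c `^ (- p))%R => //.
move=> f mf f0.
have mfp : measurable_fun setT (fun y => f y `^ p).
  exact: (measurableT_comp (measurable_poweR _)).
(* The factor [c] pays for the replacement of a ball by a rational one of up to three times its
   radius. *)
pose bad (b : H * R) := [/\ (0 < b.2)%R, (9 * b.2 <= 1)%R &
  c%:E * mu (bball b) <= \int[mu]_(y in bball b) f y].
pose s m := [seq b <- map rational_ball (iota 0 m) | `[< bad b >]].
pose U m : set H := \big[setU/set0]_(b <- s m) bball b.
have mball b : measurable (bball b : set H) by exact: measurable_hball.
have mball3 b : measurable (bball3 b : set H) by exact: measurable_hball.
have mU m : measurable (U m) by exact: bigsetU_measurable.
have UP m y : U m y <-> exists2 b, b \in s m & bball b y.
  by rewrite /U -bigcup_seq; split => -[b bs yb]; exists b.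
have U_le m : nu (U m) <= (K * c `^ (- p))%:E * \int[nu]_y f y `^ p.
  have [t [ut ts dt ct]] := vitali_finite (s m).
  have UT : U m `<=` \big[setU/set0]_(b <- t) bball3 b.
    move=> y /UP[b bs yb]; have [b' b't sub] := ct b bs.
    by rewrite -bigcup_seq; exists b' => //; exact: sub.
  apply: le_trans (_ : nu (\big[setU/set0]_(b <- t) bball3 b) <= _).
    by apply: le_measure => //; rewrite inE//; exact: bigsetU_measurable.
  apply: le_trans (measure_bigsetU_le nu t mball3) _.
  apply: le_trans (_ : \sum_(b <- t) ((K * c `^ (- p))%:E * \int[nu]_(y in bball b) f y `^ p) <= _).
    rewrite big_seq [leRHS]big_seq; apply: lee_sum => b /ts.
    rewrite mem_filter => /andP[/asboolP[b0 b9 Hb] _].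
    exact: HK.
  rewrite -ge0_sume_distrr; last first.
    by move=> b _; apply: integral_ge0 => y _; exact: poweR_ge0.
  rewrite lee_wpmul2l// ?lee_fin ?(ltW C0)//.
  have tt : trivIset [set` t] (bball : H * R -> set H).
    by move=> b b' /= bt b't; exact: dt.
  rewrite -(ge0_integral_bigsetU nu mball ut tt); last 2 first.
  - exact: measurable_funTS.
  - by move=> y _; exact: poweR_ge0.
  by apply: ge0_subset_integral_nonmeasurable => // y _; exact: poweR_ge0.
exists (\bigcup_m U m); split.
- exact: bigcup_measurable.
- move=> x r r0 r27 Hr.
  have [k] := rational_ball_dense x r0.
  set b := rational_ball k => -[xb /andP[b2 b3]].
  exists k.+1 => //; apply/UP; exists b; last first.
    by rewrite /bball/hball/= hdistC; lra.
  have ks : b \in map rational_ball (iota 0 k.+1).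
    by apply: map_f; rewrite mem_iota add0n ltnSn.
  rewrite mem_filter ks andbT.
  apply/asboolP; split; [lra|lra|].
  have := Hc x b.1 r b.2 r0 _ _ _ => /(_ _ _ _)/le_trans; apply; [lra|lra|lra|].
  apply: le_trans (ltW Hr) _.
  apply: ge0_subset_integral_nonmeasurable => // y.
  by apply: hball_sub; rewrite hdistC; lra.
have ndU : {homo U : m m' / (m <= m')%N >-> (m <= m')%O}.
  move=> m m' mm'; apply/subsetPset => y /UP[b bs yb]; apply/UP; exists b => //.
  move: bs; rewrite !mem_filter => /andP[-> /mapP[k km ->]] /=.
  by apply: map_f; move: km; rewrite !mem_iota !add0n => /leq_trans; apply.
have cvU := nondecreasing_cvg_mu mU (bigcup_measurable (fun m _ => mU m)) ndU : nu \o U @ \oo --> _.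
rewrite -(cvg_lim _ cvU)//; apply: lime_le; first by apply/cvg_ex; eexists; exact: cvU.
by apply: nearW => m; exact: U_le.
Qed.

End weak_type_small_radii.

(** * The maximal operator *)

Section hball_volume.
Context {R : realType} {n : nat}.
Local Notation H := (hyperbolic R n).
Local Notation mu := (@hvolume R n).
Hypothesis n2 : (2 <= n)%N.
Local Notation a := (n.-1%:R : R).

Lemma hvolume_hball_fin (x : H) (r : R) : 0 < r ->
  exists2 V : R, 0 < V & mu (hball x r) = V%:E.
Proof.
move=> r0; have [r1|r1] := leP r 1.
  by apply: hvolume_small_fin => //; rewrite r0.
have [c c0 Hc] := @hvolume_hball_ge R n n2.
have [C C0 HC] := @hvolume_hball_le R n n2.
have := Hc x r (ltW r1); have := HC x r.
case: (mu (hball x r)) => [V| |]//; rewrite !lee_fin => _ cV; exists V => //.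
by apply: lt_le_trans cV; rewrite mulr_gt0// expR_gt0.
Qed.

(** Rounding the radius up to an integer costs a factor [expR a]. Radii between 1/27 and 1, beyond
    the small ones, are rounded to 1. *)
Lemma hvolume_hball_ge_nat : exists2 c : R, 0 < c & forall (x : H) (r : R),
  1 < 27 * r -> exists k : nat, [/\ (1 <= k)%N, r <= k%:R &
    ((c * expR (a * k%:R))%:E <= mu (hball x r))%E].
Proof.
have [c c0 Hc] := @hvolume_hball_ge R n n2.
have [c' [C' [c'0 C'0 HC']]] := @hvolume_small_hball R n n2.
pose v := c' * (27^-1) ^+ n.
have v0 : 0 < v by rewrite mulr_gt0// exprn_gt0// invr_gt0.
exists (Num.min c v * expR (- a)); first by rewrite mulr_gt0 ?expR_gt0// lt_min c0.
move=> x r r27; have [r1|r1] := leP r 1.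
  exists 1; split => //; rewrite mulr1 -mulrA -expRD addNr expR0 mulr1.
  apply: (@le_trans _ _ v%:E); first by rewrite lee_fin ge_min lexx orbT.
  have /andP[h _] : ((c' * (27^-1) ^+ n)%:E <= mu (hball x 27^-1) <= (C' * (27^-1) ^+ n)%:E)%E.
    by apply: HC'; rewrite invr_gt0 ltr0n/= invf_le1 ?ler1n.
  apply: le_trans h _; apply: hvolume_mono => y; rewrite /hball/= => h.
  by apply: lt_le_trans h _; lra.
have r0 : 0 <= r by lra.
have /andP[h1 h2] : (Num.trunc r)%:R <= r < (Num.trunc r).+1%:R.
  by rewrite truncnS_gt andbT truncn_le.
exists (Num.trunc r).+1; split => //; first exact: ltW.
apply: le_trans (Hc x r (ltW r1)); rewrite lee_fin -mulrA -expRD.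
apply: ler_pM; rewrite ?expR_ge0//.
- by rewrite le_min !ltW.
- by rewrite ge_min lexx.
- rewrite ler_expR -natr1 mulrDr mulr1 addrCA addNr addr0 ler_wpM2l//.
Qed.

Lemma ball_averageE (f : H -> \bar R) (x : H) (r V : R) : 0 < V ->
  mu (hball x r) = V%:E ->
  (ball_average r f x = (V^-1)%:E * \int[mu]_(y in hball x r) `|f y|)%E.
Proof. by move=> V0 HV; rewrite /ball_average /average HV inver gt_eqF. Qed.

Lemma ball_average_ge0 (f : H -> \bar R) (x : H) (r : R) : (0 <= ball_average r f x)%E.
Proof.
rewrite /ball_average /average mule_ge0//; first by rewrite inve_ge0 measure_ge0.
by apply: integral_ge0 => y _; exact: abse_ge0.
Qed.

Lemma maximal_ge0 (f : H -> \bar R) (x : H) : (0 <= maximal f x)%E.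
Proof.
apply: le_trans (ball_average_ge0 f x 1) _; apply: ereal_sup_ubound.
by exists 1 => //=.
Qed.

Lemma maximal_gt (f : H -> \bar R) (x : H) (l : R) : (l%:E < maximal f x)%E ->
  exists2 r : R, 0 < r &
    (l%:E * mu (hball x r) < \int[mu]_(y in hball x r) `|f y|)%E.
Proof.
move=> /ereal_sup_gt[_ [r /= r0 <-] lr]; exists r => //.
have [V V0 HV] := hvolume_hball_fin x r0.
by move: lr; rewrite (ball_averageE _ V0 HV) lte_pdivlMl// muleC HV.
Qed.

End hball_volume.

Section maximal_bounds.
Local Open Scope ereal_scope.
Context {R : realType} {n : nat}.
Local Notation H := (hyperbolic R n).
Local Notation mu := (@hvolume R n).
Variables (w : weight H R) (p delta Cw : R).
Local Notation nu := (weighted mu w).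
Local Notation a := (n.-1%:R : R).
Hypotheses (n2 : (2 <= n)%N) (p1 : (1 <= p)%R) (delta1 : (delta < 1)%R) (Cw0 : (0 < Cw)%R).
Hypothesis Apw : Ap_loc p w.
Hypothesis kernel_growth : forall r i : nat, (1 <= r)%N ->
  {ae mu, forall y, nu (ysection (hkernel r i) y) <=
    (Cw * expR (a * ((2 * r%:R - i%:R) / 2 * (p - delta) + r%:R * delta)) * w y)%:E}.

Let p0 : (0 < p)%R. Proof. exact: lt_le_trans p1. Qed.

Lemma weak_type_balls : exists2 C : R, (0 < C)%R &
  forall f : H -> \bar R, measurable_fun setT f -> (forall y, 0 <= f y) ->
  exists U : set H, [/\ measurable U,
    forall x (r : R), (0 < r)%R ->
      mu (hball x r) < \int[mu]_(y in hball x r) f y -> U x &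
    nu U <= C%:E * \int[nu]_y f y `^ p].
Proof.
have [Cs Cs0 Hs] := weak_type_small_radii n2 p1 Apw.
have [Cl [L [Cl0 L0 Hl]]] := weak_type_large_radii n2 p1 delta1 Cw0 kernel_growth.
have [c c0 Hc] := @hvolume_hball_ge_nat R n n2.
(* Scaling [f] by [k] turns the lower bound [c * expR (a * j%:R)] of the volume into the level
   [L * expR (a * j%:R)] of the large radii. *)
pose k := (L / c)%R; have k0 : (0 < k)%R by rewrite divr_gt0.
exists (Cs + Cl * k `^ p)%R; first by rewrite addr_gt0// mulr_gt0// powR_gt0.
move=> f mf f0.
have [Us [mUs HUs nUs]] := Hs f mf f0.
pose g y := k%:E * f y.
have mg : measurable_fun setT g by exact: measurable_funeM.
have g0 y : 0 <= g y by rewrite mule_ge0// lee_fin ltW.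
have [Ul [mUl HUl nUl]] := Hl g mg g0.
exists (Us `|` Ul); split; first exact: measurableU.
  move=> x r r0 Hr; have [r27|r27] := leP (27 * r)%R 1%R.
    by left; exact: HUs Hr.
  right; have [j [j1 rj Hj]] := Hc x r r27.
  apply: (HUl x j j1); rewrite ge0_integralZl//; last 3 first.
  - exact: measurable_hball.
  - exact: measurable_funTS.
  - by rewrite lee_fin ltW.
  rewrite (_ : L = k * c)%R; last by rewrite /k divfK// gt_eqF.
  rewrite -mulrA EFinM lte_pmul2l ?lte_fin//.
  apply: le_lt_trans Hj _; apply: lt_le_trans Hr _.
  apply: ge0_subset_integral_nonmeasurable => // y; rewrite /hball/= => xy.
  exact: lt_le_trans rj.
apply: le_trans (measureU2 nu mUs mUl) _.
rewrite EFinD ge0_muleDl ?lee_fin ?(ltW Cs0)//; last by rewrite mulr_ge0 ?powR_ge0// ltW.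
apply: leeD => //; apply: le_trans nUl _.
rewrite EFinM -muleA lee_pmul2l ?lte_fin//.
under eq_integral do rewrite /g poweRM ?lee_fin ?(ltW k0)// poweR_EFin.
rewrite ge0_integralZl//.
- exact: (measurableT_comp (measurable_poweR _)).
- by move=> y _; exact: poweR_ge0.
- by rewrite lee_fin powR_ge0.
Qed.

Lemma weak_type_maximal : exists2 C : R, (0 < C)%R &
  forall (f : H -> \bar R) (l : R), measurable_fun setT f -> (0 < l)%R ->
  exists U : set H, [/\ measurable U,
    forall x, l%:E < maximal f x -> U x &
    nu U <= (C * l `^ (- p))%:E * \int[nu]_y `|f y| `^ p].
Proof.
have [C C0 HC] := weak_type_balls; exists C => // f l mf l0.
pose g y := (l^-1)%:E * `|f y|.
have mg : measurable_fun setT g by apply: measurable_funeM; exact: measurableT_comp.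
have g0 y : 0 <= g y by rewrite mule_ge0// lee_fin invr_ge0 ltW.
have [U [mU HU nU]] := HC g mg g0; exists U; split => //.
  move=> x /(maximal_gt n2)[r r0 Hr]; apply: (HU x r r0).
  rewrite ge0_integralZl//; last 3 first.
  - exact: measurable_hball.
  - by apply: measurable_funTS; exact: measurableT_comp.
  - by rewrite lee_fin invr_ge0 ltW.
  by rewrite lte_pdivlMl.
apply: le_trans nU _; rewrite EFinM -muleA lee_pmul2l ?lte_fin//.
under eq_integral do rewrite /g poweRM ?lee_fin ?invr_ge0 ?(ltW l0)// poweR_EFin.
rewrite ge0_integralZl//; last 3 first.
- by apply: (measurableT_comp (measurable_poweR _)); exact: measurableT_comp.
- by move=> y _; exact: poweR_ge0.
- by rewrite lee_fin powR_ge0.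
by rewrite -powR_inv1 ?(ltW l0)// -powRrM mulN1r.
Qed.

(** Values of [f] at most [l] add at most [l] to any average, so an average above [2 * l] leaves
    more than [l] to the larger values. *)
Lemma weak_type_truncated : exists2 C : R, (0 < C)%R &
  forall (f : H -> \bar R) (l : R), measurable_fun setT f -> (0 < l)%R ->
  exists U : set H, [/\ measurable U,
    forall x, (2 * l)%:E < maximal f x -> U x &
    nu U <= (C * l `^ (- p))%:E *
      \int[nu]_y (if l%:E < `|f y| then `|f y| `^ p else 0)].
Proof.
have [C C0 HC] := weak_type_maximal; exists C => // f l mf l0.
pose g y := if l%:E < `|f y| then `|f y| else 0.
have maf : measurable_fun setT (fun y => `|f y|) by exact: measurableT_comp.
have mb : measurable_fun setT (fun y => l%:E < `|f y|).
  exact: measurable_fun_lte.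
have mg : measurable_fun setT g by exact: measurable_fun_ifT.
have g0 y : 0 <= g y by rewrite /g; case: ifPn.
have [U [mU HU nU]] := HC g l mg l0; exists U; split => //.
  move=> x /(maximal_gt n2)[r r0 Hr]; apply: HU.
  have [V V0 HV] := hvolume_hball_fin n2 x r0.
  apply: (@lt_le_trans _ _ (ball_average r g x)); last first.
    by apply: ereal_sup_ubound; exists r.
  rewrite (ball_averageE _ V0 HV) lte_pdivlMl//.
  have : \int[mu]_(y in hball x r) `|f y| <=
      (l * V)%:E + \int[mu]_(y in hball x r) `|g y|.
    apply: le_trans (_ : \int[mu]_(y in hball x r) (l%:E + `|g y|) <= _).
      apply: ge0_le_integral_nonmeasurable => // y _; rewrite /g; case: ifPn => fl.
        by rewrite abse_id leeDr// lee_fin ltW.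
      by rewrite abse0 adde0 leNgt.
    rewrite ge0_integralD//; last 3 first.
    - exact: measurable_hball.
    - by move=> y _; rewrite lee_fin ltW.
    - by apply: measurable_funTS; exact: measurableT_comp.
    rewrite integral_cst; last exact: measurable_hball.
    by rewrite EFinM -HV.
  move=> h; have := lt_le_trans Hr h; rewrite HV -!EFinM.
  rewrite (_ : 2 * l * V = l * V + V * l)%R; last by ring.
  by rewrite EFinD lteD2lE.
apply: le_trans nU _; rewrite le_eqVlt; apply/orP; left; apply/eqP; congr (_ * _).
apply: eq_integral => y _; rewrite gee0_abs// /g; case: ifPn => // _.
by rewrite poweR0r// gt_eqF.
Qed.

End maximal_bounds.

(** * Strong type *)

Section series_facts.
Local Open Scope ereal_scope.
Context {R : realType}.

Lemma term_le_nneseries (u : nat -> \bar R) (i : nat) : (forall k, 0 <= u k) ->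
  u i <= \sum_(0 <= k <oo) u k.
Proof.
move=> u0; apply: le_trans (nneseries_lim_ge i.+1 _) => //.
by rewrite big_nat_recr//= leeDr// sume_ge0.
Qed.

Lemma nneseries_coef_le (d : nat -> R) (D : R) (X : \bar R) : (forall j, 0 <= d j)%R ->
  (forall m, \sum_(j < m) d j <= D)%R -> 0 <= X ->
  \sum_(0 <= j <oo) (d j)%:E * X <= D%:E * X.
Proof.
move=> d0 dD X0; apply: lime_le.
  by apply: is_cvg_nneseries => j _ _; rewrite mule_ge0// lee_fin.
near=> m; rewrite big_mkord -ge0_sume_distrl; last by move=> i _; rewrite lee_fin.
by rewrite lee_wpmul2r// sumEFin lee_fin.
Unshelve. all: by end_near. Qed.

(** Dyadic levels are indexed by integers; they are split into two families over [nat], with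
    exponents of either sign. *)
Lemma dyadic_level (t : R) : (0 < t)%R -> exists i : nat,
  (2 * 2 ^+ i < t <= 4 * 2 ^+ i)%R \/ (2 * 2 ^- i < t <= 4 * 2 ^- i)%R.
Proof.
move=> t0; have [t2|t2] := ltP 2%R t.
  have ex : exists i : nat, (t <= 4 * 2 ^+ i)%R.
    exists (Num.trunc t); apply: le_trans (ltW (truncnS_gt t)) _.
    apply: (@le_trans _ _ (2 ^+ (Num.trunc t))%R); last first.
      by rewrite ler_peMl ?exprn_ge0// ler1n.
    by rewrite -natrX ler_nat ltn_expl.
  have [i hi mini] := ex_minnP ex; exists i; left; rewrite hi andbT.
  case: i hi mini => [|i] hi mini; first by rewrite expr0 mulr1.
  rewrite ltNge; apply/negP => h.
  have /mini : (t <= 4 * 2 ^+ i)%R by move: h; rewrite exprS; lra.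
  by rewrite ltnn.
have ex : exists i : nat, (2 * 2 ^- i < t)%R.
  exists (Num.trunc (2 / t)); rewrite ltr_pdivrMr ?exprn_gt0// mulrC -ltr_pdivrMr//.
  by apply: lt_le_trans (truncnS_gt _) _; rewrite -natrX ler_nat ltn_expl.
have [i hi mini] := ex_minnP ex; exists i; right; rewrite hi/=.
case: i hi mini => [|i] hi mini.
  by move: hi; rewrite expr0 invr1 mulr1 ltNge t2.
rewrite leNgt; apply/negP => h.
have /mini : (2 * 2 ^- i < t)%R.
  apply: le_lt_trans h; rewrite exprS invfM mulrA le_eqVlt; apply/orP; left.
  by apply/eqP; field; rewrite gt_eqF// exprn_gt0.
by rewrite ltnn.
Qed.

End series_facts.

Section strong_type.
Local Open Scope ereal_scope.
Context {R : realType} {n : nat}.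
Local Notation H := (hyperbolic R n).
Local Notation mu := (@hvolume R n).
Variables (w : weight H R) (p delta Cw : R).
Local Notation nu := (weighted mu w).
Local Notation a := (n.-1%:R : R).
Hypotheses (n2 : (2 <= n)%N) (p1 : (1 <= p)%R) (delta1 : (delta < 1)%R) (Cw0 : (0 < Cw)%R).
Hypothesis Apw : Ap_loc p w.
Hypothesis kernel_growth : forall r i : nat, (1 <= r)%N ->
  {ae mu, forall y, nu (ysection (hkernel r i) y) <=
    (Cw * expR (a * ((2 * r%:R - i%:R) / 2 * (p - delta) + r%:R * delta)) * w y)%:E}.
Variable q : R.
Hypothesis pq : (p < q)%R.

Let p0 : (0 < p)%R. Proof. exact: lt_le_trans p1. Qed.
Let q0 : (0 < q)%R. Proof. exact: lt_trans pq. Qed.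

(** Marcinkiewicz interpolation. Multiplying the truncated weak bound by [s i]^
    q[leaves the series of the]s i [^ (q - p)] over the levels below [|f y|], which [HD] bounds. The
    levels are a parameter so that both signs of the exponent are covered. *)
Let layer_sum_le (s : nat -> R) (D : R) : (forall i, 0 < s i)%R -> (0 < D)%R ->
  (forall t : \bar R, 0 <= t -> \sum_(0 <= i <oo)
     (if (s i `^ (q - p))%:E <= t then (s i `^ (q - p))%:E else 0) <= D%:E * t) ->
  exists2 C : R, (0 < C)%R & forall f : H -> \bar R, measurable_fun setT f ->
    exists U : nat -> set H, [/\ forall i, measurable (U i),
      forall i x, (2 * s i)%:E < maximal f x -> U i x &
      \int[nu]_x \sum_(0 <= i <oo) ((4 * s i) `^ q)%:E * (\1_(U i) x)%:E <=
        C%:E * \int[nu]_y `|f y| `^ q].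
Proof.
move=> s0 D0 HD.
have [C C0 HC] := weak_type_truncated n2 p1 delta1 Cw0 Apw kernel_growth.
exists (4 `^ q * C * D)%R; first by rewrite !mulr_gt0// powR_gt0.
move=> f mf.
have [U HU] := choice (fun i => HC f (s i) mf (s0 i)).
have mU i : measurable (U i) by have [] := HU i.
exists U; split => //; first by move=> i x; have [_ + _] := HU i; apply.
have mi i : measurable_fun setT (fun x => (\1_(U i) x)%:E : \bar R).
  by apply/measurable_EFinP; exact: measurable_indic.
have i0 i x : 0 <= ((4 * s i) `^ q)%:E * (\1_(U i) x)%:E.
  by rewrite mule_ge0// lee_fin// powR_ge0.
rewrite integral_nneseries//; last by move=> i; exact: measurable_funeM.
pose F i y := if (s i)%:E < `|f y| then `|f y| `^ p else 0.
have F0 i y : 0 <= F i y by rewrite /F; case: ifPn => // _; exact: poweR_ge0.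
have maf : measurable_fun setT (fun y => `|f y|) by exact: measurableT_comp.
have mF i : measurable_fun setT (F i).
  apply: measurable_fun_ifT => //; first exact: measurable_fun_lte.
  exact: (measurableT_comp (measurable_poweR _)).
apply: le_trans (_ : \sum_(0 <= i <oo) \int[nu]_y
   ((4 `^ q * C)%:E * ((s i `^ (q - p))%:E * F i y)) <= _).
  apply: lee_nneseries => [i _ _|i _]; first exact: integral_ge0.
  have si0 := s0 i.
  rewrite ge0_integralZl//; last by rewrite lee_fin powR_ge0.
  rewrite integral_indic// setIT.
  have [_ _ nU] := HU i.
  have c1 : 0 <= ((4 * s i) `^ q)%:E by rewrite lee_fin powR_ge0.
  apply: le_trans (lee_wpmul2l c1 nU) _.
  have c2 : 0 <= (4 `^ q * C)%:E by rewrite lee_fin mulr_ge0 ?powR_ge0// ltW.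
  have c3 : 0 <= (s i `^ (q - p))%:E by rewrite lee_fin powR_ge0.
  rewrite ge0_integralZl//; last 2 first.
  - exact: measurable_funeM.
  - by move=> y _; exact: mule_ge0.
  have IF0 : 0 <= \int[nu]_y F i y by apply: integral_ge0 => y _; exact: F0.
  rewrite ge0_integralZl// muleA muleA -!EFinM; apply: (lee_wpmul2r IF0).
  rewrite lee_fin powRM ?(ltW si0)// powRD; last by rewrite (gt_eqF si0) implybT.
  by rewrite le_eqVlt; apply/orP; left; apply/eqP; ring.
have c2 : 0 <= (4 `^ q * C)%:E by rewrite lee_fin mulr_ge0 ?powR_ge0// ltW.
have t0 i y : 0 <= (s i `^ (q - p))%:E * F i y by rewrite mule_ge0// lee_fin powR_ge0.
rewrite -integral_nneseries//; last 2 first.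
- by move=> i; apply: measurable_funeM; exact: measurable_funeM.
- by move=> i y _; exact: mule_ge0.
have mfq : measurable_fun setT (fun y => `|f y| `^ q).
  exact: (measurableT_comp (measurable_poweR _)).
have c4 : 0 <= (4 `^ q * C * D)%:E by rewrite lee_fin !mulr_ge0 ?powR_ge0 ?(ltW C0) ?(ltW D0).
rewrite -ge0_integralZl//; last by move=> y _; exact: poweR_ge0.
apply: ge0_le_integral_nonmeasurable => y _.
  by apply: nneseries_ge0 => i _ _; exact: mule_ge0.
rewrite nneseriesZl// (EFinM (4 `^ q * C)%R) -muleA lee_wpmul2l//.
have -> : `|f y| `^ q = `|f y| `^ (q - p) * `|f y| `^ p.
  by rewrite -poweRD ?subrK// add_neq0_poweRD_def// subrK gt_eqF.
have : 0 <= `|f y| by exact: abse_ge0.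
rewrite /F; case: (`|f y|) => [t| |]// t00; last first.
  by rewrite !poweRyr ?gt_eqF ?subr_gt0// mulyy gt0_muley ?lte_fin// leey.
apply: le_trans (_ : t%:E `^ p * \sum_(0 <= i <oo)
   (if (s i `^ (q - p))%:E <= t%:E `^ (q - p) then (s i `^ (q - p))%:E else 0) <= _).
  rewrite poweR_EFin -nneseriesZl//; last first.
    by move=> i _; case: ifPn => // _; rewrite lee_fin powR_ge0.
  apply: lee_nneseries => [i _ _|i _].
    by rewrite mule_ge0 ?lee_fin ?powR_ge0//; case: ifPn => // _; rewrite lee_fin powR_ge0.
  case: ifPn => [sf|_]; last first.
    rewrite mule0 mule_ge0 ?lee_fin ?powR_ge0//.
    by case: ifPn => // _; rewrite lee_fin powR_ge0.
  rewrite ifT 1?muleC// -poweR_EFin.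
  by apply: lee_poweR; [rewrite subr_ge0 ltW|rewrite lee_fin ltW|exact: ltW].
rewrite muleA (muleC (D%:E * _)) lee_wpmul2l ?poweR_ge0//.
exact: HD (poweR_ge0 _ _).
Qed.

Lemma strong_type_maximal : exists2 C : R, (0 < C)%R &
  forall f : H -> \bar R, measurable_fun setT f ->
    exists Phi : H -> \bar R, [/\ measurable_fun setT Phi,
      forall x, maximal f x `^ q <= Phi x &
      \int[nu]_x Phi x <= C%:E * \int[nu]_y `|f y| `^ q].
Proof.
pose rho : R := (2 `^ (q - p))%R.
have rho1 : (1 < rho)%R.
  by rewrite /rho /powR pnatr_eq0/= expR_gt1 mulr_gt0 ?subr_gt0// ln_gt0// ltr1n.
have rho0 : (0 < rho)%R by exact: lt_trans rho1.
have D0 : (0 < rho / (rho - 1))%R by rewrite divr_gt0// subr_gt0.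
have e1 i : ((2 ^+ i) `^ (q - p) = rho ^+ i)%R.
  by rewrite -powR_mulrn// -powRrM mulrC powRrM powR_mulrn ?powR_ge0.
have e2 i : ((2 ^- i) `^ (q - p) = rho ^- i)%R.
  by rewrite -powR_inv1 ?exprn_ge0// -powRrM mulrC powRrM e1 powR_inv1// exprn_ge0// ltW.
have [C1 C10 H1] : exists2 C : R, (0 < C)%R & forall f : H -> \bar R, measurable_fun setT f ->
    exists U : nat -> set H, [/\ forall i, measurable (U i),
      forall i x, (2 * 2 ^+ i)%:E < maximal f x -> U i x &
      \int[nu]_x \sum_(0 <= i <oo) ((4 * 2 ^+ i) `^ q)%:E * (\1_(U i) x)%:E <=
        C%:E * \int[nu]_y `|f y| `^ q].
  apply: layer_sum_le D0 _ => [i|t t0]; first by rewrite exprn_gt0.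
  by under eq_eseriesr do rewrite e1; exact: nneseries_cutoff.
have [C2 C20 H2] : exists2 C : R, (0 < C)%R & forall f : H -> \bar R, measurable_fun setT f ->
    exists U : nat -> set H, [/\ forall i, measurable (U i),
      forall i x, (2 * 2 ^- i)%:E < maximal f x -> U i x &
      \int[nu]_x \sum_(0 <= i <oo) ((4 * 2 ^- i) `^ q)%:E * (\1_(U i) x)%:E <=
        C%:E * \int[nu]_y `|f y| `^ q].
  apply: layer_sum_le D0 _ => [i|t t0]; first by rewrite invr_gt0 exprn_gt0.
  by under eq_eseriesr do rewrite e2; exact: nneseries_cutoffV.
exists (C1 + C2)%R; first by rewrite addr_gt0.
move=> f mf; have [U1 [mU1 HU1 I1]] := H1 f mf; have [U2 [mU2 HU2 I2]] := H2 f mf.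
pose Phi1 x := \sum_(0 <= i <oo) ((4 * 2 ^+ i) `^ q)%:E * (\1_(U1 i) x)%:E.
pose Phi2 x := \sum_(0 <= i <oo) ((4 * 2 ^- i) `^ q)%:E * (\1_(U2 i) x)%:E.
have t10 i x : 0 <= ((4 * 2 ^+ i) `^ q)%:E * (\1_(U1 i) x)%:E.
  by rewrite mule_ge0// lee_fin// powR_ge0.
have t20 i x : 0 <= ((4 * 2 ^- i) `^ q)%:E * (\1_(U2 i) x)%:E.
  by rewrite mule_ge0// lee_fin// powR_ge0.
have P10 x : 0 <= Phi1 x by exact: nneseries_ge0.
have P20 x : 0 <= Phi2 x by exact: nneseries_ge0.
have mP1 : measurable_fun setT Phi1.
  apply: ge0_emeasurable_sum => // i _; apply: measurable_funeM.
  by apply/measurable_EFinP; exact: measurable_indic.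
have mP2 : measurable_fun setT Phi2.
  apply: ge0_emeasurable_sum => // i _; apply: measurable_funeM.
  by apply/measurable_EFinP; exact: measurable_indic.
exists (fun x => Phi1 x + Phi2 x); split.
- exact: emeasurable_funD.
- move=> x; have := maximal_ge0 f x.
  case Em : (maximal f x) => [t| |]//; last first.
    (* Every level is exceeded, so [x] is in all the [U1 i], and the terms of [Phi1 x] are
       unbounded. *)
    move=> _; rewrite (_ : Phi1 x = +oo); first by rewrite addye ?leey// gt_eqF// (lt_le_trans _ (P20 x)).
    apply: eq_infty => v; apply: le_trans (term_le_nneseries (Num.trunc v) (fun i => t10 i x)).
    rewrite indicE mem_set; last by apply: HU1; rewrite Em ltry.
    rewrite mule1 lee_fin; apply: le_trans (ltW (truncnS_gt v)) _.
    set m := Num.trunc v.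
    have h1 : (1 <= 4 * 2 ^+ m :> R)%R by rewrite mulr_ege1// ?ler1n// exprn_ege1// ler1n.
    apply: (@le_trans _ _ (4 * 2 ^+ m)%R).
      apply: (@le_trans _ _ (2 ^+ m)%R); last by rewrite ler_peMl ?exprn_ge0// ler1n.
      by rewrite -natrX ler_nat ltn_expl.
    rewrite -[leLHS]powRr1; last by rewrite (le_trans ler01).
    by apply: ler_powR => //; rewrite (le_trans p1)// ltW.
  rewrite lee_fin le_eqVlt => /predU1P[<-|t0].
    by rewrite poweR0r ?gt_eqF// adde_ge0.
  have [i [/andP[h1 h2]|/andP[h1 h2]]] := dyadic_level t0.
    apply: le_trans (_ : Phi1 x <= _); last by rewrite leeDl.
    apply: le_trans (term_le_nneseries i (fun i => t10 i x)).
    rewrite indicE mem_set; last by apply: HU1; rewrite Em lte_fin.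
    rewrite mule1 -poweR_EFin; apply: lee_poweR; rewrite ?lee_fin ?(ltW q0)//.
    exact: ltW.
  apply: le_trans (_ : Phi2 x <= _); last by rewrite leeDr.
  apply: le_trans (term_le_nneseries i (fun i => t20 i x)).
  rewrite indicE mem_set; last by apply: HU2; rewrite Em lte_fin.
  rewrite mule1 -poweR_EFin; apply: lee_poweR; rewrite ?lee_fin ?(ltW q0)//.
  exact: ltW.
rewrite ge0_integralD// EFinD ge0_muleDl ?lee_fin ?(ltW C10) ?(ltW C20)//.
exact: leeD.
Qed.

Lemma strong_type_ball_series (gamma : R) : (0 <= gamma)%R ->
  exists2 C : R, (0 < C)%R & forall f : H -> \bar R, measurable_fun setT f ->
    exists W : H -> \bar R, [/\ measurable_fun setT W, forall x, 0 <= W x,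
      forall x, (\sum_(1 <= j <oo) (j%:R `^ gamma)%:E * ball_average j%:R f x) `^ q <= W x &
      \int[nu]_x W x <= C%:E * \int[nu]_y `|f y| `^ q].
Proof.
move=> gamma0.
have [c c0 Hc] := @hvolume_hball_ge R n n2.
have [C [kappa [C0 kappa0 HC]]] := strong_type_ball_integral n2 p1 delta1 Cw0 kernel_growth pq.
have kq : (0 < kappa / 2 / q)%R by rewrite !divr_gt0.
have [G G0 HG] := sum_expRN_le kq.
have k4 : (0 < kappa / 4)%R by rewrite divr_gt0.
have [G' G'0 HG'] := sum_expRN_le k4.
(* [A] is the total power of [2 * j + 1] to be absorbed. Of the decay [kappa * j], half pays for the
   weights [b j] below and a quarter for this power, through [ep]; the last quarter is summed. *)
pose A : R := (gamma * q + (q + 1))%R.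
have A0 : (0 < A)%R by rewrite ltr_wpDl ?mulr_ge0 ?(ltW q0)// addr_gt0.
pose ep : R := (kappa / (8 * A))%R.
have ep0 : (0 < ep)%R by rewrite divr_gt0// mulr_gt0.
pose D : R := (C * c `^ (- q) * ep `^ (- A) * expR (kappa / 8))%R.
have D0 : (0 < D)%R by rewrite !mulr_gt0 ?expR_gt0 ?powR_gt0.
exists (G `^ q * (D * G'))%R.
  by apply: mulr_gt0; [exact: powR_gt0|exact: mulr_gt0].
move=> f mf.
have maf : measurable_fun setT (fun y => `|f y|) by exact: measurableT_comp.
pose I j x := \int[mu]_(y in hball x j%:R) `|f y|.
have I0 j x : 0 <= I j x by exact: integral_ge0.
have mI j : measurable_fun setT (I j) by exact: measurable_ball_integral.
pose K (j : nat) : R := (if j == 0%N then 0 else j%:R `^ gamma * (c * expR (a * j%:R))^-1)%R.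
have K0 j : (0 <= K j)%R.
  rewrite /K; case: ifPn => // _.
  by rewrite mulr_ge0 ?powR_ge0// invr_ge0 mulr_ge0 ?expR_ge0// ltW.
pose v j x := (K j)%:E * I j x.
have v0 j x : 0 <= v j x by rewrite mule_ge0// lee_fin.
pose b (j : nat) : R := expR (kappa / 2 * j%:R).
pose cc (j : nat) : R := expR (- (kappa / 2 / q * j%:R)).
have b0 j : (0 <= b j)%R by exact: expR_ge0.
have bv0 j x : 0 <= (b j)%:E * v j x `^ q by rewrite mule_ge0 ?poweR_ge0// lee_fin.
have Gq0 : 0 <= (G `^ q)%:E by rewrite lee_fin powR_ge0.
have mbv j : measurable_fun setT (fun x => (b j)%:E * v j x `^ q).
  apply: measurable_funeM; apply: (measurableT_comp (measurable_poweR _)).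
  exact: measurable_funeM.
pose W0 x := \sum_(0 <= j <oo) (b j)%:E * v j x `^ q.
have mW0 : measurable_fun setT W0 by apply: ge0_emeasurable_sum.
have W00 x : 0 <= W0 x by exact: nneseries_ge0.
exists (fun x => (G `^ q)%:E * W0 x); split.
- exact: measurable_funeM.
- by move=> x; exact: mule_ge0.
- move=> x; apply: le_trans (_ : (\sum_(0 <= j <oo) v j x) `^ q <= _).
    apply: lee_poweR; first exact: ltW.
      by apply: nneseries_ge0 => j _ _; rewrite mule_ge0 ?ball_average_ge0.
    rewrite ereal_series_cond eseries_mkcond; apply: lee_nneseries => [j _ _|j _].
      by case: ifPn => // _; rewrite mule_ge0 ?ball_average_ge0.
    rewrite andbT; case: ifPn => // j1; rewrite /v /K gtn_eqF//.
    have j0 : (0 < j%:R :> R)%R by rewrite ltr0n.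
    have [V V0 HV] := hvolume_hball_fin n2 x j0.
    rewrite (ball_averageE _ V0 HV) EFinM -muleA.
    apply: lee_wpmul2l; first by rewrite lee_fin powR_ge0.
    apply: (lee_wpmul2r (I0 j x)).
    rewrite lee_fin lef_pV2 ?posrE ?mulr_gt0 ?expR_gt0//.
    by rewrite -lee_fin -HV Hc// ler1n.
  apply: (@poweR_series _ _ b cc) => //.
  - by move=> j; exact: expR_ge0.
  - move=> j; rewrite /b /cc -expRM -expRD.
    rewrite (_ : _ + _ = 0)%R ?expR0//; field.
    by rewrite gt_eqF.
rewrite ge0_integralZl// (EFinM (G `^ q)%R) -muleA lee_wpmul2l//.
rewrite integral_nneseries//.
set X := \int[nu]_y _.
have X0 : 0 <= X by apply: integral_ge0 => y _; exact: poweR_ge0.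
have ke m : (\sum_(j < m) D * expR (- (kappa / 4 * j%:R)) <= D * G')%R.
  by rewrite -mulr_sumr ler_pM2l.
have d0 j : (0 <= D * expR (- (kappa / 4 * j%:R)))%R by rewrite mulr_ge0 ?expR_ge0// ltW.
apply: le_trans (nneseries_coef_le d0 ke X0).
apply: lee_nneseries => [j _ _|j _]; first exact: integral_ge0.
have [->|j0] := posnP j.
  rewrite (_ : \int[nu]_x _ = 0); last first.
    by apply: integral0_eq => x _; rewrite /v /K/= mul0e poweR0r ?gt_eqF// mule0.
  by rewrite mule_ge0// lee_fin mulr_ge0 ?expR_ge0// ltW.
have bK x : (b j)%:E * v j x `^ q = (b j * K j `^ q)%:E * I j x `^ q.
  by rewrite /v poweRM ?lee_fin// poweR_EFin muleA -EFinM.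
under eq_integral do rewrite bK.
rewrite ge0_integralZl//; last 3 first.
- exact: (measurableT_comp (measurable_poweR _)).
- by move=> x _; exact: poweR_ge0.
- by rewrite lee_fin mulr_ge0// powR_ge0.
have af0 y : 0 <= `|f y| by exact: abse_ge0.
have c5 : 0 <= (b j * K j `^ q)%:E by rewrite lee_fin mulr_ge0// powR_ge0.
apply: le_trans (lee_wpmul2l c5 (HC _ j maf af0 j0)) _.
rewrite muleA -EFinM lee_wpmul2r// lee_fin.
have jr : (0 <= j%:R :> R)%R by [].
have J1 : (0 < (2 * j).+1%:R :> R)%R by rewrite ltr0n.
rewrite /K gtn_eqF// powRM ?powR_ge0 ?invr_ge0 ?mulr_ge0 ?expR_ge0 ?(ltW c0)//.
rewrite -powR_inv1 ?mulr_ge0 ?expR_ge0 ?(ltW c0)// -!powRrM mulN1r.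
rewrite powRM ?expR_ge0 ?(ltW c0)// -expRM.
have hj : (j%:R `^ (gamma * q) <= (2 * j).+1%:R `^ (gamma * q) :> R)%R.
  apply: ge0_ler_powR; rewrite ?nnegrE ?mulr_ge0 ?(ltW q0)// ler_nat.
  by rewrite leqW// leq_pmull.
have hA : ((2 * j).+1%:R `^ A <= ep `^ (- A) * expR (kappa / 8 + kappa / 4 * j%:R) :> R)%R.
  have h : ((2 * j).+1%:R <= ep^-1 * expR (ep * (2 * j).+1%:R) :> R)%R.
    rewrite ler_pdivlMl//; apply: le_trans (expR_ge1Dx _).
    by rewrite lerDr.
  apply: le_trans (ge0_ler_powR (ltW A0) _ _ h) _; rewrite ?nnegrE//.
    by rewrite mulr_ge0 ?expR_ge0// invr_ge0 ltW.
  rewrite powRM ?invr_ge0 ?expR_ge0 ?(ltW ep0)// -expRM -powR_inv1 ?(ltW ep0)//.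
  rewrite -powRrM mulN1r ler_pM2l ?powR_gt0// ler_expR -natr1 natrM.
  by rewrite /ep le_eqVlt; apply/orP; left; apply/eqP; field; rewrite gt_eqF.
apply: (@le_trans _ _ (C * c `^ (- q) * expR (- (kappa / 2 * j%:R)) * (2 * j).+1%:R `^ A)%R).
  rewrite /A [X in (_ <= _ * X)%R]powRD; last by rewrite pnatr_eq0 implybT.
  rewrite /b (_ : expR (- _) = expR (kappa / 2 * j%:R) * expR (a * j%:R * - q) *
     expR ((a * q - kappa) * j%:R))%R; last by rewrite -!expRD; congr expR; field.
  set e1 := expR _; set e2 := expR _; set e3 := expR _.
  rewrite [leLHS](_ : _ = (C * c `^ (- q) * (e1 * e2 * e3)) *
     (j%:R `^ (gamma * q) * (2 * j).+1%:R `^ (q + 1)))%R; last by ring.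
  rewrite ler_wpM2l//; last by rewrite ler_wpM2r// powR_ge0.
  by rewrite !mulr_ge0 ?expR_ge0 ?powR_ge0// ltW.
have c6 : (0 <= C * c `^ (- q) * expR (- (kappa / 2 * j%:R)))%R.
  by rewrite !mulr_ge0 ?expR_ge0 ?powR_ge0// ltW.
apply: le_trans (ler_wpM2l c6 hA) _.
rewrite /D [leLHS](_ : _ = C * c `^ (- q) * ep `^ (- A) *
  (expR (- (kappa / 2 * j%:R)) * expR (kappa / 8 + kappa / 4 * j%:R)))%R; last by ring.
rewrite -[leRHS]mulrA -!expRD ler_wpM2l//.
  by rewrite !mulr_ge0 ?powR_ge0// ltW.
by rewrite ler_expR le_eqVlt; apply/orP; left; apply/eqP; field.
Qed.

End strong_type.

Theorem corollary1p6 (R : realType) (n : nat) (p : R)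
    (w : weight (hyperbolic R n) R) :
  (2 <= n)%N -> 1 <= p -> Ap_loc p w ->
  (exists delta : R, delta < 1 /\
     exists C : R, 0 < C /\
       forall j l r : nat, (1 <= j)%N -> (1 <= l)%N -> (1 <= r)%N ->
         `|l%:R - j%:R| <= r%:R :> R ->
         {ae @hvolume R n, forall x, hshell j x ->
           (weighted hvolume w (hshell l `&` hball x r%:R) <=
             (C * expR ((n%:R - 1) * ((r%:R + l%:R - j%:R) / 2) * (p - delta))
                * expR ((n%:R - 1) * r%:R * delta) * w x)%:E)%E}) ->
  (exists C : R, 0 < C /\
     forall f : hyperbolic R n -> \bar R, measurable_fun setT f ->
       (weak_Lnorm (weighted hvolume w) p (maximal f) <=
         C%:E * 'N[weighted hvolume w]_p%:E [f])%E) /\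
  (forall q : R, p < q ->
     forall T : (hyperbolic R n -> \bar R) -> (hyperbolic R n -> \bar R),
       (forall f : hyperbolic R n -> \bar R,
          measurable_fun setT f -> measurable_fun setT (T f)) ->
       (exists gamma : R, 0 <= gamma /\
          exists C : R, 0 < C /\
            forall f : hyperbolic R n -> \bar R, measurable_fun setT f ->
            forall x : hyperbolic R n,
              (`|T f x| <= C%:E * (local_maximal (abse \o f) x +
                 \sum_(1 <= j <oo) (j%:R `^ gamma)%:E *
                                   ball_average j%:R (abse \o f) x))%E) ->
       exists C : R, 0 < C /\
         forall f : hyperbolic R n -> \bar R, measurable_fun setT f ->
           ('N[weighted hvolume w]_q%:E [T f] <=
             C%:E * 'N[weighted hvolume w]_q%:E [f])%E).
Proof.
move=> n2 p1 Apw [delta [delta1 [C0 [C00 growth]]]].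
have p0 : 0 < p by exact: lt_le_trans p1.
have nE : n%:R - 1 = n.-1%:R :> R by rewrite -[in LHS](prednK (ltnW n2)) -natr1 addrK.
have kernel_growth (r i : nat) : (1 <= r)%N ->
    {ae @hvolume R n, forall y, (weighted hvolume w (ysection (hkernel r i) y) <=
      (C0 * expR (n.-1%:R * ((2 * r%:R - i%:R) / 2 * (p - delta) + r%:R * delta)) * w y)%:E)%E}.
  by rewrite -nE; exact: weighted_hkernel_le.
split.
  have [C Cpos HC] := weak_type_maximal n2 p1 delta1 C00 Apw kernel_growth.
  exists (C `^ p^-1); split; first exact: powR_gt0.
  move=> f mf; apply: ge_ereal_sup => _ [l /= l0 <-].
  have [U [mU HU nU]] := HC f l mf l0.
  set X := (\int[weighted hvolume w]_y `|f y| `^ p)%E in nU.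
  have X0 : (0 <= X)%E by apply: integral_ge0 => y _; exact: poweR_ge0.
  (* The superlevel set is compared with the measurable set [U] by monotonicity of the integral
     alone. *)
  have nle : (weighted hvolume w [set x | (l%:E < `|maximal f x|)%E] <= weighted hvolume w U)%E.
    apply: ge0_subset_integral_nonmeasurable => x; last by rewrite lee_fin weight_ge0.
    by rewrite /= gee0_abs ?maximal_ge0//; exact: HU.
  have pV0 : 0 <= p^-1 by rewrite invr_ge0 ltW.
  apply: (@le_trans _ _ (l%:E * ((C * l `^ (- p))%:E * X) `^ p^-1)%E).
    rewrite lee_wpmul2l ?lee_fin ?(ltW l0)//.
    apply: lee_poweR => //.
    exact: le_trans nle nU.
  rewrite unlock -/X poweRM ?lee_fin ?mulr_ge0 ?powR_ge0 ?(ltW Cpos)//.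
  rewrite poweR_EFin powRM ?powR_ge0 ?(ltW Cpos)// -powRrM mulNr mulfV ?gt_eqF//.
  rewrite powR_inv1 ?(ltW l0)// muleA -EFinM mulrCA mulfV ?gt_eqF// mulr1.
  by [].
move=> q pq T mT [gamma [gamma0 [CT [CT0 HT]]]].
have q0 : 0 < q by exact: lt_trans pq.
have [C1 C10 H1] := strong_type_maximal n2 p1 delta1 C00 Apw kernel_growth pq.
have [C2 C20 H2] := strong_type_ball_series n2 p1 delta1 C00 kernel_growth pq gamma0.
pose K := CT `^ q * 2 `^ q * (C1 + C2).
have K0 : 0 < K by rewrite !mulr_gt0 ?powR_gt0// addr_gt0.
exists (K `^ q^-1); split; first exact: powR_gt0.
move=> f mf; pose g := (abse \o f : hyperbolic R n -> \bar R).
have mg : measurable_fun setT g by exact: measurableT_comp.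
have [Phi [mPhi HPhi IPhi]] := H1 g mg.
have [W [mW W0 HW IW]] := H2 g mg.
set X := (\int[weighted hvolume w]_y `|f y| `^ q)%E.
have gX : (\int[weighted hvolume w]_y `|g y| `^ q = X)%E.
  by apply: eq_integral => y _; rewrite /g/= abse_id.
rewrite gX in IPhi IW.
have X0 : (0 <= X)%E by apply: integral_ge0 => y _; exact: poweR_ge0.
have Phi0 x : (0 <= Phi x)%E by exact: le_trans (poweR_ge0 _ _) (HPhi x).
have c0 : (0 <= (CT `^ q * 2 `^ q)%:E)%E by rewrite lee_fin mulr_ge0 ?powR_ge0.
have pointwise x : (`|T f x| `^ q <= (CT `^ q * 2 `^ q)%:E * (Phi x + W x))%E.
  set S := (\sum_(1 <= j <oo) (j%:R `^ gamma)%:E * ball_average j%:R g x)%E.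
  have S0 : (0 <= S)%E.
    by apply: nneseries_ge0 => j _ _; rewrite mule_ge0 ?ball_average_ge0// lee_fin powR_ge0.
  have Tx : (`|T f x| <= CT%:E * (maximal g x + S))%E.
    apply: le_trans (HT f mf x) _; rewrite lee_wpmul2l ?lee_fin ?(ltW CT0)//.
    (* The local maximal function is a supremum over fewer radii. *)
    rewrite leeD2r//; apply: ereal_sup_le => _ [r /= /andP[r0 _] <-].
    by exists r.
  apply: le_trans (lee_poweR (ltW q0) (abse_ge0 _) Tx) _.
  rewrite poweRM ?lee_fin ?(ltW CT0) ?adde_ge0 ?maximal_ge0// poweR_EFin EFinM -muleA.
  rewrite lee_wpmul2l ?lee_fin ?powR_ge0//.
  apply: le_trans (poweR_add2 q0 (maximal_ge0 g x) S0) _.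
  apply: lee_wpmul2l; first by rewrite lee_fin powR_ge0.
  by apply: leeD; [exact: HPhi|exact: HW].
have main : (\int[weighted hvolume w]_y `|T f y| `^ q <= K%:E * X)%E.
  apply: (@le_trans _ _ (\int[weighted hvolume w]_x
      ((CT `^ q * 2 `^ q)%:E * (Phi x + W x)))%E).
    by apply: ge0_le_integral_nonmeasurable => x _; [exact: poweR_ge0|exact: pointwise].
  rewrite ge0_integralZl//; last 2 first.
  - exact: emeasurable_funD.
  - by move=> x _; exact: adde_ge0.
  rewrite /K (EFinM (CT `^ q * 2 `^ q)) -muleA; apply: (lee_wpmul2l c0).
  rewrite ge0_integralD// EFinD ge0_muleDl ?lee_fin ?(ltW C10) ?(ltW C20)//.
  exact: leeD.
rewrite unlock -/X -poweR_EFin -poweRM ?lee_fin ?(ltW K0)//.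
apply: lee_poweR => //; first by rewrite invr_ge0 ltW.
by apply: integral_ge0 => y _; exact: poweR_ge0.
Qed.
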